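(* Let $D\subset\mathbb{R}^d$, $d\ge 2$, be an open, bounded, connected set with Lipschitz boundary. Let $\nu$ be a probability measure on $D$ with continuous density $\rho$ (with respect to Lebesgue measure), which is bounded from below and above by positive constants. Let $X_1,\dots,X_n,\dots$ be a sequence of i.i.d. random points chosen according to the distribution $\nu$ on $D$. Let $\{\varepsilon_n\}_{n\in\mathbb{N}}$ be a sequence of positive numbers converging to $0$ and satisfying $$\lim_{n\to\infty}\frac{(\log n)^{3/4}}{n^{1/2}}\frac1{\varepsilon_n}=0\ \text{ if } d=2,\qquad \lim_{n\to\infty}\frac{(\log n)^{1/d}}{n^{1/d}}\frac1{\varepsilon_n}=0\ \text{ if } d\ge 3.$$ Assume that the kernel $\eta$ satisfies conditions (K1)-(K3) stated in the context. Then, with probability one, the following holds: for every sequence of functions $u_n\in L^1(D,\nu_n)$, $n\in\mathbb{N}$, such that $$\sup_{n\in\mathbb{N}}\|u_n\|_{L^1(D,\nu_n)}<\infty\quad\text{and}\quad\sup_{n\in\mathbb{N}}GTV_{n,\varepsilon_n}(u_n)<\infty,$$ the sequence $\{u_n\}_{n\in\mathbb{N}}$ is relatively compact in $TL^1$.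
   Context: Kernel. $\eta:\mathbb{R}^d\to[0,\infty)$ is given by $\eta(x)=\boldsymbol{\eta}(|x|)$ with radial profile $\boldsymbol{\eta}:[0,\infty)\to[0,\infty)$. The conditions are: (K1) $\boldsymbol{\eta}(0)>0$ and $\boldsymbol{\eta}$ is continuous at $0$; (K2) $\boldsymbol{\eta}$ is non-increasing; (K3) $\int_0^\infty\boldsymbol{\eta}(r)r^d\,dr<\infty$. Set $\eta_\varepsilon(z)=\varepsilon^{-d}\eta(z/\varepsilon)$. Empirical measure: $\nu_n=\frac1n\sum_{i=1}^n\delta_{X_i}$. Graph total variation: for $u\in L^1(D,\nu_n)$ (a function on the data points), $$GTV_{n,\varepsilon}(u)=\frac1\varepsilon\frac1{n^2}\sum_{i,j=1}^n\eta_\varepsilon(X_i-X_j)|u(X_i)-u(X_j)|.$$ The space $TL^1$: let $\mathcal{P}(D)$ be the set of Borel probability measures on $D$ and $TL^1(D)=\{(\mu,f):\mu\in\mathcal{P}(D),\ f\in L^1(D,\mu)\}$, with metric $$d_{TL^1}((\mu,f),(\theta,g))=\inf_{\pi\in\Gamma(\mu,\theta)}\iint_{D\times D}\big(|x-y|+|f(x)-g(y)|\big)\,d\pi(x,y),$$ where $\Gamma(\mu,\theta)$ is the set of couplings, i.e. Borel probability measures on $D\times D$ with first marginal $\mu$ and second marginal $\theta$. A sequence $u_n\in L^1(D,\nu_n)$ is called relatively compact in $TL^1$ if the sequence $\{(\nu_n,u_n)\}_{n\in\mathbb{N}}$ is relatively compact in the metric space $(TL^1(D),d_{TL^1})$,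 i.e. each of its subsequences has a further subsequence converging to an element of $TL^1(D)$. *)

(* Defs.v *)
From HB Require Import structures.
From mathcomp Require Import all_boot all_order all_algebra.
From mathcomp Require Import interval_inference finmap.
From mathcomp Require Import all_classical all_reals all_analysis.
From mathcomp Require Import measurable_realfun.

Set Implicit Arguments.
Unset Strict Implicit.
Unset Printing Implicit Defensive.
Import Order.TTheory GRing.Theory Num.Theory.
Import numFieldNormedType.Exports.

Local Open Scope classical_set_scope.
Local Open Scope ring_scope.

(* R^d is 'rV[R]_d; its measurable sets are the Borel sets of its topology. *)
Section borel_rV.
Context (R : realType) (d : nat).

Let borel : set (set 'rV[R]_d) := <<s @open 'rV[R]_d >>.

Let borel0 : borel set0.
Proof. exact: sigma_algebra0. Qed.

Let borelC A : borel A -> borel (~` A).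
Proof. exact: sigma_algebraC. Qed.

Let borel_bigcup (F : (set 'rV[R]_d)^nat) :
  (forall i, borel (F i)) -> borel (\bigcup_i (F i)).
Proof. exact: sigma_algebra_bigcup. Qed.

HB.instance Definition _ := @isMeasurable.Build
  (sigma_display (@open 'rV[R]_d)) 'rV[R]_d borel borel0 borelC borel_bigcup.

End borel_rV.


Section borel_rV_theory.
Context (R : realType).

Lemma open_measurable_rV n (U : set 'rV[R]_n) : open U -> measurable U.
Proof. exact: sub_sigma_algebra. Qed.

Lemma measurable_coord n (i : 'I_n) :
  measurable_fun setT (fun v : 'rV[R]_n => v ord0 i).
Proof.
apply: (measurability _ (RGenOpens.measurableE R)) => _ [_ [a [b ->]] <-].
rewrite setTI; apply: open_measurable_rV.
by apply: open_comp; [move=> v _; exact: coord_continuous|exact: interval_open].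
Qed.

Lemma open_rV_boxes n (U : set 'rV[R]_n) : open U ->
  U = \bigcup_(a in [set a : 'rV[rat]_n * 'rV[rat]_n |
        [set v : 'rV[R]_n | forall i,
           v ord0 i \in `]ratr (a.1 ord0 i), ratr (a.2 ord0 i)[] `<=` U])
      [set v | forall i, v ord0 i \in `]ratr (a.1 ord0 i), ratr (a.2 ord0 i)[].
Proof.
move=> oU; apply/seteqP; split => [v Uv|v [a /= aU va]]; last exact: aU.
have /nbhs_ballP[e /= e0 veU] := open_nbhs_nbhs (conj oU Uv).
have lo i : {q : rat | ratr q \in `](v ord0 i - e), (v ord0 i)[}.
  by apply: cid; apply: rat_in_itvoo; rewrite ltrBlDr ltrDl.
have hi i : {q : rat | ratr q \in `](v ord0 i), (v ord0 i + e)[}.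
  by apply: cid; apply: rat_in_itvoo; rewrite ltrDl.
exists (\row_i sval (lo i), \row_i sval (hi i)) => /= [w|i]; last first.
  rewrite !mxE; case: (lo i) (hi i) => p /= + [q /= ].
  by rewrite !in_itv/= => /andP[_ ->] /andP[-> _].
move=> wv; apply: veU; split => // i j; rewrite ord1 {i}.
have := wv j; rewrite !mxE; case: (lo j) (hi j) => p /= + [q /= ].
rewrite !in_itv/= /ball/= => /andP[p1 _] /andP[_ q1] /andP[pw wq].
by rewrite distrC ltr_distl (lt_trans p1 pw) (lt_trans wq q1).
Qed.

Lemma measurable_box n (A : 'I_n -> set R) : (forall i, measurable (A i)) ->
  measurable [set v : 'rV[R]_n | forall i, A i (v ord0 i)].
Proof.
move=> mA.
rewrite (_ : mkset _ = \bigcap_(i in [set: 'I_n])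
    ((fun v : 'rV[R]_n => v ord0 i) @^-1` A i)).
  apply: fin_bigcap_measurable => // i _.
  by rewrite -[X in measurable X]setTI; exact: measurable_coord.
by apply/seteqP; split => [v vA i _|v vA i]; exact: vA.
Qed.

Lemma measurable_fun_rV d (T : measurableType d) n (f : T -> 'rV[R]_n) :
  (forall i, measurable_fun setT (fun x => f x ord0 i)) ->
  measurable_fun setT f.
Proof.
move=> mf; apply: (@measurability _ _ _ _ _ _ (@open 'rV[R]_n)) => //.
move=> _ [U /open_rV_boxes -> <-].
rewrite setTI preimage_bigcup bigcup_mkcond.
apply: countable_bigcupT_measurable => // a; case: ifPn => // _.
rewrite (_ : _ @^-1` _ = \bigcap_(i in [set: 'I_n])
    ((fun x => f x ord0 i) @^-1`
     `]ratr (a.1 ord0 i), ratr (a.2 ord0 i)[%classic)).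
  apply: fin_bigcap_measurable => // i _.
  by rewrite -[X in measurable X]setTI; exact: mf.
by apply/seteqP; split => [x xA i _|x xA i]; [exact: xA|exact: (xA i)].
Qed.

End borel_rV_theory.

Section lebesgue_rV.
Context (R : realType).

Definition rV_cons n (p : R * 'rV[R]_n) : 'rV[R]_n.+1 :=
  \row_(i < n.+1) if unlift ord0 i is Some j then p.2 ord0 j else p.1.

Definition rV_uncons n (v : 'rV[R]_n.+1) : R * 'rV[R]_n :=
  (v ord0 ord0, \row_j v ord0 (lift ord0 j)).

Lemma rV_consK n : cancel (@rV_cons n) (@rV_uncons n).
Proof.
move=> [x v]; rewrite /rV_uncons mxE unlift_none; congr pair.
by apply/rowP => j; rewrite !mxE liftK.
Qed.

Lemma rV_unconsK n : cancel (@rV_uncons n) (@rV_cons n).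
Proof.
by move=> v; apply/rowP => i; rewrite mxE; case: unliftP => [j|] ->; rewrite ?mxE.
Qed.

Lemma measurable_rV_cons n : measurable_fun setT (@rV_cons n).
Proof.
apply: measurable_fun_rV => i; rewrite /rV_cons.
under eq_fun do rewrite mxE.
case: (unlift ord0 i) => [j|]; last exact: measurable_fst.
exact: (measurableT_comp (measurable_coord j) measurable_snd).
Qed.

Lemma measurable_rV_uncons n : measurable_fun setT (@rV_uncons n).
Proof.
apply/measurable_fun_pairP; split; first exact: measurable_coord.
apply: measurable_fun_rV => j /=; under eq_fun do rewrite mxE.
exact: measurable_coord.
Qed.

Section push.
Context n (mu : {sigma_finite_measure set 'rV[R]_n -> \bar R}).

Definition lebesgue_rV_step : set 'rV[R]_n.+1 -> \bar R :=
  pushforward (@lebesgue_measure R \x mu)%E (@rV_cons n).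

Let step0 : lebesgue_rV_step set0 = 0%E.
Proof. by rewrite /lebesgue_rV_step /pushforward preimage_set0 measure0. Qed.

Let step_ge0 A : (0 <= lebesgue_rV_step A)%E.
Proof. exact: (measure_ge0 (@lebesgue_measure R \x mu)%E). Qed.

Let step_sigma_additive : semi_sigma_additive lebesgue_rV_step.
Proof. by apply: measure_semi_sigma_additive; exact: measurable_rV_cons. Qed.

HB.instance Definition _ := isMeasure.Build _ _ _ lebesgue_rV_step
  step0 step_ge0 step_sigma_additive.

Let step_sigma_finite : sigma_finite setT lebesgue_rV_step.
Proof.
have /sigma_finiteP[F [TF ndF Foo]] := sigma_finiteT (@lebesgue_measure R).
have /sigma_finiteP[G [TG ndG Goo]] := sigma_finiteT mu.
exists (fun k => @rV_uncons n @^-1` (F k `*` G k)).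
  rewrite -preimage_bigcup (_ : \bigcup_i _ = setT) ?preimage_setT//.
  apply/seteqP; split => // -[x v] _.
  have [i _ Fix] : (\bigcup_i F i) x by rewrite -TF.
  have [j _ Gjv] : (\bigcup_i G i) v by rewrite -TG.
  exists (maxn i j) => //; split.
    by move: x Fix; exact/subsetPset/ndF/leq_maxl.
  by move: v Gjv; exact/subsetPset/ndG/leq_maxr.
move=> k; have [mF Fk] := Foo k; have [mG Gk] := Goo k; split.
  rewrite -[X in measurable X]setTI; apply: measurable_rV_uncons => //.
  exact: measurableX.
rewrite /lebesgue_rV_step /pushforward -comp_preimage.
have -> : @rV_uncons n \o @rV_cons n = id by exact/funext/rV_consK.
by rewrite preimage_id product_measure1E// lte_mul_pinfty// ge0_fin_numE.
Qed.

HB.instance Definition _ := Measure_isSigmaFinite.Build _ _ _ lebesgue_rV_step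
  step_sigma_finite.

End push.

(* Lebesgue measure on R^n, as the n-fold product of lebesgue_measure *)
Fixpoint lebesgue_rV n : {sigma_finite_measure set 'rV[R]_n -> \bar R} :=
  match n with
  | 0 => @dirac _ 'rV[R]_0 0 R
  | n'.+1 => lebesgue_rV_step (lebesgue_rV n')
  end.

Lemma lebesgue_rV_box n (A : 'I_n -> set R) : (forall i, measurable (A i)) ->
  lebesgue_rV n [set v | forall i, A i (v ord0 i)] =
  (\prod_(i < n) lebesgue_measure (A i))%E.
Proof.
elim: n A => [|n IH] A mA.
  rewrite big_ord0 /= diracE mem_set//.
  by case.
rewrite big_ord_recl -IH; last by move=> i; exact: mA.
rewrite -product_measure1E; [|exact: mA|exact: (measurable_box (fun i => mA _))].
rewrite /= /lebesgue_rV_step /pushforward; congr (_ _).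
apply/seteqP; split => [[x v] /= xvA|[x v] [/= xA vA] i].
  split; first by have := xvA ord0; rewrite mxE unlift_none.
  by move=> i; have := xvA (lift ord0 i); rewrite mxE liftK.
by rewrite mxE; case: unliftP => [j|] ->; [exact: vA|exact: xA].
Qed.

End lebesgue_rV.

Section domain.
Context (R : realType).

(* The norm `|v| provided by the library on 'rV[R]_n is the sup norm. *)
Definition enorm n (v : 'rV[R]_n) : R := Num.sqrt (\sum_i v ord0 i ^+ 2).

(* Near every boundary point, after an orthogonal change of coordinates
   y |-> y *m Q, D is the strict epigraph of a Lipschitz function g of the d-1
   coordinates other than the i-th. *)
Definition lipschitz_boundary d (D : set 'rV[R]_d) :=
  forall x, (closure D `\` interior D) x ->
    exists (Q : 'M[R]_d) (i : 'I_d) (g : 'rV[R]_d.-1 -> R) (L r : R),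
      [/\ Q *m Q^T = 1%:M, 0 < r,
          forall y z, `|g y - g z| <= L * enorm (y - z)
        & forall y, enorm (y - x) < r ->
            D y <-> g (col' i (y *m Q)) < (y *m Q) ord0 i].

Definition has_density_on d (D : set 'rV[R]_d) (nu : probability 'rV[R]_d R)
    (rho : 'rV[R]_d -> R) :=
  forall A, measurable A ->
    nu A = (\int[lebesgue_rV R d]_(x in A `&` D) (rho x)%:E)%E.

End domain.

Section random_sample.
Context (R : realType) (dO : measure_display) (Omega : measurableType dO).
Context (P : probability Omega R) (d' : measure_display).
Context (T : measurableType d').

Definition mutually_independent (X : nat -> {RV P >-> T}) :=
  forall (J : {fset nat}) (B : nat -> set T), (forall i, measurable (B i)) ->
    P (\bigcap_(i in [set` J]) X i @^-1` B i) =
    (\prod_(i <- J) P (X i @^-1` B i))%E.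

Definition iid (nu : probability T R) (X : nat -> {RV P >-> T}) :=
  mutually_independent X /\
  forall i A, measurable A -> distribution P (X i) A = nu A.

End random_sample.

Section graph_total_variation.
Context (R : realType) (d : nat).

Definition scaled_kernel (eta : R -> R) (eps : R) (z : 'rV[R]_d) : R :=
  eps ^- d * eta (enorm (eps^-1 *: z)).

(* The sample points are x 0, ..., x n.-1. *)
Definition GTV (eta : R -> R) (n : nat) (eps : R) (x : nat -> 'rV[R]_d)
    (u : 'rV[R]_d -> R) : R :=
  eps^-1 * (n%:R ^+ 2)^-1 *
  \sum_(i < n) \sum_(j < n)
     scaled_kernel eta eps (x i - x j) * `|u (x i) - u (x j)|.

Definition empirical_measure (n : nat) (x : nat -> 'rV[R]_d) :
    {measure set 'rV[R]_d -> \bar R} :=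
  mscale (n%:R^-1)%:nng (msum (fun i => @dirac _ _ (x i) R) n).

End graph_total_variation.

Section TL1_space.
Context (R : realType) (d : nat) (D : set 'rV[R]_d).

Local Notation measure_rV := {measure set 'rV[R]_d -> \bar R}.

Definition L1 (mu : measure_rV) (f : 'rV[R]_d -> R) :=
  mu.-integrable D (EFin \o f).

Definition L1norm (mu : measure_rV) (f : 'rV[R]_d -> R) : \bar R :=
  (\int[mu]_(x in D) `|f x|%:E)%E.

(* Probability measures on D are represented by the probability measures on
   R^d that give D full measure. *)
Definition TL1 : set (measure_rV * ('rV[R]_d -> R)) :=
  [set p : measure_rV * ('rV[R]_d -> R) |
    [/\ p.1 setT = 1%E, p.1 D = 1%E & L1 p.1 p.2]].

(* The product sigma-algebra on R^d * R^d is the Borel one, and couplings of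
   measures concentrated on D are concentrated on D `*` D. *)
Definition couplings (mu theta : measure_rV) :
    set (probability ('rV[R]_d * 'rV[R]_d)%type R) :=
  [set pi | forall A, measurable A ->
     pi (A `*` setT) = mu A /\ pi (setT `*` A) = theta A].

Definition dTL1 (p q : measure_rV * ('rV[R]_d -> R)) : \bar R :=
  ereal_inf [set (\int[pi]_(z in D `*` D)
    (enorm (z.1 - z.2) + `|p.2 z.1 - q.2 z.2|)%:E)%E | pi in couplings p.1 q.1].

Definition TL1_relatively_compact
    (s : nat -> measure_rV * ('rV[R]_d -> R)) :=
  (forall k, TL1 (s k)) /\
  forall phi : nat -> nat, increasing_seq phi ->
    exists psi : nat -> nat, increasing_seq psi /\
    exists2 p, TL1 p & dTL1 (s (phi (psi k))) p @[k --> \oo] --> 0%E.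

End TL1_space.

(* Main.v *)
(* For all d >= 2 only the consequence n eps_n^d / log n -> oo of the rates is used.
   Cut space into cubes of side s_n = c eps_n. By Chernoff bounds and
   Borel-Cantelli, almost surely, for n large, every cube contains at most
   C n s_n^d sample points and every cube inside D at least C^-1 n s_n^d. Hence the
   variation of the averages of u_n over neighbouring full cubes is controlled by
   the graph total variation, also after summation along lattice paths. By
   compactness of the boundary, points of D move into D along one of finitely many
   directions, so each sample point can be compared, along such a path, with the
   mean of u_n over a box of side delta at distance of order delta inside D. This
   gives a piecewise constant approximation of u_n at scale delta with
   L^1(nu_n)-error O(delta), uniformly in n, and with coefficients bounded for
   fixed delta.
   Along an ultrafilter the coefficients converge at all dyadic scales; the limiting
   step functions are Cauchy in L^1(nu), and a coupling of nu_n and nu that stays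
   inside the pieces up to a vanishing mass shows TL^1-convergence to their limit. *)

From HB Require Import structures.
Require Import Defs.
From mathcomp Require Import all_boot all_order all_algebra.
From mathcomp Require Import all_classical all_reals all_analysis.
From mathcomp Require Import measurable_realfun finmap.
From mathcomp Require Import zify ring lra.

Set Implicit Arguments.
Unset Strict Implicit.
Unset Printing Implicit Defensive.
Import Order.TTheory GRing.Theory Num.Theory.
Import numFieldNormedType.Exports.

Local Open Scope classical_set_scope.
Local Open Scope ring_scope.

(** * Averages over lattice cells *)

(** Cells that meet the boundary of D have no lower bound on their number of sample points, so
    averaging over a point's own cell gives no control. The point is compared instead with a cell
    [t] places away along an inward direction, where [t] depends only on the opening of the cones;
    the side s = c eps_n is then chosen so that this jump stays in the range where the kernel is
    bounded below. All points of one group follow translates of a single path. A pair of cells is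
    then charged only by the points of one cell, and a lattice step costs (hi / lo^2) V, where V is
    the variation over near pairs and lo, hi are of order n s^d. With delta / s steps and V of order
    at most n^2 s^(d+1) GTV the total is of order n delta GTV: the powers of s cancel, which is why
    the error is uniform in n. An ultrafilter spares a diagonal extraction over the scales; a
    subsequence is recovered only at the end. *)

Section lattice_averages.
Context (R : realFieldType) (d n : nat).
Variables (z : 'I_n -> 'rV[int]_d) (v : 'I_n -> R).

Definition supn_le (l : 'rV[int]_d) (t : nat) := [forall j, `|l 0 j| <= t%:Z].

Definition cell_count (w : 'rV[int]_d) : R := \sum_(a | z a == w) 1.

Definition cell_mean (w : 'rV[int]_d) : R :=
  (\sum_(a | z a == w) v a) / cell_count w.

(** Lattice substitute for the graph total variation: the weight of a pair depends on the cell
    indices only, which makes translations harmless. *)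
Definition near_variation (t : nat) : R :=
  \sum_a \sum_(b | supn_le (z a - z b) t) `|v a - v b|.

Lemma near_variation_ge0 t : 0 <= near_variation t.
Proof. by apply: sumr_ge0 => a _; apply: sumr_ge0 => b _. Qed.

Lemma supn_leP (l : 'rV[int]_d) (t : nat) : reflect (forall j, `|l 0 j| <= t%:Z) (supn_le l t).
Proof. exact: forallP. Qed.

Lemma supn_leN (l : 'rV[int]_d) (t : nat) : supn_le (- l) t = supn_le l t.
Proof. by apply: eq_forallb => j; rewrite !mxE normrN. Qed.

Lemma ler_sum_sub (I : finType) (P Q : pred I) (F : I -> R) :
  (forall i, P i -> Q i) -> (forall i, Q i -> 0 <= F i) ->
  \sum_(i | P i) F i <= \sum_(i | Q i) F i.
Proof.
move=> PQ F0; rewrite [leRHS](bigID P)/=.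
rewrite [X in _ <= X + _](_ : _ = \sum_(i | P i) F i); last first.
  by apply: eq_bigl => i; case Pi: (P i); rewrite ?andbT ?andbF// PQ.
by rewrite lerDl sumr_ge0// => i /andP[/F0].
Qed.

Lemma ler_sum_inj (I J : finType) (h : I -> J) (F : J -> R) :
  injective h -> (forall j, 0 <= F j) -> \sum_i F (h i) <= \sum_j F j.
Proof.
move=> h_inj F0; rewrite -(big_imset (A := predT) F (in2W h_inj)).
exact: ler_sum_sub.
Qed.

Variable (lo hi : R).
Hypotheses (lo_gt0 : 0 < lo) (cell_count_le : forall w, cell_count w <= hi).

Definition populated w := lo <= cell_count w.

(** The left side is the average of the differences [x - v b] over the cell, and the number of
    points averaged is at least [lo]. *)
Lemma dist_cell_mean x w : populated w ->
  `|x - cell_mean w| <= lo^-1 * \sum_(b | z b == w) `|x - v b|.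
Proof.
move=> pw; have c0 : 0 < cell_count w by exact: lt_le_trans pw.
have -> : x - cell_mean w = (cell_count w)^-1 * \sum_(b | z b == w) (x - v b).
  have -> : \sum_(b | z b == w) (x - v b) = cell_count w * x - \sum_(b | z b == w) v b.
    by rewrite sumrB mulr_suml; under [in RHS]eq_bigr do rewrite mul1r.
  by rewrite mulrBr mulKf ?lt0r_neq0// [_^-1 * _]mulrC.
rewrite normrM ger0_norm ?invr_ge0 ?(ltW c0)//.
apply: ler_pM => //; first by rewrite invr_ge0 ltW.
  by rewrite lef_pV2 ?posrE.
exact: ler_norm_sum.
Qed.

Lemma cell_mean_dist w w' : populated w -> populated w' ->
  `|cell_mean w - cell_mean w'| <=
  lo^-1 * lo^-1 * \sum_(a | z a == w) \sum_(b | z b == w') `|v a - v b|.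
Proof.
move=> pw pw'; rewrite distrC.
apply: (le_trans (dist_cell_mean _ pw)); rewrite -mulrA ler_wpM2l//.
  by rewrite invr_ge0 ltW.
rewrite mulr_sumr; apply: ler_sum => a _; rewrite distrC.
exact: dist_cell_mean.
Qed.

(* Double counting: a pair (a, b) is charged only by the points [i] of the
   single cell [z a - q], of which there are at most [hi]. *)
Lemma sum_step_le (I : pred 'I_n) (q q' : 'rV[int]_d) t :
  (forall i, I i -> populated (z i + q)) ->
  (forall i, I i -> populated (z i + q')) ->
  supn_le (q - q') t ->
  \sum_(i | I i) `|cell_mean (z i + q) - cell_mean (z i + q')| <=
  hi / lo ^+ 2 * near_variation t.
Proof.
move=> pq pq' qq't.
apply: (@le_trans _ _ (\sum_(i | I i) lo^-1 * lo^-1 *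
    \sum_(a | z a == z i + q) \sum_(b | z b == z i + q') `|v a - v b|)).
  by apply: ler_sum => i Ii; apply: cell_mean_dist; [exact: pq|exact: pq'].
rewrite -mulr_sumr (_ : hi / _ * _ = lo^-1 * lo^-1 * (hi * near_variation t)); last first.
  by rewrite expr2 invfM; ring.
rewrite ler_wpM2l//.
  by rewrite mulr_ge0 // invr_ge0 ltW.
apply: (@le_trans _ _ (\sum_i \sum_(a | z a == z i + q)
    \sum_(b | supn_le (z a - z b) t) `|v a - v b|)).
  apply: (@le_trans _ _ (\sum_(i | I i) \sum_(a | z a == z i + q)
      \sum_(b | supn_le (z a - z b) t) `|v a - v b|)).
    apply: ler_sum => i Ii; apply: ler_sum => a /eqP za.
    apply: ler_sum_sub => // b /eqP zb.
    by rewrite za zb opprD addrACA subrr add0r.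
  by apply: ler_sum_sub => // i _; apply: sumr_ge0 => a _; apply: sumr_ge0.
rewrite (exchange_big_dep xpredT)//= /near_variation mulr_sumr.
apply: ler_sum => a _.
rewrite (eq_bigl (fun i => z i == z a - q)); last first.
  by move=> i /=; rewrite [RHS]eq_sym subr_eq.
set S := \sum_(b | supn_le (z a - z b) t) `|v a - v b|.
rewrite [leLHS](_ : _ = cell_count (z a - q) * S).
  by rewrite ler_wpM2r//; apply: sumr_ge0.
by rewrite mulr_suml; apply: eq_bigr => i _; rewrite mul1r.
Qed.

(** Telescoping along the path. Since [q] is the same for all points, [sum_step_le] applies to each
    of the [m] steps. *)
Lemma sum_path_le (I : pred 'I_n) (q : nat -> 'rV[int]_d) m t :
  (forall i k, I i -> (k <= m)%N -> populated (z i + q k)) ->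
  (forall k, (k < m)%N -> supn_le (q k - q k.+1) t) ->
  \sum_(i | I i) `|cell_mean (z i + q 0%N) - cell_mean (z i + q m)| <=
  m%:R * (hi / lo ^+ 2 * near_variation t).
Proof.
elim: m => [|m IH] pq qt.
  by rewrite mul0r big1// => i _; rewrite subrr normr0.
apply: (@le_trans _ _ (\sum_(i | I i)
   (`|cell_mean (z i + q 0%N) - cell_mean (z i + q m)| +
    `|cell_mean (z i + q m) - cell_mean (z i + q m.+1)|))).
  by apply: ler_sum => i _; exact: ler_distD.
rewrite big_split/= -natr1 mulrDl mul1r lerD//.
  apply: IH => [i k Ii km|k km]; [apply: pq => //|apply: qt]; lia.
by apply: sum_step_le => [i Ii|i Ii|]; [apply: pq; lia..|apply: qt].
Qed.

(** Here the point [i] is itself one member of the pair, so no pair is charged twice and the factor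
    is [lo^-1] alone. *)
Lemma sum_jump_le (I : pred 'I_n) (q : 'rV[int]_d) t :
  (forall i, I i -> populated (z i + q)) -> supn_le q t ->
  \sum_(i | I i) `|v i - cell_mean (z i + q)| <= lo^-1 * near_variation t.
Proof.
move=> pq qt.
apply: (@le_trans _ _ (\sum_(i | I i) lo^-1 *
    \sum_(b | supn_le (z i - z b) t) `|v i - v b|)).
  apply: ler_sum => i Ii; apply: (le_trans (dist_cell_mean _ (pq _ Ii))).
  rewrite ler_wpM2l//; first by rewrite invr_ge0 ltW.
  apply: ler_sum_sub => // b /eqP zb.
  by rewrite zb opprD addrA subrr sub0r supn_leN.
rewrite -mulr_sumr ler_wpM2l//; first by rewrite invr_ge0 ltW.
by apply: ler_sum_sub => // i _; apply: sumr_ge0.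
Qed.

(** Lattice path from 0 to [l]: all coordinates move in parallel by unit steps and each stops on
    arrival, so [t] steps reach any [l] of sup norm at most [t]. *)
Definition clampz (l : 'rV[int]_d) (t : nat) : 'rV[int]_d :=
  \row_j (Num.sg (l 0 j) * (minn t (absz (l 0 j)))%:Z).

Lemma clampz0 l : clampz l 0 = 0.
Proof. by apply/rowP => j; rewrite !mxE min0n mulr0. Qed.

Lemma clampz_id l t : supn_le l t -> clampz l t = l.
Proof.
move=> /supn_leP lt; apply/rowP => j; rewrite mxE.
have := lt j; lia.
Qed.

Lemma supn_le_clampz l t k : supn_le l t -> supn_le (clampz l k) t.
Proof.
move=> /supn_leP lt; apply/supn_leP => j; rewrite mxE.
have := lt j; nia.
Qed.

Lemma clampz_step l k : supn_le (clampz l k - clampz l k.+1) 1.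
Proof.
apply/supn_leP => j; rewrite !mxE; move: (l 0 j : int) => a.
have sgM b : Num.sg a * b = if a == 0 then 0 else if a < 0 then - b else b.
  by case: sgrP; rewrite ?mul0r ?mul1r ?mulN1r.
rewrite !sgM; case: (ltrgtP a 0) => a0 //; lia.
Qed.

Lemma supn_leW l t t' : (t <= t')%N -> supn_le l t -> supn_le l t'.
Proof. by move=> tt' /supn_leP H; apply/supn_leP => j; have := H j; lia. Qed.

Lemma supn_leD l l' t t' : supn_le l t -> supn_le l' t' ->
  supn_le (l + l') (t + t')%N.
Proof.
move=> /supn_leP H /supn_leP H'; apply/supn_leP => j; rewrite mxE.
by have := H j; have := H' j; move: (l 0 j : int) (l' 0 j : int) => a b; lia.
Qed.

Lemma sum_translate_le (I : pred 'I_n) (p l : 'rV[int]_d) r :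
  supn_le l r ->
  (forall i l', I i -> supn_le l' r -> populated (z i + p + l')) ->
  \sum_(i | I i) `|cell_mean (z i + p) - cell_mean (z i + p + l)| <=
  r%:R * (hi / lo ^+ 2 * near_variation 1).
Proof.
move=> lr pop.
have := @sum_path_le I (fun k => p + clampz l k) r 1.
rewrite clampz0 addr0 clampz_id// => H.
under eq_bigr do rewrite -addrA.
apply: H => [i k Ii _|k kr].
  by rewrite addrA; apply: pop => //; exact: supn_le_clampz.
by rewrite opprD addrACA subrr add0r; exact: clampz_step.
Qed.

Definition offset m (k : {ffun 'I_d -> 'I_m}) : 'rV[int]_d := \row_j (k j : nat)%:Z.

(** A mean of cell means: all cells of the box have equal weight, whatever their number of points,
    so that estimates for single cells can be averaged. *)
Definition box_mean m (w : 'rV[int]_d) : R :=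
  (m%:R ^+ d)^-1 * \sum_(k : {ffun 'I_d -> 'I_m}) cell_mean (w + offset k).

Lemma offset_le m (k : {ffun 'I_d -> 'I_m}) : supn_le (offset k) m.
Proof. by apply/supn_leP => j; rewrite mxE; have := ltn_ord (k j); lia. Qed.

Lemma offset_inj m : injective (@offset m).
Proof.
move=> k k' /rowP kk'; apply/ffunP => j; apply/val_inj.
by have := kk' j; rewrite !mxE => -[].
Qed.

Lemma dist_box_mean m w x : (0 < m)%N ->
  `|x - box_mean m w| <=
  (m%:R ^+ d)^-1 * \sum_(k : {ffun 'I_d -> 'I_m}) `|x - cell_mean (w + offset k)|.
Proof.
move=> m0; have md0 : 0 < (m%:R : R) ^+ d by rewrite exprn_gt0// ltr0n.
have -> : x - box_mean m w = (m%:R ^+ d)^-1 *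
    \sum_(k : {ffun 'I_d -> 'I_m}) (x - cell_mean (w + offset k)).
  rewrite sumrB mulrBr; congr (_ - _).
  rewrite sumr_const card_ffun !card_ord -[x *+ _]mulr_natl natrX mulKf//.
  by rewrite lt0r_neq0.
by rewrite normrM ger0_norm ?invr_ge0 ?(ltW md0)// ler_wpM2l ?invr_ge0 ?(ltW md0)// ler_norm_sum.
Qed.

(** The position of [y i] relative to [z i] varies with [i], whereas double counting needs common
    translations. The box at [y i] is therefore enlarged to the box of radius [r + m] around [z i],
    whose translations [L k] are the same for all points; the price is the ratio of the volumes. *)
Lemma sum_box_mean_le (I : pred 'I_n) (p : 'rV[int]_d) (y : 'I_n -> 'rV[int]_d) m r :
  (0 < m)%N ->
  (forall i, I i -> supn_le (y i - z i) r) ->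
  (forall i l, I i -> supn_le l (r + m) -> populated (z i + p + l)) ->
  \sum_(i | I i) `|cell_mean (z i + p) - box_mean m (y i + p)| <=
  (m%:R ^+ d)^-1 * ((r + m).*2.+1)%:R ^+ d *
    ((r + m)%:R * (hi / lo ^+ 2 * near_variation 1)).
Proof.
move=> m0 yz pop; set r' := (r + m)%N.
pose L (k : {ffun 'I_d -> 'I_(r'.*2.+1)}) : 'rV[int]_d := \row_j ((k j : nat)%:Z - r'%:Z).
have Lle k : supn_le (L k) r'.
  by apply/supn_leP => j; rewrite mxE; have := ltn_ord (k j); lia.
have md0 : 0 < (m%:R : R) ^+ d by rewrite exprn_gt0// ltr0n.
apply: (@le_trans _ _ (\sum_(i | I i) (m%:R ^+ d)^-1 *
    \sum_k `|cell_mean (z i + p) - cell_mean (z i + p + L k)|)).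
  apply: ler_sum => i Ii; apply: (le_trans (dist_box_mean _ _ m0)).
  rewrite ler_wpM2l ?invr_ge0 ?(ltW md0)//.
  (* Index of the translation that leads from [z i] to the [k]-th cell of the box at [y i]; adding
     [r'] makes the coordinates nonnegative. *)
  pose h (k : {ffun 'I_d -> 'I_m}) : {ffun 'I_d -> 'I_(r'.*2.+1)} :=
    [ffun j => inord (absz ((y i - z i + offset k) 0 j + r'%:Z))].
  have hE k : z i + p + L (h k) = y i + p + offset k.
    have -> : L (h k) = y i - z i + offset k; last first.
      by apply/rowP => j; rewrite !mxE; ring.
    apply/rowP => j.
    have /supn_leP/(_ j) := supn_leD (yz _ Ii) (offset_le k).
    rewrite [LHS]mxE ffunE; set a := (y i - z i + offset k) 0 j => aj.
    rewrite inordK; lia.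
  have h_inj : injective h.
    move=> k k' hkk'; apply: (@offset_inj m).
    by have := hE k; rewrite hkk' hE => /addrI ->.
  under eq_bigr do rewrite -hE.
  exact: (ler_sum_inj (F := fun l => `|_ - cell_mean (_ + L l)|) h_inj).
rewrite -mulr_sumr -mulrA ler_wpM2l ?invr_ge0 ?(ltW md0)//.
rewrite exchange_big/=.
have -> : (r'.*2.+1%:R : R) ^+ d = #|{ffun 'I_d -> 'I_(r'.*2.+1)}|%:R.
  by rewrite card_ffun !card_ord natrX.
set X := r'%:R * _.
have -> : #|{ffun 'I_d -> 'I_(r'.*2.+1)}|%:R * X = \sum_(k : {ffun 'I_d -> 'I_(r'.*2.+1)}) X.
  by rewrite sumr_const mulr_natl.
apply: ler_sum => k _; exact: sum_translate_le.
Qed.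

Lemma cell_mean_norm_le w : populated w ->
  `|cell_mean w| <= lo^-1 * \sum_(b | z b == w) `|v b|.
Proof.
move=> pw; have := dist_cell_mean 0 pw; rewrite sub0r normrN.
by under eq_bigr do rewrite sub0r normrN.
Qed.

(** A sample point lies in at most one cell of the box, so the sum over the box counts it at most
    once. For m s of order delta and lo of order n s^d the factor is of order 1 / (n delta^d), which
    bounds the coefficients at a fixed scale. *)
Lemma box_mean_norm_le m w : (0 < m)%N ->
  (forall l, supn_le l m -> populated (w + l)) ->
  `|box_mean m w| <= (m%:R ^+ d * lo)^-1 * \sum_b `|v b|.
Proof.
move=> m0 pop; have md0 : 0 < (m%:R : R) ^+ d by rewrite exprn_gt0// ltr0n.
have := dist_box_mean w 0 m0; rewrite sub0r normrN => /le_trans; apply.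
rewrite invfM -mulrA ler_wpM2l ?invr_ge0 ?(ltW md0)//.
apply: (@le_trans _ _ (\sum_(k : {ffun 'I_d -> 'I_m}) lo^-1 *
    \sum_(b | z b == w + offset k) `|v b|)).
  apply: ler_sum => k _; rewrite sub0r normrN; apply: cell_mean_norm_le.
  by apply: pop; exact: offset_le.
rewrite -mulr_sumr ler_wpM2l ?invr_ge0 ?(ltW lo_gt0)//.
rewrite (exchange_big_dep xpredT)//=; apply: ler_sum => b _.
(* By injectivity of [offset] at most one [k] survives the filter. *)
rewrite -big_filter; case E : [seq _ <- _ | _] => [|k s]; first by rewrite big_nil.
have mE k' : k' \in k :: s -> z b = w + offset k'.
  by rewrite -E mem_filter => /andP[/eqP].
have us : uniq (k :: s) by rewrite -E filter_uniq// index_enum_uniq.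
case: s E mE us => [|k' s] E mE us; first by rewrite big_seq1.
have := mE k; rewrite !inE eqxx => /(_ isT).
have := mE k'; rewrite !inE eqxx orbT => /(_ isT) -> /addrI/offset_inj kk'.
by move: us; rewrite /= kk' !inE eqxx.
Qed.

(* From a point jump to a cell at distance [t], follow the path [q] inwards, and
   compare the end cell with the mean over a box of side [m]. *)
Lemma sum_dist_box_mean_le (I : pred 'I_n) (q : nat -> 'rV[int]_d)
    (y : 'I_n -> 'rV[int]_d) (k m r t : nat) :
  (0 < m)%N -> (0 < t)%N ->
  supn_le (q 0%N) t ->
  (forall j, supn_le (q j - q j.+1) 1) ->
  (forall i j, I i -> (j <= k)%N -> populated (z i + q j)) ->
  (forall i, I i -> supn_le (y i - z i) r) ->
  (forall i l, I i -> supn_le l (r + m) -> populated (z i + q k + l)) ->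
  \sum_(i | I i) `|v i - box_mean m (y i + q k)| <=
  (lo^-1 + (k%:R + (m%:R ^+ d)^-1 * ((r + m).*2.+1)%:R ^+ d * (r + m)%:R) *
     (hi / lo ^+ 2)) * near_variation t.
Proof.
move=> m0 t0 q0 qS popq yz pop.
have V1t : near_variation 1 <= near_variation t.
  apply: ler_sum => a _; apply: ler_sum_sub => // b; exact: supn_leW.
have hi0 : 0 <= hi.
  by apply: le_trans (cell_count_le 0); rewrite /cell_count sumr_const.
have hl0 : 0 <= hi / lo ^+ 2 by rewrite divr_ge0// exprn_ge0// ltW.
apply: (@le_trans _ _ (\sum_(i | I i)
   (`|v i - cell_mean (z i + q 0%N)| +
    `|cell_mean (z i + q 0%N) - cell_mean (z i + q k)| +
    `|cell_mean (z i + q k) - box_mean m (y i + q k)|))).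
  apply: ler_sum => i _; apply: (le_trans (ler_distD (cell_mean (z i + q k)) _ _)).
  by rewrite lerD2r; exact: ler_distD.
rewrite !big_split/=; set A := _ ^-1 * _ ^+ d.
rewrite [X in _ <= X](_ : _ = lo^-1 * near_variation t +
  k%:R * (hi / lo ^+ 2 * near_variation t) +
  A * ((r + m)%:R * (hi / lo ^+ 2 * near_variation t))); last by ring.
apply: lerD; first apply: lerD.
- by apply: sum_jump_le => // i Ii; exact: popq.
- apply: (le_trans (sum_path_le (I := I) (t := 1%N) popq (fun j _ => qS j))).
  by apply: ler_wpM2l => //; exact: ler_wpM2l.
apply: (le_trans (sum_box_mean_le m0 yz pop)).
apply: ler_wpM2l; first by rewrite /A mulr_ge0// ?invr_ge0 exprn_ge0.
by apply: ler_wpM2l => //; exact: ler_wpM2l.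
Qed.

End lattice_averages.

(** * Inward cones of Lipschitz domains *)

Section euclidean_norm.
Context (R : realType).

Lemma rV_coord_le_norm d (v : 'rV[R]_d) j : `|v 0 j| <= `|v|.
Proof.
rewrite -[leRHS]/(mx_norm v) mx_normrE; apply/bigmax_geP; right => /=.
by exists (0, j).
Qed.

Lemma rV_norm_lt d (v : 'rV[R]_d) e : 0 < e ->
  (forall j, `|v 0 j| < e) -> `|v| < e.
Proof.
move=> e0 ve; rewrite -[ltLHS]/(mx_norm v) mx_normrE; apply/bigmax_ltP; split => //.
by move=> [i j] _ /=; rewrite ord1.
Qed.

Lemma enorm_ge0 d (v : 'rV[R]_d) : 0 <= enorm v.
Proof. exact: sqrtr_ge0. Qed.

Lemma enorm_le_norm d (v : 'rV[R]_d) : enorm v <= d%:R * `|v|.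
Proof.
have dv0 : 0 <= d%:R * `|v| by rewrite mulr_ge0.
rewrite -(ger0_norm dv0) -sqrtr_sqr /enorm ler_wsqrtr//.
apply: (@le_trans _ _ (\sum_(i < d) `|v| ^+ 2)).
  apply: ler_sum => i _; rewrite -[leLHS]real_normK ?num_real//.
  by rewrite lerXn2r ?nnegrE//; exact: rV_coord_le_norm.
rewrite sumr_const card_ord -[leLHS]mulr_natl exprMn ler_wpM2r ?exprn_ge0//.
by rewrite -natrX ler_nat; nia.
Qed.

Lemma coord_le_enorm d (v : 'rV[R]_d) j : `|v 0 j| <= enorm v.
Proof.
rewrite -sqrtr_sqr /enorm ler_wsqrtr// (bigD1 j)//= lerDl sumr_ge0// => i _.
exact: sqr_ge0.
Qed.

Lemma enorm_col' d (v : 'rV[R]_d) i : enorm (col' i v) <= enorm v.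
Proof.
rewrite /enorm ler_wsqrtr// [leRHS](bigD1_ord i)//=.
under eq_bigr do rewrite mxE.
by rewrite lerDr sqr_ge0.
Qed.

Lemma enorm_mulmx d (v : 'rV[R]_d) (Q : 'M[R]_d) :
  Q *m Q^T = 1%:M -> enorm (v *m Q) = enorm v.
Proof.
move=> QQ; have E (w : 'rV[R]_d) : enorm w = Num.sqrt ((w *m w^T) 0 0).
  by congr Num.sqrt; rewrite mxE; apply: eq_bigr => i _; rewrite mxE expr2.
by rewrite !E trmx_mul mulmxA -(mulmxA v) QQ mulmx1.
Qed.

End euclidean_norm.

Section compact_closure.
Context (R : realType) (d : nat).

Lemma bounded_closure_compact (D : set 'rV[R]_d) : bounded_set D -> compact (closure D).
Proof.
move=> [M [Mreal DM]].
apply: bounded_closed_compact; last exact: closed_closure.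
exists (M + 2); split; first exact: num_real.
move=> a Ma x Dx /=.
have [y [Dy xy]] := Dx _ (nbhsx_ballx x 1 ltr01).
move: xy; rewrite -ball_normE /= => xy.
rewrite -[x](subrK y); apply: le_trans (ler_normD _ _) _.
have : `|y| <= M + 1 by apply: DM => //; rewrite ltrDl.
by move=> yM; rewrite (le_trans (lerD (ltW xy) yM))// ltW//; lra.
Qed.

End compact_closure.

Section interior_cone.
Context (R : realType) (d : nat).
Implicit Types (D : set 'rV[R]_d).

(** The interior cone condition near [y], with axis [e] and in the sup norm: the tolerance grows
    linearly with the displacement [t]. The axis [e = 0] is allowed and describes balls around
    [x]. *)
Definition inward_cone D (y e : 'rV[R]_d) (r kappa : R) :=
  forall x, D x -> `|x - y| < r -> forall t w, 0 < t -> t <= r ->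
  `|w - (x + t *: e)| < kappa * t -> D w.

Lemma interior_inward_cone D y : open D -> D y ->
  exists2 r : R, 0 < r & inward_cone D y 0 r 1.
Proof.
move=> oD Dy; have /nbhs_ballP[r /= r0 rD] := open_nbhs_nbhs (conj oD Dy).
exists (r / 2); first by rewrite divr_gt0.
move=> x Dx xy t w t0 tr; rewrite scaler0 addr0 mul1r => wx.
apply: rD; rewrite -ball_normE /= distrC.
apply: le_lt_trans (ler_distD x _ _) _.
by rewrite [ltRHS]splitr ltrD// (lt_le_trans wx).
Qed.

(** A move by [t *: e] raises the height by [t] and keeps the argument of [g]. An error [b] lowers
    the height by at most [enorm b] and raises [g] by at most |L| times that, so (|L| + 1) d1 |b| <
    t suffices; this is the choice of [kappa]. *)
Lemma boundary_inward_cone D y : lipschitz_boundary D ->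
  (closure D `\` interior D) y ->
  exists (e : 'rV[R]_d) (r kappa : R), [/\ 0 < r, 0 < kappa,
    forall j, `|e 0 j| <= 1 & inward_cone D y e r kappa].
Proof.
move=> lD /lD[Q [i [g [L [r0 [QQ r0_gt0 gL gD]]]]]].
have QTQ : Q^T *m Q = 1%:M by exact: mulmx1C.
pose e : 'rV[R]_d := delta_mx 0 i *m Q^T.
have eQ : e *m Q = delta_mx 0 i by rewrite /e -mulmxA QTQ mulmx1.
have e1 j : `|e 0 j| <= 1.
  apply: le_trans (coord_le_enorm _ _) _.
  rewrite -(enorm_mulmx e QQ) eQ /enorm (bigD1 i)//= big1 => [|k ki].
    by rewrite mxE !eqxx/= expr1n addr0 sqrtr1.
  by rewrite mxE (negbTE ki) andbF expr0n.
(* Factor from the sup norm to [enorm]; the successor keeps it positive for [d = 0]. *)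
pose d1 : R := d.+1%:R; have d1_gt0 : 0 < d1 by rewrite ltr0n.
pose kappa := ((`|L| + 1) * d1)^-1.
have Ld : 0 < (`|L| + 1) * d1 by rewrite mulr_gt0// ltr_wpDl.
have k0 : 0 < kappa by rewrite invr_gt0.
have k1 : kappa <= 1.
  rewrite invf_le1//; apply: (@le_trans _ _ (1 * 1)); first by rewrite mulr1.
  by apply: ler_pM => //; rewrite ?lerDr// ler1n.
have e_norm (v : 'rV[R]_d) : enorm v <= d1 * `|v|.
  by apply: le_trans (enorm_le_norm _) _; rewrite ler_wpM2r// ler_nat.
have en1 : `|e| <= 1.
  by rewrite -[leLHS]/(mx_norm e) mx_normrE; apply/bigmax_leP; split => //= -[a b] _ /=; rewrite ord1.
(* Both [x] and [w] must stay in the chart of radius [r0], and [w] is at sup distance less than 3 r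
   from [y]. *)
exists e, (r0 / (4 * d1)), kappa; split => //; first by rewrite divr_gt0// mulr_gt0.
set r := r0 / (4 * d1); have r_gt0 : 0 < r by rewrite divr_gt0// mulr_gt0.
have r0E : r0 = 4 * d1 * r by rewrite /r mulrC divfK// lt0r_neq0// mulr_gt0.
move=> x Dx xy t w t0 tr wx.
pose b := w - (x + t *: e).
have b_lt : d1 * `|b| < t / (`|L| + 1).
  have -> : t / (`|L| + 1) = d1 * (kappa * t).
    by rewrite /kappa; field; rewrite !lt0r_neq0// ltr_wpDl.
  by rewrite ltr_pM2l.
have wE : w = x + t *: e + b by rewrite /b addrC subrK.
have wQ : w *m Q = x *m Q + t *: delta_mx 0 i + b *m Q.
  by rewrite wE !mulmxDl -scalemxAl eQ.
have [xr wr] : enorm (x - y) < r0 /\ enorm (w - y) < r0.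
  have wy : `|w - y| < 3 * r.
    have -> : w - y = b + t *: e + (x - y).
      by rewrite wE; apply/rowP => j; rewrite !mxE; ring.
    apply: le_lt_trans (ler_normD _ _) _.
    have -> : 3 * r = r + r + r by ring.
    apply: ler_ltD => //; apply: le_trans (ler_normD _ _) _; apply: lerD.
      by apply: (le_trans (ltW wx)); apply: le_trans tr; rewrite ler_piMl// ltW.
    by rewrite normrZ gtr0_norm// (le_trans _ tr)// ler_piMr// ltW.
  split; apply: (le_lt_trans (e_norm _)); rewrite r0E.
    have := @ltr_pM2l _ d1 d1_gt0 `|x - y| r; rewrite xy => H; nra.
  have := @ltr_pM2l _ d1 d1_gt0 `|w - y| (3 * r); rewrite wy => H; nra.
apply/(gD _ wr); move/(gD _ xr): Dx => Dx.
have gle : g (col' i (w *m Q)) <= g (col' i (x *m Q)) + `|L| * (d1 * `|b|).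
  rewrite -lerBlDl; apply: le_trans (ler_norm _) _.
  apply: le_trans (gL _ _) _.
  apply: (@le_trans _ _ (`|L| * enorm (col' i (w *m Q) - col' i (x *m Q)))).
    by rewrite ler_wpM2r ?enorm_ge0// ler_norm.
  rewrite ler_wpM2l//.
  have -> : col' i (w *m Q) - col' i (x *m Q) = col' i (b *m Q).
    rewrite wQ; apply/rowP => j; rewrite !mxE eqxx/=.
    by rewrite eq_sym (negbTE (neq_lift _ _)) mulr0; ring.
  apply: le_trans (enorm_col' _ _) _.
  by rewrite enorm_mulmx.
have bQi : - (d1 * `|b|) <= (b *m Q) 0 i.
  have := le_trans (coord_le_enorm (b *m Q) i) _.
  rewrite enorm_mulmx// => /(_ _ (e_norm _)).
  by rewrite ler_norml => /andP[].
have -> : (w *m Q) ord0 i = (x *m Q) ord0 i + t + (b *m Q) 0 i.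
  by rewrite wQ !mxE !eqxx/= mulr1.
have : d1 * `|b| * (`|L| + 1) < t by rewrite -ltr_pdivlMr// ltr_wpDl.
by rewrite mulrDr mulr1 => ?; lra.
Qed.

(** The closure is covered by balls of half the local cone radius, so that a point of such a ball
    inherits the cone of its centre with the remaining half. *)
Lemma uniform_inward_cone D : open D -> bounded_set D -> lipschitz_boundary D ->
  exists (K : nat) (e : 'I_K -> 'rV[R]_d) (r kappa : R),
    [/\ 0 < r, 0 < kappa, forall k j, `|e k 0 j| <= 1 &
      forall y, D y -> exists k, inward_cone D y (e k) r kappa].
Proof.
move=> oD bD lD; have cptD := bounded_closure_compact bD.
have loc y : exists p : 'rV[R]_d * R * R, closure D y ->
    [/\ 0 < p.1.2, 0 < p.2, forall j, `|p.1.1 0 j| <= 1 &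
      inward_cone D y p.1.1 p.1.2 p.2].
  have [cDy|] := pselect (closure D y); last by exists (0, 0, 0).
  have [Dy|nDy] := pselect (D y).
    have [r r0 H] := interior_inward_cone oD Dy.
    by exists (0, r, 1) => _; split => //= j; rewrite mxE normr0.
  have [|e [r [kappa [r0 k0 e1 H]]]] := @boundary_inward_cone D y lD.
    by split => // /interior_subset.
  by exists (e, r, kappa).
have {loc} /boolp.choice[p pP] := loc.
(* Radius 1 is a default outside the closure, where [p] satisfies no condition. *)
pose rad y := if y \in closure D then (p y).1.2 / 2 else 1.
have radP y : 0 < rad y.
  by rewrite /rad; case: ifPn => // /set_mem/pP[? _ _ _]; rewrite divr_gt0.
have := cptD; rewrite compact_cover => /(_ _ (closure D) (fun y => ball y (rad y))).
case=> [y _|y cDy|F FD Fcov].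
- exact: ball_open.
- by exists y => //; exact: ballxx.
pose s := enum_fset F.
pose c (k : 'I_(size s)) := nth 0 s k.
have cD k : closure D (c k) by apply/set_mem/FD; exact: mem_nth.
have rc_gt0 k : 0 < (p (c k)).1.2 / 2 by have [? _ _ _] := pP _ (cD k); rewrite divr_gt0.
have kc_gt0 k : 0 < (p (c k)).2 by have [_ ? _ _] := pP _ (cD k).
(* Starting from 1 keeps both minima positive even for an empty cover. *)
pose r : R := \big[Num.min/1]_k ((p (c k)).1.2 / 2).
pose kappa : R := \big[Num.min/1]_k (p (c k)).2.
exists (size s), (fun k => (p (c k)).1.1), r, kappa; split.
- by apply/bigmin_gtP; split => // k _; exact: rc_gt0.
- by apply/bigmin_gtP; split => // k _; exact: kc_gt0.
- by move=> k j; have [_ _ + _] := pP _ (cD k); exact.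
move=> y Dy; have [c0 /= c0F] := Fcov _ (subset_closure Dy).
have c0s : c0 \in s by [].
have [kk ck] : exists k, c k = c0.
  by exists (Ordinal (etrans (index_mem c0 s) c0s)); rewrite /c /= nth_index.
rewrite -ball_normE /= => yc; exists kk.
have [r0 k0 _ cone] := pP _ (cD kk).
have rle : r <= (p (c kk)).1.2 / 2 by exact: bigmin_le_cond.
have kle : kappa <= (p (c kk)).2 by exact: bigmin_le_cond.
move=> x Dx xy t w t0 tr wx; apply: (cone x Dx _ t w t0).
- move: yc; rewrite /rad mem_set ?ck -?ck; last exact: cD.
  rewrite distrC => yc; apply: le_lt_trans (ler_distD y _ _) _.
  by rewrite [ltRHS]splitr ltrD// (lt_le_trans xy).
- by apply: (le_trans tr); apply: (le_trans rle); rewrite ler_pdivrMr//; nra.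
- by apply: lt_le_trans wx _; rewrite ler_wpM2r// ltW.
Qed.

End interior_cone.

(** * Poincare inequality on the sample *)

Section lattice_cells.
Context (R : realType) (d : nat).

Definition cell (s : R) (x : 'rV[R]_d) : 'rV[int]_d :=
  \row_j Num.floor (x 0 j / s).

Definition full_cell (D : set 'rV[R]_d) (s : R) (w : 'rV[int]_d) :=
  forall x, cell s x = w -> D x.

(** The ray in direction [e], measured in cell sides and rounded to the lattice. *)
Definition ray (e : 'rV[R]_d) (tau : nat) : 'rV[int]_d :=
  \row_j Num.floor (tau%:R * e 0 j).

(** The floors differ by less than p + 1, and integrality gains the rest. *)
Lemma floor_near (a b : R) (p : nat) : `|a - b| <= p%:R ->
  `|Num.floor a - Num.floor b| <= p%:Z.
Proof.
move=> ab; have /andP[a1 a2] := floor_itv a; have /andP[b1 b2] := floor_itv b.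
move: ab; rewrite ler_norml => /andP[ab1 ab2].
have : (Num.floor a)%:~R < (Num.floor b + 1 + p%:Z)%:~R :> R.
  by move: b2; rewrite !intrD -!pmulrn => b2; lra.
have : (Num.floor b)%:~R < (Num.floor a + 1 + p%:Z)%:~R :> R.
  by move: a2; rewrite !intrD -!pmulrn => a2; lra.
rewrite !ltr_int; lia.
Qed.

Lemma ray_le (e : 'rV[R]_d) (tau : nat) : (forall j, `|e 0 j| <= 1) -> supn_le (ray e tau) tau.
Proof.
move=> e1; apply/supn_leP => j; rewrite mxE.
have := @floor_near (tau%:R * e 0 j) 0 tau.
rewrite floor0 !subr0; apply.
by rewrite normrM ger0_norm// ler_piMr.
Qed.

Lemma ray_step (e : 'rV[R]_d) (tau : nat) : (forall j, `|e 0 j| <= 1) ->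
  supn_le (ray e tau - ray e tau.+1) 1.
Proof.
move=> e1; apply/supn_leP => j; rewrite !mxE; apply: floor_near.
by rewrite -mulrBl -natr1 opprD addrA subrr sub0r mulN1r normrN.
Qed.

(** Rounding [x], [w] and the ray produces three fractional parts, which together contribute less
    than 2 in absolute value. Each coordinate of [w] thus misses the axis by less than s (2 + p),
    which the opening kappa s tau absorbs. *)
Lemma inward_cone_full_cell D (y e x : 'rV[R]_d) (r kappa s : R) (tau p : nat) (l : 'rV[int]_d) :
  inward_cone D y e r kappa -> D x -> `|x - y| < r ->
  0 < s -> 0 < kappa -> (0 < tau)%N -> s * tau%:R <= r -> (2 + p)%:R <= kappa * tau%:R ->
  supn_le l p -> full_cell D s (cell s x + ray e tau + l).
Proof.
move=> cone Dx xy s0 k0 tau0 str pk /supn_leP lp w wE.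
have tauR : 0 < tau%:R :> R by rewrite ltr0n.
apply: (cone x Dx xy (s * tau%:R)) => //; first by rewrite mulr_gt0.
apply: rV_norm_lt; first by rewrite !mulr_gt0.
move=> j; move/rowP : wE => /(_ j); rewrite !mxE => wE.
have := lp j; move: (l 0 j) wE => lj wE ljp.
have ljR : `|lj%:~R| <= p%:R :> R by rewrite -intr_norm pmulrn ler_int.
have /andP[w1 w2] := floor_itv (w 0 j / s).
have /andP[x1 x2] := floor_itv (x 0 j / s).
have /andP[e1 e2] := floor_itv (tau%:R * e 0 j).
move: w1 w2 x1 x2 e1 e2; rewrite wE !intrD => w1 w2 x1 x2 e1 e2.
have -> : w 0 j - (x 0 j + s * tau%:R * e 0 j) =
    s * (w 0 j / s - x 0 j / s - tau%:R * e 0 j).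
  by field; rewrite lt0r_neq0.
rewrite normrM gtr0_norm// mulrCA ltr_pM2l//.
apply: lt_le_trans pk; rewrite natrD ltr_norml.
move: ljR; rewrite ler_norml => /andP[l1 l2].
by apply/andP; split; lra.
Qed.

Lemma cell_near (s : R) (x y : 'rV[R]_d) p : 0 < s -> `|x - y| <= s * p%:R ->
  supn_le (cell s x - cell s y) p.
Proof.
move=> s0 xy; apply/supn_leP => j; rewrite !mxE; apply: floor_near.
rewrite -mulrBl normrM [X in _ * X]gtr0_norm ?invr_gt0// ler_pdivrMr// mulrC.
apply: le_trans xy; have := rV_coord_le_norm (x - y) j.
by rewrite !mxE.
Qed.

Lemma supn_le0 t : supn_le (0 : 'rV[int]_d) t.
Proof. by apply/supn_leP => j; rewrite mxE normr0. Qed.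

(* Every label class meeting [D] is compared with a mean of cell averages taken
   at distance of order [delta] inside [D], along the cone direction of the
   class. *)
Lemma graph_poincare D (K : nat) (e : 'I_K -> 'rV[R]_d) (r kappa : R)
    (t : nat) (J : finType) (lab : 'rV[R]_d -> J) (delta s lo hi : R)
    (n : nat) (x : 'I_n -> 'rV[R]_d) (v : 'I_n -> R) :
  0 < r -> 0 < kappa -> (forall k j, `|e k 0 j| <= 1) ->
  (forall y, D y -> exists k, inward_cone D y (e k) r kappa) ->
  (0 < t)%N -> 2 <= kappa * t%:R ->
  0 < delta -> 4 * delta * t%:R <= r ->
  (forall x y, D x -> D y -> lab x = lab y -> `|x - y| < delta) ->
  0 < s -> s <= delta -> 0 < lo -> lo <= hi ->
  (forall i, D (x i)) ->
  (forall w, cell_count R (fun i => cell s (x i)) w <= hi) ->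
  (forall w, full_cell D s w -> lo <= cell_count R (fun i => cell s (x i)) w) ->
  exists c : J -> R,
    (forall j, `|c j| <= (2 * s / delta) ^+ d / lo * \sum_i `|v i|) /\
    \sum_i `|v i - c (lab (x i))| <=
      K%:R * (1 + 3 * t%:R + 3 * 7 ^+ d) * (delta / s) * (hi / lo ^+ 2) *
      near_variation (fun i => cell s (x i)) v t.
Proof.
move=> r0 k0 e1 cone t0 tk de0 detr labD s0 sde lo0 lohi Dx hiN loN.
(* Side of the averaging boxes, in cells; [s <= delta] makes it at least 1. *)
pose m := Num.trunc (delta / s).
have ds1 : 1 <= delta / s by rewrite ler_pdivlMr// mul1r.
have /andP[m1 m2] : m%:R <= delta / s < m.+1%:R.
  by apply: truncn_itv; apply: le_trans ds1.
move: m m1 m2 => m m1 m2.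
have m0 : (0 < m)%N by rewrite -(ltr_nat R); move: m2; rewrite -natr1 => m2; lra.
have ms : s * m%:R <= delta by rewrite mulrC -ler_pdivlMr.
have ms2 : delta < s * m.+1%:R by rewrite mulrC -ltr_pdivrMr.
have tR : 1 <= t%:R :> R by rewrite ler1n.
have mR : 1 <= m%:R :> R by rewrite ler1n.
pose z i := cell s (x i).
(* Number of steps after the jump by [t]. As kappa t >= 2, at place t + k = (2 m + 2) t the cone has
   room for all translations of size up to 2 m + 1 that [sum_box_mean_le] asks for. *)
pose k := (m.*2.+1 * t)%N.
have str tau : (tau <= t + k)%N -> s * tau%:R <= r.
  move=> tauk; apply: le_trans detr.
  apply: (@le_trans _ _ (s * (4 * m%:R * t%:R))).
    rewrite ler_pM2l//; have : (tau <= 4 * m * t)%N.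
      by rewrite (leq_trans tauk)// /k -mulSn leq_mul2r; apply/orP; right; clear -m0; lia.
    by rewrite -(ler_nat R) !natrM.
  have : s * m%:R * (4 * t%:R) <= delta * (4 * t%:R) by rewrite ler_wpM2r//; lra.
  by move=> H; nra.
have der : delta < r by nra.
have kap tau p : (t <= tau)%N -> (p = 0)%N \/ (tau = t + k)%N /\ (p <= m.*2.+1)%N ->
    (2 + p)%:R <= kappa * tau%:R.
  move=> ttau [->|[-> pm]].
    by apply: (le_trans tk); rewrite ler_pM2l// ler_nat.
  apply: (@le_trans _ _ (2 * (1 + m.*2.+1)%:R)).
    have pm2 : (2 + p <= 2 * (1 + m.*2.+1))%N by clear -pm; lia.
    by move: pm2; rewrite -(ler_nat R) natrM.
  apply: (@le_trans _ _ (kappa * t%:R * (1 + m.*2.+1)%:R)).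
    by rewrite ler_wpM2r.
  by rewrite -mulrA ler_pM2l// /k mulnC -mulnS natrM add1n.
have A0 : 0 <= 1 + 3 * t%:R + 3 * 7 ^+ d :> R.
  by rewrite !addr_ge0 ?mulr_ge0 ?exprn_ge0.
have hi0 : 0 < hi by exact: lt_le_trans lohi.
have ds0 : 0 <= delta / s by exact: le_trans ds1.
have h0 : 0 <= hi / lo ^+ 2 by rewrite divr_ge0 ?exprn_ge0 ?(ltW lo0) ?(ltW hi0).
have V0 : 0 <= near_variation z v t by exact: near_variation_ge0.
(* If [D] is empty there are no sample points and zero coefficients serve. Otherwise [y0] provides a
   direction index for the classes that miss [D]. *)
have [[y0 Dy0]|nD] := pselect (exists y, D y); last first.
  exists (fun=> 0); split => [j|].
    rewrite normr0 mulr_ge0 ?sumr_ge0// divr_ge0 ?(ltW lo0)// exprn_ge0//.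
    by rewrite divr_ge0// ?mulr_ge0// ltW.
  rewrite big1 => [|i _]; last by case: nD; exists (x i).
  exact: mulr_ge0 (mulr_ge0 (mulr_ge0 (mulr_ge0 _ A0) ds0) h0) V0.
have rep_ex (j : J) : exists p : 'rV[R]_d * 'I_K,
    (exists2 y, D y & lab y = j) ->
    [/\ D p.1, lab p.1 = j & inward_cone D p.1 (e p.2) r kappa].
  have [[y Dy yj]|nj] := pselect (exists2 y, D y & lab y = j).
    by have [kk ck] := cone _ Dy; exists (y, kk).
  by have [kk _] := cone _ Dy0; exists (0, kk).
have {rep_ex}/boolp.choice[p pP] := rep_ex.
pose q (kk : 'I_K) tau := ray (e kk) (t + tau).
pose cc j := box_mean z v m (cell s (p j).1 + q (p j).2 k).
(* For a class that misses [D] no cell is known to be populated, so the coefficient is set to 0. *)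
pose c j := if `[< exists2 y, D y & lab y = j >] then cc j else 0.
have full (y : 'rV[R]_d) j tau l pp : D y -> lab y = j -> (t <= tau <= t + k)%N ->
    (pp = 0)%N \/ (tau = t + k)%N /\ (pp <= m.*2.+1)%N -> supn_le l pp ->
    lo <= cell_count R z (cell s y + ray (e (p j).2) tau + l).
  move=> Dy yj /andP[ttau tauk] ppP lpp; apply: loN.
  have [|Dp labp cp] := pP j; first by exists y.
  apply: (inward_cone_full_cell cp Dy) lpp => //.
  - apply: lt_trans der; apply: labD => //; exact: etrans (esym labp).
  - exact: leq_trans ttau.
  - exact: str.
  - exact: kap.
exists c; split => [j|].
  rewrite /c; case: asboolP => [[y Dy yj]|_]; last first.
    rewrite normr0 mulr_ge0 ?sumr_ge0// divr_ge0 ?(ltW lo0)// exprn_ge0//.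
    by rewrite divr_ge0// ?mulr_ge0// ltW.
  have [|Dp labp cp] := pP j; first by exists y.
  apply: (le_trans (box_mean_norm_le v lo0 m0 _)) => [l lm|].
    rewrite /cc /q; apply: (full _ j _ _ m) => //; first by rewrite leq_addr leqnn.
    by right; split => //; clear; lia.
  rewrite ler_wpM2r ?sumr_ge0// invfM ler_wpM2r ?invr_ge0 ?(ltW lo0)//.
  rewrite -exprVn lerXn2r ?nnegrE ?invr_ge0//.
    by rewrite divr_ge0// ?mulr_ge0// ltW.
  rewrite ler_pdivlMr// -[leRHS]mulr1 mulrC ler_pdivrMr; last lra.
  apply: (le_trans (ltW ms2)); rewrite -natr1; nra.
(* The path of a point depends only on the direction index of its class; splitting the sum by this
   index gives the factor [K]. *)
rewrite (partition_big (fun i => (p (lab (x i))).2) xpredT)//=.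
set B := (1 + 3 * t%:R + 3 * 7 ^+ d) * (delta / s) * (hi / lo ^+ 2) *
  near_variation z v t.
rewrite [leRHS](_ : _ = \sum_(kk < K) B); last first.
  by rewrite sumr_const card_ord -[RHS]mulr_natl /B !mulrA.
apply: ler_sum => kk _.
have -> : \sum_(i | (p (lab (x i))).2 == kk) `|v i - c (lab (x i))| =
  \sum_(i | (p (lab (x i))).2 == kk) `|v i - box_mean z v m (cell s (p (lab (x i))).1 + q kk k)|.
  apply: eq_bigr => i /eqP ikk; rewrite /c asboolT ?/cc ?ikk//.
  by exists (x i).
apply: (le_trans (@sum_dist_box_mean_le _ _ _ z v lo hi lo0 hiN _ (q kk)
    (fun i => cell s (p (lab (x i))).1) k m m.+1 t m0 t0 _ _ _ _ _)).
- by rewrite /q addn0; exact: ray_le.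
- by move=> j; rewrite /q addnS; exact: ray_step.
- move=> i j /eqP ikk jk; have := full (x i) (lab (x i)) (t + j)%N 0 0%N.
  rewrite addr0 ikk; apply => //; [|by left|exact: supn_le0].
  by rewrite leq_addr leq_add2l.
- move=> i ikk; have [|Dp labp cp] := pP (lab (x i)); first by exists (x i).
  apply: cell_near => //; apply/ltW; apply: lt_trans ms2.
  exact: labD.
- move=> i l /eqP ikk lm; have := full (x i) (lab (x i)) (t + k)%N l _ _ _ _ _ lm.
  rewrite ikk; apply => //; first by rewrite leq_addr leqnn.
  by right; split => //; clear; lia.
rewrite /B ler_wpM2r//.
have hl : lo^-1 <= hi / lo ^+ 2.
  by rewrite expr2 invfM mulrA ler_peMl ?invr_ge0 ?(ltW lo0)// ler_pdivlMr// mul1r.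
(* The enlarged box has 2 (2 m + 1) + 1 = 4 m + 3 cells per side, at most 7 m. *)
have A7 : (m%:R ^+ d)^-1 * ((m.+1 + m).*2.+1)%:R ^+ d <= 7 ^+ d :> R.
  rewrite ler_pdivrMl ?exprn_gt0 ?ltr0n// -exprMn lerXn2r ?nnegrE ?mulr_ge0//.
  have m7 : ((m.+1 + m).*2.+1 <= m * 7)%N by clear -m0; lia.
  by move: m7; rewrite -(ler_nat R) natrM.
have m3 : (m.+1 + m)%:R <= 3 * m%:R :> R.
  have m3 : (m.+1 + m <= 3 * m)%N by clear -m0; lia.
  by move: m3; rewrite -(ler_nat R) natrM.
have k3 : k%:R <= 3 * t%:R * m%:R :> R.
  have k3 : (k <= 3 * t * m)%N by rewrite /k [(3 * t * m)%N]mulnAC leq_mul2r; apply/orP; right; clear -m0; lia.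
  by move: k3; rewrite -(ler_nat R) !natrM.
apply: (@le_trans _ _ ((1 + (3 * t%:R * m%:R + 7 ^+ d * (3 * m%:R))) * (hi / lo ^+ 2))).
  rewrite [leRHS]mulrDl mul1r lerD// ler_wpM2r// lerD//.
  apply: ler_pM => //; by rewrite mulr_ge0// ?invr_ge0 exprn_ge0.
rewrite ler_wpM2r//.
have s7 : 0 <= 7 ^+ d :> R by rewrite exprn_ge0.
apply: (@le_trans _ _ ((1 + 3 * t%:R + 3 * 7 ^+ d) * m%:R)); first nra.
by rewrite ler_wpM2l.
Qed.

End lattice_cells.

(** * Concentration of cell counts *)

Section exponential_bound.
Context (R : realType).

(** From exp x <= 1 / (1 - x) and (1 + x + 2 x^2) (1 - x) = 1 + x^2 (1 - 2 x), which explains the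
    threshold 1/2. *)
Lemma expR_le_quadratic (x : R) : x <= 1 / 2 -> expR x <= 1 + x + 2 * x ^+ 2.
Proof.
move=> x2; have x1 : 0 < 1 - x by lra.
have : expR x <= (1 - x)^-1.
  by rewrite -[x in expR x]opprK expRN lef_pV2 ?posrE ?expR_gt0// expR_ge1Dx.
move=> /le_trans; apply; rewrite -[leLHS]mul1r ler_pdivrMr// expr2; nra.
Qed.

(** Exponential decay put in the form of a telescoping summable series; it follows from exp (x n) >=
    (1 + x n / 2)^2. *)
Lemma expRN_linear_le (x : R) n : 0 < x ->
  expR (- (x * n%:R)) <= 2 * (1 + 2 / x) ^+ 2 / (n.+1%:R * n.+2%:R).
Proof.
move=> x0; rewrite ler_pdivlMr ?mulr_gt0// expRN mulrC ler_pdivrMr ?expR_gt0//.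
have -> : x * n%:R = 2%:R * (x / 2 * n%:R) by field.
have n0 : 0 <= n%:R :> R by [].
rewrite mulr_natl expRM_natl.
have h : 1 + x / 2 * n%:R <= expR (x / 2 * n%:R) by exact: expR_ge1Dx.
have h0 : 0 <= 1 + x / 2 * n%:R by rewrite addr_ge0// mulr_ge0// divr_ge0// ltW.
apply: (@le_trans _ _ (2 * (1 + 2 / x) ^+ 2 * (1 + x / 2 * n%:R) ^+ 2)); last first.
  apply: ler_wpM2l; first by rewrite mulr_ge0 ?sqr_ge0.
  by rewrite lerXn2r// nnegrE ?expR_ge0.
rewrite -mulrA -exprMn.
have h1 : n.+1%:R <= (1 + 2 / x) * (1 + x / 2 * n%:R).
  rewrite mulrDl mul1r mulrDr mulr1 -natr1.
  have -> : 2 / x * (x / 2 * n%:R) = n%:R by field; rewrite lt0r_neq0.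
  have : 0 <= 2 / x by rewrite divr_ge0// ltW.
  have : 0 <= x / 2 * n%:R by rewrite mulr_ge0// divr_ge0// ltW.
  lra.
apply: (@le_trans _ _ (2 * n.+1%:R ^+ 2)).
  rewrite -!natr1 expr2; nra.
by rewrite ler_pM2l// lerXn2r// nnegrE//; exact: le_trans h1.
Qed.

End exponential_bound.

Section borel_cantelli.
Context (R : realType) (dO : measure_display) (Omega : measurableType dO).
Context (P : probability Omega R).

Lemma sum_inv_quadratic (N : nat) :
  \sum_(0 <= n < N) (n.+1%:R * n.+2%:R)^-1 = 1 - N.+1%:R^-1 :> R.
Proof.
elim: N => [|N IH]; first by rewrite big_nil invr1 subrr.
rewrite big_nat_recr//= IH -!natr1; field.
have N0 : 0 <= N%:R :> R by [].
by apply/andP; split; apply: lt0r_neq0; lra.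
Qed.

Lemma measure_bigsetU_le (I : Type) (r : seq I) (Q : pred I) (F : I -> set Omega) :
  (forall i, measurable (F i)) ->
  (P (\big[setU/set0]_(i <- r | Q i) F i) <= \sum_(i <- r | Q i) P (F i))%E.
Proof.
move=> mF.
have [] : measurable (\big[setU/set0]_(i <- r | Q i) F i) /\
  (P (\big[setU/set0]_(i <- r | Q i) F i) <= \sum_(i <- r | Q i) P (F i))%E; last by [].
elim/big_ind2 : _ => [|A x B y [mA Ax] [mB By]|i _].
- by split => //; rewrite measure0.
- split; first exact: measurableU.
  by apply: (le_trans (measureU2 _ mA mB)); exact: leeD.
- by split.
Qed.

(** Borel-Cantelli with a telescoping majorant of sum at most [C]. Shifting by [N] discards the
    indices without a bound. *)
Lemma ae_eventually_not (F : nat -> set Omega) (C : R) (N : nat) :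
  (forall n, measurable (F n)) ->
  (forall n, (N <= n)%N -> (P (F n) <= (C / (n.+1%:R * n.+2%:R))%:E)%E) ->
  {ae P, forall w, exists N, forall n, (N <= n)%N -> ~ F n w}.
Proof.
move=> mF PF.
have C0 : 0 <= C.
  have := le_trans (measure_ge0 P (F N)) (PF _ (leqnn N)).
  by rewrite lee_fin pmulr_lge0// invr_gt0 mulr_gt0.
pose G n := F (n + N)%N.
have PG : P (lim_sup_set G) = 0.
  apply: lim_sup_set_cvg0 => [n|]; first exact: mF.
  apply: (@le_lt_trans _ _ C%:E); last exact: ltry.
  apply: lime_le; first exact: is_cvg_nneseries.
  apply: nearW => n.
  apply: (@le_trans _ _ (\sum_(0 <= k < n) (C * (k.+1%:R * k.+2%:R)^-1)%:E)%E).
    apply: lee_sum => k _; apply: (le_trans (PF _ (leq_addl _ _))).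
    rewrite lee_fin ler_wpM2l// lef_pV2 ?posrE ?mulr_gt0//.
    by rewrite -!natrM ler_nat leq_mul// ltnS ?ltnS leq_addr.
  rewrite sumEFin lee_fin -mulr_sumr sum_inv_quadratic ler_piMr//.
exists (lim_sup_set G); split => //.
  apply: bigcap_measurable => [|n _]; first by exists 0%N.
  by apply: bigcup_measurable => k _; exact: mF.
move=> w /= nE n _; apply: contrapT => nG; apply: nE; exists (n + N)%N => k nk Fk.
apply: nG; have Nk : (N <= k)%N by rewrite (leq_trans _ nk)// leq_addl.
exists (k - N)%N; first by rewrite /= leq_subRL// addnC.
by rewrite /G subnK.
Qed.

End borel_cantelli.

Section empirical_counts.
Context (R : realType) (dO : measure_display) (Omega : measurableType dO).
Context (P : probability Omega R) (d' : measure_display).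
Context (T : measurableType d') (nu : probability T R).
Context (X : nat -> {RV P >-> T}) (X_iid : iid nu X).

Definition hits (n : nat) (B : set T) (w : Omega) : nat :=
  \sum_(i < n) (X i w \in B).

Let pattern n (B : set T) (f : {ffun 'I_n -> bool}) : set Omega :=
  [set w | forall i : 'I_n, (X i w \in B) = f i].

Lemma pattern_prob n B (f : {ffun 'I_n -> bool}) : measurable B ->
  measurable (pattern B f) /\
  P (pattern B f) = (\prod_(i < n) (if f i then fine (nu B) else 1 - fine (nu B)))%:E.
Proof.
move=> mB; have [Xind Xd] := X_iid.
have nuB : (fine (nu B))%:E = nu B by rewrite fineK// fin_num_measure.
pose J : {fset nat} := [fset i in iota 0 n]%fset.
(* [mutually_independent] takes a family indexed by [nat], so [f] is extended to all natural
   numbers. *)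
pose g (k : nat) := if insub k is Some i then f i else true.
pose Bk k := if g k then B else ~` B.
have mBk k : measurable (Bk k) by rewrite /Bk; case: (g k) => //; exact: measurableC.
have gE (i : 'I_n) : g i = f i by rewrite /g insubT//= => ii; congr (f _); exact: val_inj.
have patE : pattern B f = \bigcap_(i in [set` J]) X i @^-1` Bk i.
  apply/seteqP; split => [w wf k /=|w wf i].
    rewrite !inE /= mem_iota add0n => /andP[_ kn].
    have := wf (Ordinal kn); rewrite -gE /= /Bk => <-.
    by case: ifPn => [/set_mem//|/negP kB] /= Bw; apply: kB; exact/mem_set.
  have /= := wf i; rewrite !inE mem_iota /= add0n ltn_ord => /(_ isT).
  rewrite /Bk gE; case: (f i) => /= [Bw|nBw]; first exact/mem_set.
  by apply/negbTE/negP => /set_mem.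
have mX k : measurable (X k @^-1` Bk k).
  by rewrite -[X in measurable X]setTI; exact: measurable_funP.
split.
  by rewrite patE; apply: fin_bigcap_measurable => // k _; exact: mX.
rewrite patE Xind//.
have -> : (\prod_(i <- J) P (X i @^-1` Bk i) = \prod_(i <- iota 0 n) P (X i @^-1` Bk i))%E.
  apply: perm_big; apply: uniq_perm; [exact: fset_uniq|exact: iota_uniq|].
  by move=> k; rewrite !inE.
have -> : iota 0 n = index_iota 0 n by rewrite /index_iota subn0.
rewrite big_mkord.
rewrite -prodEFin; apply: eq_bigr => i _.
have := Xd i (Bk i) (mBk _); rewrite /distribution /pushforward => ->.
rewrite /Bk gE; case: (f i) => //.
by rewrite probability_setC// -nuB.
Qed.

(* Markov's inequality for [y ^ hits]; summing over the 2^n hit patterns avoids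
   expectations. *)
Lemma hits_markov n B (Q : nat -> bool) (K y : R) : measurable B -> 0 <= K -> 0 <= y ->
  (forall m, Q m -> 1 <= K * y ^+ m) ->
  measurable [set w | Q (hits n B w)] /\
  (P [set w | Q (hits n B w)] <=
    (K * (1 + fine (nu B) * (y - 1)) ^+ n)%:E)%E.
Proof.
move=> mB K0 y0 Qy; set p := fine (nu B).
have p01 : 0 <= p <= 1.
  rewrite /p fine_ge0 ?measure_ge0//= -lee_fin fineK ?fin_num_measure//.
  exact: probability_le1.
have /andP[p0 p1] := p01.
have HE : [set w | Q (hits n B w)] =
    \big[setU/set0]_(f : {ffun 'I_n -> bool} | Q (\sum_i f i)%N) pattern B f.
  rewrite -bigcup_seq_cond; apply/seteqP; split => [w Qw|w [f /= /andP[_ Qf] wf]].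
    exists [ffun i : 'I_n => X i w \in B]; last by move=> i; rewrite ffunE.
    rewrite /= mem_index_enum/=; under eq_bigr do rewrite ffunE.
    exact: Qw.
  by rewrite /hits; under eq_bigr do rewrite wf.
have mp (f : {ffun 'I_n -> bool}) := (pattern_prob f mB).1.
split.
  by rewrite HE; apply: bigsetU_measurable => f _; exact: mp.
rewrite HE; apply: (le_trans (measure_bigsetU_le _ _ _ mp)).
under eq_bigr do rewrite (pattern_prob _ mB).2.
rewrite sumEFin lee_fin.
(* The [n]-th power of this two-term sum expands into one product per hit pattern. *)
have -> : 1 + p * (y - 1) = \sum_(b : bool) (if b then p * y else 1 - p).
  by rewrite big_bool/=; ring.
rewrite -[n in _ ^+ n]card_ord -prodr_const bigA_distr_bigA mulr_sumr.
apply: (@le_trans _ _ (\sum_(f : {ffun 'I_n -> bool} | Q (\sum_i f i)%N)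
   K * \prod_i (if f i then p * y else 1 - p))); last first.
  apply: ler_sum_sub => // f _; rewrite mulr_ge0// prodr_ge0// => i _.
  by case: (f i); [rewrite mulr_ge0|rewrite subr_ge0].
apply: ler_sum => f Qf.
have -> : \prod_i (if f i then p * y else 1 - p) =
    y ^+ (\sum_i f i) * \prod_i (if f i then p else 1 - p).
  rewrite -prodrXr -big_split/=; apply: eq_bigr => i _.
  by case: (f i); rewrite ?expr1 ?expr0 ?mul1r// mulrC.
rewrite mulrA ler_peMl ?Qy// prodr_ge0// => i _.
by case: (f i) => //; rewrite subr_ge0.
Qed.

Lemma nu_fine_ge0_le1 (B : set T) : measurable B -> 0 <= fine (nu B) <= 1.
Proof.
move=> mB; rewrite fine_ge0 ?measure_ge0//= -lee_fin fineK ?fin_num_measure//.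
exact: probability_le1.
Qed.

(** [hits_markov] with y = exp theta. Positive [theta] gives the upper tail and negative [theta] the
    lower one; [theta <= 1 / 2] is what the quadratic bound on exp asks for. *)
Lemma hits_chernoff n B (theta tau : R) : measurable B ->
  theta <= 1 / 2 ->
  measurable [set w | theta * (n%:R * fine (nu B)) + tau <= theta * (hits n B w)%:R] /\
  (P [set w | (theta * (n%:R * fine (nu B)) + tau <= theta * (hits n B w)%:R)%R] <=
    (expR (2 * (n%:R * fine (nu B)) * theta ^+ 2 - tau))%:E)%E.
Proof.
move=> mB theta2; set p := fine (nu B).
have /andP[p0 p1] : 0 <= p <= 1 by exact: nu_fine_ge0_le1.
have [m H|mS PS] := @hits_markov n B
  (fun m => theta * (n%:R * p) + tau <= theta * m%:R)
  (expR (- (theta * (n%:R * p) + tau))) (expR theta) mB (expR_ge0 _) (expR_ge0 _).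
  by rewrite -expRM_natr -expRD -[leLHS]expR0 ler_expR addrC subr_ge0.
split; first exact: mS.
apply: (le_trans PS); rewrite lee_fin -/p.
apply: (@le_trans _ _ (expR (- (theta * (n%:R * p) + tau)) *
    expR (n%:R * (p * (theta + 2 * theta ^+ 2))))); last first.
  by rewrite -expRD ler_expR le_eqVlt; apply/orP; left; apply/eqP; ring.
rewrite ler_wpM2l ?expR_ge0// expRM_natl lerXn2r ?nnegrE ?expR_ge0//.
  by have := mulr_ge0 p0 (expR_ge0 theta); lra.
apply: le_trans (expR_ge1Dx _); rewrite lerD2l ler_wpM2l//.
by have := expR_le_quadratic theta2; lra.
Qed.

(** Deviations of size n / (k + 1) on either side have exponentially small probability, so
    Borel-Cantelli applies for each [k], and countably many null sets are discarded. *)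
Lemma strong_law_of_large_numbers (B : set T) : measurable B ->
  {ae P, forall w, (hits n B w)%:R / n%:R @[n --> \oo] --> fine (nu B)}.
Proof.
move=> mB; set p := fine (nu B).
have /andP[p0 p1] : 0 <= p <= 1 by exact: nu_fine_ge0_le1.
pose t (k : nat) : R := k.+1%:R^-1.
have t0 k : 0 < t k by rewrite invr_gt0.
have t1 k : t k <= 1 by rewrite invf_le1// ler1n.
(* With theta = t/4 or -t/4 the exponent is 2 n p t^2 / 16 - n t^2 / 4, at most - n t^2 / 8 because
   p <= 1. *)
pose up k n := [set w | t k / 4 * (n%:R * p) + t k ^+ 2 / 4 * n%:R <=
  t k / 4 * (hits n B w)%:R].
pose dn k n := [set w | - (t k / 4) * (n%:R * p) + t k ^+ 2 / 4 * n%:R <=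
  - (t k / 4) * (hits n B w)%:R].
have bnd k n : n%:R * (p * (t k ^+ 2 / 8)) - t k ^+ 2 / 4 * n%:R <= - (t k ^+ 2 / 8 * n%:R).
  have : 0 <= n%:R * (t k ^+ 2 / 8) * (1 - p).
    by rewrite mulr_ge0 ?subr_ge0// mulr_ge0// divr_ge0// sqr_ge0.
  lra.
have tk k : 0 < t k ^+ 2 / 8 by rewrite divr_gt0// exprn_gt0.
have BC k : {ae P, forall w, exists N, forall n, (N <= n)%N -> ~ (up k n `|` dn k n) w}.
  have [C HC] : exists C, forall n, expR (- (t k ^+ 2 / 8 * n%:R)) <= C / (n.+1%:R * n.+2%:R).
    by eexists => n; exact: expRN_linear_le.
  apply: (@ae_eventually_not _ _ _ P _ (2 * C) 0%N) => [n|n _].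
    apply: measurableU.
      by have [] := @hits_chernoff n B (t k / 4) (t k ^+ 2 / 4 * n%:R) mB; first by have := t1 k; lra.
    by have [] := @hits_chernoff n B (- (t k / 4)) (t k ^+ 2 / 4 * n%:R) mB; first by have := t0 k; lra.
  have [|mu Pu] := @hits_chernoff n B (t k / 4) (t k ^+ 2 / 4 * n%:R) mB; first by have := t1 k; lra.
  have [|md Pd] := @hits_chernoff n B (- (t k / 4)) (t k ^+ 2 / 4 * n%:R) mB; first by have := t0 k; lra.
  apply: (le_trans (measureU2 _ mu md)); apply: (le_trans (leeD Pu Pd)).
  rewrite -EFinD lee_fin.
  have -> : 2 * C / (n.+1%:R * n.+2%:R) = C / (n.+1%:R * n.+2%:R) + C / (n.+1%:R * n.+2%:R) by ring.
  apply: lerD.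
    apply: le_trans (HC n); rewrite ler_expR; apply: le_trans (bnd k n); rewrite -/p; lra.
  apply: le_trans (HC n); rewrite ler_expR; apply: le_trans (bnd k n); rewrite -/p; lra.
have := (@ae_foralln _ _ _ P (fun k w => exists N, forall n, (N <= n)%N -> ~ (up k n `|` dn k n) w)).
move=> /(_ BC); apply: filterS => w Hw.
apply/cvgrPdist_lt => e e0.
have [k ke] : exists k, t k < e.
  have [k ke] := ltr_add_invr (y := 0) (x := e) e0.
  by exists k; rewrite add0r in ke.
have [N HN] := Hw k.
exists N.+1 => //= n Nn; have n0 : 0 < n%:R :> R by rewrite ltr0n (leq_trans _ Nn).
apply: lt_trans ke.
have := HN n (ltnW Nn); rewrite /up /dn /= => /not_orP[/negP + /negP].
rewrite -!ltNge => u1 u2.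
rewrite -(ltr_pM2r n0) -{2}(gtr0_norm n0) -normrM mulrBl divfK ?lt0r_neq0//.
have := t0 k => tk0; rewrite ltr_norml; apply/andP; split; nra.
Qed.

End empirical_counts.

(** * Cell probabilities under a density bounded above and below *)

Section density.
Context (R : realType) (d : nat) (D : set 'rV[R]_d).
Context (nu : probability 'rV[R]_d R) (rho : 'rV[R]_d -> R).
Hypotheses (D_open : open D) (nu_density : has_density_on D nu rho).
Hypothesis rho_continuous : {within D, continuous rho}.
Variables (m M : R).
Hypotheses (m_gt0 : 0 < m) (M_ge0 : 0 <= M) (rho_bounds : forall x, D x -> m <= rho x <= M).

Let mD : measurable D. Proof. exact: open_measurable_rV. Qed.

Lemma measurable_density : measurable_fun D rho.
Proof.
apply: (measurability _ (RGenOpens.measurableE R)) => _ [_ [a [b ->]] <-].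
have oab : open `]a, b[%classic by exact: interval_open.
have /continuousP cf := rho_continuous.
have /open_subspaceP[V oV VD] := cf _ oab.
rewrite setIC -VD; apply: measurableI => //; exact: open_measurable_rV.
Qed.

Lemma density_le A : measurable A -> (nu A <= M%:E * lebesgue_rV R d A)%E.
Proof.
move=> mA; rewrite nu_density//.
have mAD : measurable (A `&` D) by exact: measurableI.
apply: (@le_trans _ _ (\int[lebesgue_rV R d]_(x in A `&` D) (cst M%:E x))%E).
  apply: ge0_le_integral => //.
  - by move=> x [_ /rho_bounds/andP[mx _]]; rewrite lee_fin (le_trans (ltW m_gt0) mx).
  - apply/measurable_EFinP; by apply: measurable_funS measurable_density => //; exact: subIsetr.
  - move=> x [_ /rho_bounds/andP[_ rM]]; rewrite lee_fin; exact: rM.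
rewrite integral_cst//.
apply: lee_wpmul2l; first by rewrite lee_fin.
by apply: le_measure => //; exact: mem_set.
Qed.

Lemma density_ge A : measurable A -> A `<=` D ->
  (m%:E * lebesgue_rV R d A <= nu A)%E.
Proof.
move=> mA AD; rewrite nu_density// setIidl// -integral_cst//.
apply: ge0_le_integral => //.
- by move=> x _; rewrite lee_fin ltW.
- by apply/measurable_EFinP; apply: measurable_funS measurable_density.
- by move=> x /AD/rho_bounds/andP[mr _]; rewrite lee_fin; exact: mr.
Qed.

Lemma cell_setE (s : R) w : 0 < s ->
  [set x | cell s x = w] = [set x : 'rV[R]_d | forall i,
    `[s * (w 0 i)%:~R, s * (w 0 i + 1)%:~R[%classic (x ord0 i)].
Proof.
move=> s0; apply/seteqP; split => [x <- i|x xw].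
  rewrite /= in_itv/= !mxE.
  have /andP[h1 h2] := floor_itv (x 0 i / s).
  by rewrite mulrC -ler_pdivlMr// h1/= mulrC -ltr_pdivrMr.
apply/rowP => i; rewrite mxE; apply: floor_def.
have := xw i; rewrite /= in_itv/= => /andP[h1 h2].
by rewrite ler_pdivlMr// mulrC h1/= ltr_pdivrMr// mulrC.
Qed.

Lemma measurable_cell_set (s : R) w : 0 < s -> measurable [set x : 'rV[R]_d | cell s x = w].
Proof.
move=> s0; rewrite cell_setE//.
by apply: (measurable_box (A := fun i => `[s * (w 0 i)%:~R, s * (w 0 i + 1)%:~R[%classic)).
Qed.

Lemma lebesgue_cell_set (s : R) (w : 'rV[int]_d) : 0 < s ->
  lebesgue_rV R d [set x | cell s x = w] = (s ^+ d)%:E.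
Proof.
move=> s0; rewrite cell_setE//.
rewrite (@lebesgue_rV_box _ _ (fun i => `[s * (w 0 i)%:~R, s * (w 0 i + 1)%:~R[%classic))//.
rewrite -[in RHS](card_ord d) -prodr_const -prodEFin; apply: eq_bigr => i _.
rewrite lebesgue_measure_itv/= lte_fin ltr_pM2l// ltr_int ltzD1 lexx.
by rewrite -EFinD -mulrBr intrD addrAC subrr add0r mulr1.
Qed.

Lemma cell_prob_le (s : R) w : 0 < s ->
  fine (nu [set x | cell s x = w]) <= M * s ^+ d.
Proof.
move=> s0; have mc := measurable_cell_set w s0.
by rewrite -lee_fin fineK ?fin_num_measure// EFinM -(lebesgue_cell_set w s0) density_le.
Qed.

Lemma cell_prob_ge (s : R) w : 0 < s -> full_cell D s w ->
  m * s ^+ d <= fine (nu [set x | cell s x = w]).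
Proof.
move=> s0 fw; have mc := measurable_cell_set w s0.
by rewrite -lee_fin fineK ?fin_num_measure// EFinM -(lebesgue_cell_set w s0) density_ge.
Qed.

Lemma density_full : nu D = 1%E.
Proof.
rewrite nu_density// setIid -[X in (\int[_]_(x in X) _)%E]setTI -nu_density//.
exact: probability_setT.
Qed.

End density.

Section uniform_concentration.
Context (R : realType) (dO : measure_display) (Omega : measurableType dO).
Context (P : probability Omega R) (d' : measure_display).
Context (T : measurableType d') (nu : probability T R).
Context (X : nat -> {RV P >-> T}) (X_iid : iid nu X).

Lemma expR_ln_natX (n : nat) : (0 < n)%N -> expR (- (3 * ln n%:R)) = (n%:R ^+ 3)^-1 :> R.
Proof.
by move=> n0; rewrite expRN expRM_natl lnK// posrE ltr0n.
Qed.

(** There are O(n) sets and each is bad with probability at most 2 / n^3, since n q dominates ln n;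
    the union bound leaves a summable O(1 / n^2). *)
Lemma uniform_concentration (I : nat -> finType) (B : forall n, I n -> set T)
    (full : forall n, pred (I n)) (q : nat -> R) (m M C : R) (N : nat) :
  (forall n f, measurable (B n f)) -> 0 < m -> 0 < M -> 0 <= C ->
  (forall n, (N <= n)%N -> 0 <= q n) ->
  (forall n f, (N <= n)%N -> fine (nu (B n f)) <= M * q n) ->
  (forall n f, (N <= n)%N -> full n f -> m * q n <= fine (nu (B n f))) ->
  (forall n, (N <= n)%N -> #|I n|%:R <= C * n%:R) ->
  (forall n, (N <= n)%N -> 3 * ln n%:R <= M * (n%:R * q n)) ->
  (forall n, (N <= n)%N -> 3 * ln n%:R <= m / 16 * (n%:R * q n)) ->
  {ae P, forall w, exists N, forall n, (N <= n)%N -> forall f : I n,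
     (hits X n (B n f) w)%:R < 4 * M * (n%:R * q n) /\
     (full n f -> m / 4 * (n%:R * q n) < (hits X n (B n f) w)%:R)}.
Proof.
move=> mB m0 M0 C0 q0 nuM num cardI lnM lnm.
pose p n f := fine (nu (B n f)).
have p01 n f : 0 <= p n f <= 1 by exact: nu_fine_ge0_le1.
(* These offsets turn the events of [hits_chernoff], for theta = 1/2 and theta = -1/4, into hits >=
   4 M n q and hits <= (m / 4) n q. *)
pose tu n f := 2 * M * (n%:R * q n) - n%:R * p n f / 2.
pose tl n f := n%:R * p n f / 4 - m / 16 * (n%:R * q n).
pose up n f := [set w | 1 / 2 * (n%:R * p n f) + tu n f <= 1 / 2 * (hits X n (B n f) w)%:R].
pose dn n f := [set w | - (1 / 4) * (n%:R * p n f) + tl n f <= - (1 / 4) * (hits X n (B n f) w)%:R].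
have upP n f : measurable (up n f) /\ ((N <= n)%N -> (P (up n f) <= (expR (- (M * (n%:R * q n))))%:E)%E).
  have [|mu Pu] := @hits_chernoff _ _ _ P _ _ nu X X_iid n (B n f) (1/2) (tu n f) (mB n f); first lra.
  split => // Nn; apply: (le_trans Pu); rewrite lee_fin ler_expR /tu -/(p n f).
  have : n%:R * p n f <= n%:R * (M * q n) by rewrite ler_wpM2l// nuM.
  lra.
have dnP n f : measurable (dn n f) /\ ((N <= n)%N -> full n f -> (P (dn n f) <= (expR (- (m / 16 * (n%:R * q n))))%:E)%E).
  have [|md Pd] := @hits_chernoff _ _ _ P _ _ nu X X_iid n (B n f) (- (1/4)) (tl n f) (mB n f); first lra.
  split => // Nn ff; apply: (le_trans Pd); rewrite lee_fin ler_expR /tl -/(p n f).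
  have : n%:R * (m * q n) <= n%:R * p n f by rewrite ler_wpM2l// num.
  lra.
pose bad n f := up n f `|` (if full n f then dn n f else set0).
have mbad n f : measurable (bad n f).
  apply: measurableU; first exact: (upP n f).1.
  by case: (full n f) => //; exact: (dnP n f).1.
have Pbad n f : (N.+1 <= n)%N -> (P (bad n f) <= (2 * (n%:R ^+ 3)^-1)%:E)%E.
  move=> Nn; apply: (le_trans (measureU2 _ (upP n f).1 _)).
    by case: (full n f) => //; exact: (dnP n f).1.
  have n0 : (0 < n)%N by exact: leq_trans Nn.
  rewrite -expR_ln_natX// mulr_natl mulr2n EFinD; apply: leeD.
    by apply: (le_trans ((upP n f).2 (ltnW Nn))); rewrite lee_fin ler_expR lerN2 lnM// ltnW.
  case: ifPn => ff; last by rewrite measure0 lee_fin expR_ge0.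
  by apply: (le_trans ((dnP n f).2 (ltnW Nn) ff)); rewrite lee_fin ler_expR lerN2 lnm// ltnW.
(* The union bound gives 2 C / n^2, and (n + 1) (n + 2) <= 6 n^2 for n >= 1; hence 12 C. *)
have := @ae_eventually_not _ _ _ P (fun n => \big[setU/set0]_(f : I n) bad n f) (12 * C) N.+1.
move=> /(_ _ _)/(filterS _); apply => [w [N' HN']|n|n Nn].
- exists (maxn N' N) => n Nn f.
  have /HN' nb : (N' <= n)%N by rewrite (leq_trans _ Nn)// leq_maxl.
  have {}nb : ~ bad n f w.
    by move=> bf; apply: nb; rewrite -bigcup_seq; exists f => //=; rewrite mem_index_enum.
  split.
    rewrite ltNge; apply/negP => le; apply: nb; left; rewrite /up /= /tu; lra.
  move=> ff; rewrite ltNge; apply/negP => le; apply: nb; right; rewrite ff /dn /= /tl; lra.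
- exact: bigsetU_measurable.
apply: (le_trans (measure_bigsetU_le _ _ _ (mbad n))).
apply: (@le_trans _ _ (\sum_(f : I n) (2 * (n%:R ^+ 3)^-1)%:E)%E).
  by apply: lee_sum => f _; exact: Pbad.
rewrite sumEFin lee_fin sumr_const -[_ *+ _]mulr_natl.
have n0 : 0 < n%:R :> R by rewrite ltr0n (leq_trans _ Nn).
have n1 : 1 <= n%:R :> R by rewrite ler1n (leq_trans _ Nn).
apply: (@le_trans _ _ (C * n%:R * (2 * (n%:R ^+ 3)^-1))).
  by rewrite ler_wpM2r ?mulr_ge0 ?invr_ge0 ?exprn_ge0// cardI// ltnW.
have -> : C * n%:R * (2 * (n%:R ^+ 3)^-1) = C * 2 * (n%:R ^+ 2)^-1 by field; rewrite lt0r_neq0.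
have -> : 12 * C / (n.+1%:R * n.+2%:R) = C * 2 * (6 / (n.+1%:R * n.+2%:R)) by ring.
rewrite ler_wpM2l ?mulr_ge0// ler_pdivlMr ?mulr_gt0// mulrC ler_pdivrMr ?exprn_gt0//.
rewrite -!natr1; nra.
Qed.

End uniform_concentration.

(** * From the rates to the logarithmic growth of n eps^d *)

Section connectivity_rate.
Context (R : realType).

Lemma powR_natV_expn (x : R) (k : nat) : (0 < k)%N -> 0 <= x ->
  (x `^ (1 / k%:R)) ^+ k = x.
Proof.
move=> k0 x0; rewrite -powR_mulrn ?powR_ge0// -powRrM mul1r mulVf ?powRr1//.
by rewrite pnatr_eq0 -lt0n.
Qed.

Lemma ln_nat_ge1 : exists N, forall n, (N <= n)%N -> 1 <= ln n%:R :> R.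
Proof.
exists (Num.trunc (expR (1 : R))).+1 => n Nn.
have eN : expR 1 <= n%:R :> R.
  by apply: le_trans (ltW (truncnS_gt (expR 1 : R))) _; rewrite ler_nat.
have n0 : 0 < n%:R :> R by rewrite ltr0n (leq_trans _ Nn).
by rewrite -[leLHS]expRK ler_ln ?posrE ?expR_gt0.
Qed.

(* The rate required for [d = 2] is stronger than the connectivity rate, which is
   all that is used. *)
Lemma log_le_of_rate (d : nat) (hd : (2 <= d)%N) (eps : nat -> R)
  (eps_gt0 : forall n, (0 < n)%N -> 0 < eps n)
  (eps_rate2 : d = 2%N ->
    (ln n%:R `^ (3 / 4) / n%:R `^ (1 / 2) * (eps n)^-1) @[n --> \oo] --> 0)
  (eps_rate3 : (3 <= d)%N ->
    (ln n%:R `^ (1 / d%:R) / n%:R `^ (1 / d%:R) * (eps n)^-1)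
      @[n --> \oo] --> 0) (A : R) : 0 < A ->
  exists N, forall n, (N <= n)%N -> A * ln n%:R <= n%:R * eps n ^+ d.
Proof.
move=> A0; have d0 : (0 < d)%N by exact: leq_trans hd.
(* The [d]-th root of 1 / A: raising the rate to the power [d] turns the bound [r] into the
   claim. *)
pose r := A^-1 `^ (1 / d%:R).
have r0 : 0 < r by rewrite powR_gt0 ?invr_gt0.
have rA : r ^+ d = A^-1 by rewrite powR_natV_expn// invr_ge0 ltW.
have [N1 HN1] := ln_nat_ge1.
suff [N HN] : exists N, forall n, (N <= n)%N ->
    ln n%:R `^ (1 / d%:R) / n%:R `^ (1 / d%:R) * (eps n)^-1 <= r.
  exists (maxn N1 N).+1 => n; rewrite gtn_max => /andP[N1n Nn].
  have n0 : (0 < n)%N by exact: leq_ltn_trans Nn.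
  have l1 := HN1 _ (ltnW N1n); have e0 := eps_gt0 _ n0.
  have l0 : 0 <= ln n%:R :> R by lra.
  have nR : 0 < n%:R :> R by rewrite ltr0n.
  have := HN _ (ltnW Nn); rewrite -(@ler_pXn2r _ d)// ?nnegrE ?(ltW r0)//; last first.
    by rewrite mulr_ge0 ?divr_ge0 ?powR_ge0// invr_ge0 ltW.
  rewrite rA !exprMn !exprVn !powR_natV_expn//.
  by rewrite -mulrA -invfM ler_pdivrMr ?mulr_gt0 ?exprn_gt0// ler_pdivlMl.
case: (ltnP 2 d) => d2.
  have /cvgrPdist_lt/(_ _ r0)[N _ HN] := eps_rate3 d2.
  exists N => n Nn; have := HN n Nn; rewrite /= sub0r normrN => H.
  by apply: le_trans (ltW H); exact: ler_norm.
(* For [d = 2] the given exponent 3/4 is lowered to 1/2 = 1/d, which is allowed because ln n >=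
   1. *)
have dE : d = 2%N by apply/eqP; rewrite eqn_leq d2 hd.
have /cvgrPdist_lt/(_ _ r0)[N _ HN] := eps_rate2 dE.
exists (maxn N1 N).+1 => n; rewrite gtn_max => /andP[N1n Nn].
have n0 : (0 < n)%N by exact: leq_ltn_trans Nn.
have l1 := HN1 _ (ltnW N1n); have e0 := eps_gt0 _ n0.
have := HN n (ltnW Nn); rewrite /= sub0r normrN => H.
apply: le_trans (le_trans (ler_norm _) (ltW H)).
rewrite dE ler_wpM2r ?invr_ge0 ?(ltW e0)// ler_wpM2r ?invr_ge0 ?powR_ge0//.
by rewrite ler_powR//; lra.
Qed.

End connectivity_rate.

Section cell_concentration.
Context (R : realType) (d : nat) (D : set 'rV[R]_d).
Context (nu : probability 'rV[R]_d R) (rho : 'rV[R]_d -> R).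
Hypotheses (D_open : open D) (nu_density : has_density_on D nu rho).
Hypothesis rho_continuous : {within D, continuous rho}.
Variables (m M : R).
Hypotheses (m_gt0 : 0 < m) (M_gt0 : 0 < M) (rho_bounds : forall x, D x -> m <= rho x <= M).
Context (dO : measure_display) (Omega : measurableType dO).
Context (P : probability Omega R).
Context (X : nat -> {RV P >-> 'rV[R]_d}) (X_iid : iid nu X).

Lemma ae_sample_in_domain : {ae P, forall w, forall i, D (X i w)}.
Proof.
apply: (@ae_foralln _ _ _ P (fun i w => D (X i w))) => i.
have mD : measurable D by exact: open_measurable_rV.
have mXD : measurable (X i @^-1` (~` D)).
  by rewrite -[X in measurable X]setTI; apply: measurable_funP => //; exact: measurableC.
exists (X i @^-1` (~` D)); split => //.
have := X_iid.2 i (~` D) (measurableC mD).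
rewrite /distribution /pushforward => XD; apply: (eq_trans XD).
by rewrite probability_setC// (density_full D_open nu_density) subee.
Qed.

Lemma cell_countE n (s : R) w (om : Omega) :
  cell_count R (fun i : 'I_n => cell s (X i om)) w =
  (hits X n [set x | cell s x = w] om)%:R.
Proof.
rewrite /cell_count /hits big_mkcond natr_sum; apply: eq_bigr => i _.
case: eqP => H; first by rewrite mem_set.
by rewrite memNset.
Qed.

(** Only cells with indices in [-W, W]^d can meet [D]. Their number is O(s^-d), hence O(n) because n
    s^d >= ln n >= 1, as the union bound requires. All other cells are empty and not full. *)
Lemma cells_concentration (Kb : R) (s : nat -> R) (N0 : nat) :
  0 <= Kb -> (forall x, D x -> `|x| <= Kb) ->
  (forall n, (N0 <= n)%N -> 0 < s n <= 1) ->
  (forall A, 0 < A -> exists N, forall n, (N <= n)%N -> A * ln n%:R <= n%:R * s n ^+ d) ->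
  {ae P, forall om, (forall i, D (X i om)) /\
    exists N, forall n, (N <= n)%N -> forall w,
      cell_count R (fun i : 'I_n => cell (s n) (X i om)) w <= 4 * M * (n%:R * s n ^+ d) /\
      (full_cell D (s n) w ->
       m / 4 * (n%:R * s n ^+ d) <= cell_count R (fun i : 'I_n => cell (s n) (X i om)) w)}.
Proof.
move=> Kb0 DKb s01 rate.
pose W n := (Num.trunc (Kb / s n)).+1.
pose I n : finType := {ffun 'I_d -> 'I_(W n).*2.+1}.
pose dec n (f : I n) : 'rV[int]_d := \row_j ((f j : nat)%:Z - (W n)%:Z).
have decP n w : supn_le w (W n) -> exists f, w = dec n f.
  move=> /supn_leP wW; exists [ffun j => inord (absz (w 0 j + (W n)%:Z))].
  apply/rowP => j; rewrite mxE ffunE.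
  have := wW j; move: (w 0 j : int) => a aW.
  rewrite inordK; lia.
have [N1 HN1] := ln_nat_ge1 R.
have [N2 HN2] := rate (3 / M) (divr_gt0 (ltr0n _ 3) M_gt0).
have [N3 HN3] := rate (3 / (m / 16)) (divr_gt0 (ltr0n _ 3) (divr_gt0 m_gt0 (ltr0n _ 16))).
have [N4 HN4] := rate 1 ltr01.
pose N := maxn N0 (maxn (maxn N1 N2) (maxn N3 N4)).
have NP n : (N <= n)%N -> [/\ (N0 <= n)%N, (N1 <= n)%N, (N2 <= n)%N, (N3 <= n)%N & (N4 <= n)%N].
  by rewrite !geq_max => /andP[-> /andP[/andP[-> ->] /andP[-> ->]]].
have s0 n : (N <= n)%N -> 0 < s n by move=> /NP[/s01/andP[]].
(* Before [N] the side [s n] may fail to be positive; the empty set keeps [B] measurable there. *)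
pose B n (f : I n) := if (N <= n)%N then [set x | cell (s n) x = dec n f] else set0.
pose full n : pred (I n) := fun f => `[< full_cell D (s n) (dec n f) >].
have mB n f : measurable (B n f).
  by rewrite /B; case: ifPn => // Nn; apply: measurable_cell_set; exact: s0.
have sW n x : (N <= n)%N -> D x -> supn_le (cell (s n) x) (W n).
  move=> Nn /DKb xKb.
  have c0 : cell (s n) (0 : 'rV[R]_d) = 0 by apply/rowP => j; rewrite !mxE mul0r floor0.
  rewrite -[cell _ _]subr0 -c0.
  apply: cell_near; first exact: s0.
  rewrite subr0 (le_trans xKb)// mulrC -ler_pdivrMr ?s0//.
  by apply: ltW; exact: truncnS_gt.
have UC := @uniform_concentration _ _ _ P _ _ nu X X_iid I B full
  (fun n => s n ^+ d) m M ((2 * Kb + 5) ^+ d) N mB m_gt0 M_gt0.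
suff conc : {ae P, forall w, exists N', forall n, (N' <= n)%N -> forall f : I n,
     (hits X n (B n f) w)%:R < 4 * M * (n%:R * s n ^+ d) /\
     (full n f -> m / 4 * (n%:R * s n ^+ d) < (hits X n (B n f) w)%:R)}.
  move: ae_sample_in_domain conc; apply: filterS2.
  move=> om XD [N' HN']; split => //.
  exists (maxn N N') => n; rewrite geq_max => /andP[Nn N'n] w.
  rewrite cell_countE.
  have [wW|nwW] := boolP (supn_le w (W n)).
    have [f wf] := decP _ _ wW.
    have [up lw] := HN' n N'n f; rewrite /B Nn -wf in up lw.
    by split; [exact: ltW|move=> fw; apply/ltW/lw/asboolP; rewrite -wf].
  split.
    rewrite [X in X%:R]big1 ?mulr_ge0 ?exprn_ge0 ?(ltW (s0 _ Nn))// ?(ltW M_gt0)// => i _.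
    rewrite memNset// => /= wE; move/negP: nwW; apply; rewrite -wE.
    exact: sW.
  move=> fw; exfalso; move/negP: nwW; apply.
  (* The lower corner of the cell: if the cell were full this point would lie in [D], forcing [w]
     into the range. *)
  pose x : 'rV[R]_d := \row_j (s n * (w 0 j)%:~R).
  have xw : cell (s n) x = w.
    apply/rowP => j; rewrite !mxE mulrAC divff ?lt0r_neq0 ?s0// mul1r.
    by rewrite intrKfloor.
  by rewrite -xw; apply: sW => //; exact: fw.
apply: UC.
- by rewrite exprn_ge0// addr_ge0// mulr_ge0.
- by move=> n Nn; rewrite exprn_ge0// ltW// s0.
- move=> n f Nn; rewrite /B Nn; exact: (cell_prob_le D_open nu_density rho_continuous m_gt0 (ltW M_gt0) rho_bounds _ (s0 _ Nn)).
- move=> n f Nn /asboolP fw; rewrite /B Nn.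
  exact: (cell_prob_ge D_open nu_density rho_continuous m_gt0 rho_bounds (s0 _ Nn) fw).
- move=> n Nn; have [n0 n1 n2 n3 n4] := NP _ Nn.
  have /andP[s0n s1n] := s01 _ n0.
  rewrite card_ffun !card_ord natrX.
  have sd1 : 1 <= n%:R * s n ^+ d.
    by apply: le_trans (HN4 _ n4); rewrite mul1r HN1.
  have WK : (W n).*2.+1%:R <= (2 * Kb + 5) / s n.
    have -> : (W n).*2.+1%:R = 2 * (Num.trunc (Kb / s n))%:R + 3 :> R.
      by rewrite -natr1 -muln2 natrM /W -natr1; ring.
    rewrite ler_pdivlMr//.
    have : (Num.trunc (Kb / s n))%:R <= Kb / s n.
      by have /truncn_itv/andP[] : 0 <= Kb / s n by rewrite divr_ge0// ltW.
    rewrite ler_pdivlMr// => tK; lra.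
  apply: (@le_trans _ _ (((2 * Kb + 5) / s n) ^+ d)).
    by rewrite lerXn2r// nnegrE// divr_ge0 ?addr_ge0 ?mulr_ge0// ltW.
  rewrite expr_div_n ler_wpM2l ?exprn_ge0 ?addr_ge0 ?mulr_ge0//.
  by rewrite -[leLHS]mul1r ler_pdivrMr ?exprn_gt0.
- move=> n Nn; have [_ _ n2 _ _] := NP _ Nn.
  by have := HN2 _ n2; rewrite mulrAC ler_pdivrMr// mulrC [X in _ <= X]mulrC.
- move=> n Nn; have [_ _ _ n3 _] := NP _ Nn.
  have m16 : 0 < m / 16 by rewrite divr_gt0.
  by have := HN3 _ n3; rewrite mulrAC ler_pdivrMr// mulrC [X in _ <= X]mulrC.
Qed.

End cell_concentration.

(** * Piecewise constant approximation *)

Section graph_compactness.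
Context (R : realType) (d : nat).

(** Continuity at 0 gives one positive radius where [eta] exceeds half of [eta 0]; monotonicity
    extends this to all smaller radii. *)
Lemma kernel_ge_near0 (eta : R -> R) :
  0 < eta 0 -> eta r @[r --> 0^'+] --> eta 0 ->
  (forall r s, 0 <= r -> r <= s -> eta s <= eta r) ->
  exists a b : R, [/\ 0 < a, 0 < b & forall r, 0 <= r -> r <= b -> a <= eta r].
Proof.
move=> e0 ce me; exists (eta 0 / 2).
have a0 : 0 < eta 0 / 2 by rewrite divr_gt0.
have /cvgrPdist_lt/(_ _ a0) := ce.
rewrite near_withinE => -[b /= b0 Hb].
exists (b / 2); split => //; first by rewrite divr_gt0.
move=> r r0 rb; have b20 : 0 < b / 2 by rewrite divr_gt0.
have : `|eta 0 - eta (b / 2)| < eta 0 / 2.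
  apply: Hb => //=; rewrite sub0r normrN gtr0_norm//.
  by rewrite ltr_pdivrMr// mulr_natr mulr2n ltrDl.
move=> /(le_lt_trans (ler_norm _)); have := me _ _ r0 rb; lra.
Qed.

Lemma cell_dist_lt (s : R) (x y : 'rV[R]_d) (t : nat) : 0 < s ->
  supn_le (cell s x - cell s y) t -> enorm (x - y) <= d%:R * (s * t.+1%:R).
Proof.
move=> s0 /supn_leP xy; apply: le_trans (enorm_le_norm _) _.
rewrite ler_wpM2l// ltW// rV_norm_lt// ?mulr_gt0// => j.
have := xy j; rewrite !mxE.
have /andP[x1 x2] := floor_itv (x 0 j / s).
have /andP[y1 y2] := floor_itv (y 0 j / s).
rewrite -(ler_int R) intr_norm intrB ler_norml -pmulrn => /andP[h1 h2].
rewrite intrD in x2; rewrite intrD in y2.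
have -> : x 0 j - y 0 j = s * (x 0 j / s - y 0 j / s) by field; rewrite lt0r_neq0.
rewrite normrM gtr0_norm// ltr_pM2l// -natr1 ltr_norml; apply/andP; split; lra.
Qed.

(** Points whose cells are at most [t] apart lie within b eps of each other, where the scaled kernel
    is at least a / eps^d; the other pairs are dropped. *)
Lemma near_variation_le_GTV (eta : R -> R) (a b eps s : R) (t n : nat)
    (x : nat -> 'rV[R]_d) (u : 'rV[R]_d -> R) :
  (forall r, 0 <= r -> 0 <= eta r) -> 0 < a ->
  (forall r, 0 <= r -> r <= b -> a <= eta r) -> (0 < n)%N ->
  0 < eps -> 0 < s -> d%:R * (s * t.+1%:R) <= b * eps ->
  near_variation (fun i : 'I_n => cell s (x i)) (fun i => u (x i)) t <=
  n%:R ^+ 2 * eps ^+ d.+1 / a * GTV eta n eps x u.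
Proof.
move=> eta0 a0 etaa n0 e0 s0 sb; rewrite /GTV.
have nR : 0 < n%:R :> R by rewrite ltr0n.
have -> : n%:R ^+ 2 * eps ^+ d.+1 / a * (eps^-1 * (n%:R ^+ 2)^-1 *
  \sum_(i < n) \sum_(j < n) scaled_kernel eta eps (x i - x j) * `|u (x i) - u (x j)|) =
  eps ^+ d / a * \sum_(i < n) \sum_(j < n) scaled_kernel eta eps (x i - x j) * `|u (x i) - u (x j)|.
  set S := \sum_(i < n) _; rewrite [eps ^+ d.+1]exprS.
  move: (eps ^+ d) => E; field; rewrite !lt0r_neq0//.
rewrite mulr_sumr; apply: ler_sum => i _; rewrite mulr_sumr.
apply: (@le_trans _ _ (\sum_(j < n | supn_le (cell s (x i) - cell s (x j)) t)
    (eps ^+ d / a * (scaled_kernel eta eps (x i - x j) * `|u (x i) - u (x j)|)))).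
  apply: ler_sum => j ij; rewrite mulrA ler_peMl// /scaled_kernel.
  have -> : eps ^+ d / a * (eps ^- d * eta (enorm (eps^-1 *: (x i - x j)))) =
    eta (enorm (eps^-1 *: (x i - x j))) / a.
    have := exprn_gt0 d e0; move: (eps ^+ d) => E E0; by field; rewrite !lt0r_neq0.
  rewrite ler_pdivlMr// mul1r; apply: etaa; first exact: enorm_ge0.
  have -> : enorm (eps^-1 *: (x i - x j)) = eps^-1 * enorm (x i - x j).
    rewrite /enorm -[X in X * Num.sqrt _]gtr0_norm ?invr_gt0// -sqrtr_sqr -sqrtrM ?sqr_ge0//.
    by rewrite mulr_sumr; congr Num.sqrt; apply: eq_bigr => k _; rewrite mxE exprMn.
  rewrite ler_pdivrMl// [leRHS]mulrC; apply: le_trans sb; exact: cell_dist_lt.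
apply: ler_sum_sub => // j _.
rewrite mulr_ge0 ?divr_ge0 ?exprn_ge0 ?(ltW a0) ?(ltW e0)// mulr_ge0// /scaled_kernel.
by rewrite mulr_ge0 ?invr_ge0 ?exprn_ge0 ?(ltW e0)// eta0// enorm_ge0.
Qed.

(** [c], [C0] and [delta0] precede the sample and the functions: the cell side c eps_n fixes the
    almost sure event on which the counts hold, and one event must serve all [u]. *)
Lemma piecewise_constant_approx (D : set 'rV[R]_d) (K : nat) (e : 'I_K -> 'rV[R]_d)
    (r kappa : R) (eta : R -> R) (eps : nat -> R) (a b m M : R) :
  (0 < d)%N -> 0 < r -> 0 < kappa -> (forall k j, `|e k 0 j| <= 1) ->
  (forall y, D y -> exists k, inward_cone D y (e k) r kappa) ->
  (forall r, 0 <= r -> 0 <= eta r) -> 0 < a -> 0 < b ->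
  (forall r, 0 <= r -> r <= b -> a <= eta r) ->
  (forall n, (0 < n)%N -> 0 < eps n) -> eps n @[n --> \oo] --> 0 ->
  0 < m -> m <= M ->
  exists c C0 delta0 : R, [/\ 0 < c, 0 <= C0, 0 < delta0 &
    forall (x : nat -> 'rV[R]_d) (u : nat -> 'rV[R]_d -> R) (N0 : nat) (B G : R),
    (forall i, D (x i)) ->
    (forall n, (N0 <= n)%N -> forall w,
      cell_count R (fun i : 'I_n => cell (c * eps n) (x i)) w <=
        4 * M * (n%:R * (c * eps n) ^+ d) /\
      (full_cell D (c * eps n) w -> m / 4 * (n%:R * (c * eps n) ^+ d) <=
        cell_count R (fun i : 'I_n => cell (c * eps n) (x i)) w)) ->
    (forall n, (0 < n)%N -> \sum_(i < n) `|u n (x i)| <= n%:R * B) ->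
    (forall n, (0 < n)%N -> GTV eta n (eps n) x (u n) <= G) ->
    forall delta, 0 < delta -> delta <= delta0 ->
    forall (J : finType) (lab : 'rV[R]_d -> J),
    (forall x y, D x -> D y -> lab x = lab y -> `|x - y| < delta) ->
    exists (Bd : R) (N : nat), forall n, (N <= n)%N -> exists c : J -> R,
      (forall j, `|c j| <= Bd) /\
      \sum_(i < n) `|u n (x i) - c (lab (x i))| <= n%:R * (C0 * G * delta)].
Proof.
move=> d0 r0 k0 e1 cone eta0 a0 b0 etaa eps0 eps_cvg m0 mM.
have dR : 0 < d%:R :> R by rewrite ltr0n.
(* Ensures kappa t >= 2: after [t] places along a cone the rounding errors fit into it. *)
pose t := (Num.trunc (2 / kappa)).+1.
have tk : 2 <= kappa * t%:R.
  by rewrite mulrC -ler_pdivrMr//; apply/ltW; exact: truncnS_gt.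
have tR : 0 < t%:R :> R by rewrite ltr0n.
have t1R : 0 < t.+1%:R :> R by rewrite ltr0n.
(* Makes d s (t + 1) = b eps for s = c eps, so the jump is seen by the kernel. *)
pose c := b / (d%:R * t.+1%:R).
have c0 : 0 < c by rewrite divr_gt0// mulr_gt0.
have M0 : 0 < M by exact: lt_le_trans mM.
pose C1 : R := K%:R * (1 + 3 * t%:R + 3 * 7 ^+ d).
have C10 : 0 <= C1.
  by rewrite /C1 mulr_ge0// !addr_ge0// mulr_ge0// exprn_ge0.
(* 64 M / m^2 is 4 M / (m / 4)^2, from hi / lo^2; the power of [c] comes from writing s = c eps in
   (delta / s) / s^d. *)
pose C0 := C1 * (64 * M / m ^+ 2) / a / c ^+ d.+1.
have C00 : 0 <= C0.
  rewrite /C0 !mulr_ge0// ?invr_ge0 ?exprn_ge0// ltW//.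
exists c, C0, (r / (4 * t%:R)); split => //; first by rewrite divr_gt0// mulr_gt0.
move=> x u N0 B G Dx counts uB uG delta de0 dele J lab labD.
(* The bound (2 s / delta)^d / lo times n B, in which n and s cancel. *)
exists ((2 / delta) ^+ d / (m / 4) * B).
have [N1 HN1] : exists N, forall n, (N <= n)%N -> c * eps n <= delta.
  have dc0 : 0 < delta / c by rewrite divr_gt0.
  have /cvgrPdist_lt/(_ _ dc0)[N _ HN] := eps_cvg.
  exists N => n Nn; have := HN n Nn; rewrite /= sub0r normrN => /(le_lt_trans (ler_norm _)).
  by move=> /ltW; rewrite ler_pdivlMr// mulrC.
exists (maxn N0 N1).+1 => n; rewrite gtn_max => /andP[N0n N1n].
have n0 : (0 < n)%N by exact: leq_ltn_trans N0n.
have nR : 0 < n%:R :> R by rewrite ltr0n.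
have e0 := eps0 _ n0.
pose s := c * eps n; have s0 : 0 < s by rewrite mulr_gt0.
have sde : s <= delta by apply: HN1; exact: ltnW.
have nsd : 0 < n%:R * s ^+ d by rewrite mulr_gt0// exprn_gt0.
have detr : 4 * delta * t%:R <= r.
  by move: dele; rewrite ler_pdivlMr ?mulr_gt0// => h; lra.
have lo0 : 0 < m / 4 * (n%:R * s ^+ d) by rewrite mulr_gt0// divr_gt0.
have lohi : m / 4 * (n%:R * s ^+ d) <= 4 * M * (n%:R * s ^+ d).
  by rewrite ler_wpM2r ?(ltW nsd)//; lra.
have [cc [ccB ccS]] := graph_poincare (x := fun i : 'I_n => x i) (fun i => u n (x i))
  r0 k0 e1 cone (ltn0Sn _) tk de0 detr labD s0 sde lo0 lohi (fun i => Dx i)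
  (fun w => (counts n (ltnW N0n) w).1) (fun w => (counts n (ltnW N0n) w).2).
exists cc; split.
  move=> j; apply: (le_trans (ccB j)).
  apply: (@le_trans _ _ ((2 * s / delta) ^+ d / (m / 4 * (n%:R * s ^+ d)) * (n%:R * B))).
    apply: ler_wpM2l; last exact: uB.
    rewrite divr_ge0 ?(ltW lo0)// exprn_ge0// divr_ge0 ?(ltW de0)//.
    by rewrite mulr_ge0// ltW.
  rewrite le_eqVlt; apply/orP; left; apply/eqP.
  have -> : 2 * s / delta = 2 / delta * s by ring.
  rewrite exprMn; move: ((2 / delta) ^+ d) (s ^+ d) (exprn_gt0 d s0) => E1 E2 E20.
  by field; rewrite !lt0r_neq0.
apply: (le_trans ccS); rewrite -/C1.
apply: (@le_trans _ _ (C1 * (delta / s) * (4 * M * (n%:R * s ^+ d) / (m / 4 * (n%:R * s ^+ d)) ^+ 2) *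
    (n%:R ^+ 2 * eps n ^+ d.+1 / a * G))).
  apply: ler_wpM2l.
    apply: mulr_ge0; first by rewrite mulr_ge0// divr_ge0// ltW.
    by rewrite divr_ge0 ?exprn_ge0 ?(ltW lo0)// mulr_ge0 ?(ltW nsd)// mulr_ge0// ltW.
  apply: (@le_trans _ _ (n%:R ^+ 2 * eps n ^+ d.+1 / a * GTV eta n (eps n) x (u n))).
    apply: (near_variation_le_GTV (b := b)) => //.
    have -> : d%:R * (s * t.+1%:R) = b * eps n by rewrite /s /c; field; rewrite !lt0r_neq0.
    by [].
  apply: ler_wpM2l; last exact: uG.
  by rewrite divr_ge0 ?(ltW a0)// mulr_ge0 ?exprn_ge0// ltW.
rewrite le_eqVlt; apply/orP; left; apply/eqP.
have -> : C0 = C1 * (64 * M / m ^+ 2) / a / (c * c ^+ d) by rewrite /C0 [c ^+ d.+1]exprS.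
have -> : eps n ^+ d.+1 = eps n * eps n ^+ d by rewrite exprS.
rewrite /s exprMn; move: (c ^+ d) (exprn_gt0 d c0) (eps n ^+ d) (exprn_gt0 d e0) => E1 E10 E2 E20.
by field; rewrite !lt0r_neq0.
Qed.

End graph_compactness.

(** * Couplings with the empirical measure *)

Section coupling_weights.
Context (R : realFieldType) (n : nat) (J : finType) (l : 'I_n -> J) (b : J -> R).
Hypotheses (n_gt0 : (0 < n)%N) (b_ge0 : forall j, 0 <= b j) (b_sum : \sum_j b j = 1).

Definition label_freq (j : J) : R := (\sum_(i | l i == j) 1) / n%:R.

Let a := label_freq.
Let nR : 0 < n%:R :> R. Proof. by rewrite ltr0n. Qed.

Lemma label_freq_ge0 j : 0 <= a j.
Proof. by rewrite divr_ge0 ?sumr_ge0 ?(ltW nR). Qed.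

Lemma label_freq_gt0 i : 0 < a (l i).
Proof.
rewrite divr_gt0// (bigD1 i)//= ltr_pwDl// sumr_ge0//.
Qed.

Lemma label_freq_sum : \sum_j a j = 1.
Proof.
rewrite -mulr_suml; have -> : \sum_j \sum_(i | l i == j) 1 = n%:R :> R.
  rewrite (exchange_big_dep xpredT)//=.
  rewrite (eq_bigr (fun=> 1)) ?sumr_const ?card_ord// => i _.
  by rewrite (eq_bigl (pred1 (l i))) ?big_pred1_eq// => j; rewrite /= eq_sym.
by rewrite divff// lt0r_neq0.
Qed.

Let mn j := Num.min (a j) (b j).
Let tau := \sum_j (a j - mn j).

Let mn_ge0 j : 0 <= mn j. Proof. by rewrite le_min label_freq_ge0 b_ge0. Qed.
Let amn j : 0 <= a j - mn j. Proof. by rewrite subr_ge0 ge_min lexx. Qed.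
Let bmn j : 0 <= b j - mn j. Proof. by rewrite subr_ge0 ge_min lexx orbT. Qed.
Let tauE : tau = \sum_j (b j - mn j).
Proof. by rewrite /tau !sumrB label_freq_sum b_sum. Qed.
Let tau_ge0 : 0 <= tau. Proof. exact: sumr_ge0. Qed.

(** The maximal coupling of the probability vectors [a] and [b]: the common mass [mn] stays on the
    diagonal and the excesses, of total mass [tau], are matched by a product. If [tau = 0] the
    quotient is 0 and so are the excesses. *)
Let transfer j k := (if j == k then mn j else 0) + (a j - mn j) * (b k - mn k) / tau.

Let transfer_ge0 j k : 0 <= transfer j k.
Proof.
by rewrite addr_ge0 ?divr_ge0 ?mulr_ge0//; case: ifP.
Qed.

Let tau0a j : tau = 0 -> a j - mn j = 0.
Proof.
move=> /eqP; rewrite psumr_eq0// => /allP/(_ j); rewrite mem_index_enum.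
by move=> /(_ isT)/eqP.
Qed.

Let tau0b j : tau = 0 -> b j - mn j = 0.
Proof.
rewrite tauE => /eqP; rewrite psumr_eq0// => /allP/(_ j); rewrite mem_index_enum.
by move=> /(_ isT)/eqP.
Qed.

Let transfer_row j : \sum_k transfer j k = a j.
Proof.
rewrite big_split/= -big_mkcond/=.
rewrite (eq_bigl (pred1 j)) => [|k]; last by rewrite /= eq_sym.
rewrite big_pred1_eq -mulr_suml -mulr_sumr -tauE.
have [t0|t0] := eqVneq tau 0.
  by rewrite t0 mulr0 mul0r addr0; apply/esym/eqP; rewrite -subr_eq0 tau0a.
by rewrite mulfK// addrC subrK.
Qed.

Let transfer_col k : \sum_j transfer j k = b k.
Proof.
rewrite big_split/= -big_mkcond/=.
rewrite big_pred1_eq -mulr_suml -mulr_suml -/tau.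
have [t0|t0] := eqVneq tau 0.
  by rewrite t0 mul0r mul0r addr0; apply/esym/eqP; rewrite -subr_eq0 tau0b.
by rewrite [tau * _]mulrC mulfK// addrC subrK.
Qed.

(* [w i k] is the density of the coupling on the slice [{x i} * lab^-1 k]. *)
Lemma coupling_weights : exists w : 'I_n -> J -> R,
  [/\ forall i k, 0 <= w i k,
      forall i, \sum_k w i k * b k = n%:R^-1,
      forall k, b k != 0 -> \sum_i w i k = 1
    & \sum_i \sum_(k | k != l i) w i k * b k <= \sum_j `|a j - b j|].
Proof.
(* The mass from class [l i] to class [k] is shared equally by the n a (l i) points of the class;
   dividing by [b k] makes it a density. If [b k = 0] the quotient is 0, and [transfer] vanishes
   there too. *)
pose w i k := transfer (l i) k / (n%:R * a (l i) * b k).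
have b0 j k : b k = 0 -> transfer j k = 0.
  move=> bk; have mk : mn k = 0 by apply/eqP; rewrite eq_le mn_ge0 andbT -bk ge_min lexx orbT.
  by rewrite /transfer bk mk subrr mulr0 mul0r addr0; case: eqP => // ->.
have a0 j k : a j = 0 -> transfer j k = 0.
  move=> aj; have mj : mn j = 0 by apply/eqP; rewrite eq_le mn_ge0 andbT -aj ge_min lexx.
  by rewrite /transfer aj mj subrr !mul0r addr0; case: eqP.
have wb i k : w i k * b k = transfer (l i) k / (n%:R * a (l i)).
  have ai := lt0r_neq0 (label_freq_gt0 i).
  have [bk|bk] := eqVneq (b k) 0; first by rewrite bk mulr0 b0// mul0r.
  rewrite /w; move: (transfer _ _) (a _) ai (b k) bk => tr a' a'0 b' b'0.
  by field; rewrite b'0 a'0 lt0r_neq0.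
exists w; split => [i k|i|k bk|].
- by rewrite divr_ge0// mulr_ge0// mulr_ge0 ?label_freq_ge0// ltW.
- under eq_bigr do rewrite wb.
  rewrite -mulr_suml transfer_row; have ai := lt0r_neq0 (label_freq_gt0 i).
  by rewrite invfM mulrCA divff// mulr1.
- rewrite -[RHS](divff bk) -[X in _ = X / _](transfer_col k) mulr_suml.
  rewrite (partition_big l xpredT)//=; apply: eq_bigr => j _.
  under eq_bigr => i /eqP li do rewrite /w li -[_ / _]mul1r.
  rewrite -mulr_suml.
  have [aj|aj] := eqVneq (a j) 0; first by rewrite a0// !mul0r mulr0.
  have -> : \sum_(i | l i == j) 1 = n%:R * a j :> R.
    by rewrite /a /label_freq mulrC divfK// lt0r_neq0.
  have E (tr a' b' N : R) : a' != 0 -> b' != 0 -> N != 0 ->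
    N * a' * (tr / (N * a' * b')) = tr / b'.
    by move=> *; field; apply/and3P; split.
  by rewrite E// lt0r_neq0.
apply: (@le_trans _ _ tau); last first.
  rewrite /tau; apply: ler_sum => j _; rewrite /mn.
  rewrite lerBlDr -lerBlDl le_min gerBl normr_ge0/= lerBlDr -lerBlDl.
  exact: ler_norm.
apply: (@le_trans _ _ (\sum_i (a (l i) - mn (l i)) / (n%:R * a (l i)))).
  apply: ler_sum => i _; under eq_bigr do rewrite wb.
  have na : 0 <= (n%:R * a (l i))^-1.
    by rewrite invr_ge0; apply: mulr_ge0; [exact: ltW|exact: label_freq_ge0].
  rewrite -mulr_suml ler_wpM2r//.
  rewrite -(transfer_row (l i)) [X in _ <= X - _](bigD1 (l i))//=.
  have -> : transfer (l i) (l i) =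
      mn (l i) + (a (l i) - mn (l i)) * (b (l i) - mn (l i)) / tau.
    by rewrite /transfer eqxx.
  have : 0 <= (a (l i) - mn (l i)) * (b (l i) - mn (l i)) / tau by rewrite divr_ge0// mulr_ge0.
  lra.
rewrite (partition_big l xpredT)//= /tau; apply: ler_sum => j _.
under eq_bigr => i /eqP li do rewrite li -[_ / _]mul1r.
rewrite -mulr_suml.
have [aj|aj] := eqVneq (a j) 0.
  have -> : n%:R * a j = 0 by rewrite aj mulr0.
  by rewrite invr0 !mulr0; exact: amn.
have -> : \sum_(i | l i == j) 1 = n%:R * a j :> R.
  by rewrite /a /label_freq mulrC divfK// lt0r_neq0.
by rewrite mulrC divfK// mulf_neq0// lt0r_neq0.
Qed.

End coupling_weights.

Section slice_measure.
Local Open Scope ereal_scope.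
Context d1 d2 (T1 : measurableType d1) (T2 : measurableType d2) (R : realType).
Variables (p : T1) (mu : {measure set T2 -> \bar R}).

(** The product of the Dirac mass at [p] with [mu]; weighted sums of such measures make up the
    coupling. *)
Definition slice : set (T1 * T2) -> \bar R := pushforward mu (pair p).

Let slice0 : slice set0 = 0.
Proof. by rewrite /slice /pushforward preimage_set0 measure0. Qed.

Let slice_ge0 A : 0 <= slice A.
Proof. exact: (measure_ge0 mu). Qed.

Let slice_sigma_additive : semi_sigma_additive slice.
Proof. by apply: measure_semi_sigma_additive; exact: pair1_measurable. Qed.

HB.instance Definition _ := isMeasure.Build _ _ _ slice
  slice0 slice_ge0 slice_sigma_additive.

End slice_measure.

Section empirical_coupling.
Context (R : realType) (d : nat).

Lemma empirical_measureE n (x : nat -> 'rV[R]_d) A :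
  empirical_measure n x A = (n%:R^-1 * \sum_(i < n) (x i \in A)%:R)%:E.
Proof.
rewrite /empirical_measure /= /mscale /msum /= EFinM; congr (_ * _)%E.
by rewrite -sumEFin; apply: eq_bigr => i _; rewrite -diracE.
Qed.

(** Take the sum over [i] and [k] of the Dirac mass at [x i] times [nu] restricted to class [k],
    with density [w i k]. How mass moves inside a class does not matter; only mass that changes
    class is estimated. *)
Lemma exists_coupling (nu : probability 'rV[R]_d R) n (x : nat -> 'rV[R]_d) q
    (lab : 'rV[R]_d -> 'I_q) : (0 < n)%N ->
  (forall j, measurable [set y | lab y = j]) ->
  exists2 pi : probability ('rV[R]_d * 'rV[R]_d)%type R,
    couplings (empirical_measure n x) nu pi &
    (pi [set z | lab z.1 != lab z.2] <=
      (\sum_j `|label_freq R (fun i : 'I_n => lab (x i)) j - fine (nu [set y | lab y = j])|)%:E)%E.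
Proof.
move=> n0 mlab; pose b j := fine (nu [set y | lab y = j]).
pose l (i : 'I_n) := lab (x i).
have bE j : nu [set y | lab y = j] = (b j)%:E by rewrite fineK// fin_num_measure.
have b0 j : 0 <= b j by rewrite fine_ge0.
(* [msum] is indexed by [nat], so classes and weights are extended to natural numbers, by the empty
   set and by 0. *)
have mlabn (k : nat) : measurable [set y | lab y = k :> nat].
  have [kq|qk] := ltnP k q.
    rewrite (_ : [set y | _] = [set y | lab y = Ordinal kq])//.
    by apply/seteqP; split => y /= H; [exact: val_inj|rewrite H].
  rewrite (_ : [set y | _] = set0)//; apply/seteqP; split => // y /= yk.
  by move: (ltn_ord (lab y)); rewrite yk ltnNge qk.
have labE (k : 'I_q) : [set y | lab y = k :> nat] = [set y | lab y = k].
  by apply/seteqP; split => y /= H; [exact: val_inj|rewrite H].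
have part A : measurable A -> (nu A = \sum_(j < q) nu (A `&` [set y | lab y = j]))%E.
  move=> mA; pose F (k : nat) := A `&` [set y | lab y = k :> nat].
  transitivity (\sum_(j < q) nu (F j))%E; last first.
    by apply: eq_bigr => j _; rewrite /F labE.
  rewrite -measure_bigsetU//; last 2 first.
  - by move=> j; exact: measurableI.
  - by apply/trivIsetP => j k _ _ jk; apply/seteqP; split => // y [[_ /= yj] [_ /= yk]]; move: jk; rewrite -yj yk eqxx.
  congr (nu _); apply/seteqP; split => y; rewrite -bigcup_mkord.
    by move=> Ay; exists (lab y) => //=.
  by case=> j _ [].
have b1 : \sum_j b j = 1.
  apply: EFin_inj; rewrite -sumEFin -(probability_setT nu) part//.
  by apply: eq_bigr => j _; rewrite setTI bE.
have [w [w0 wrow wcol woff]] := coupling_weights l n0 b0 b1.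
pose wn (i k : nat) : R := if insub i is Some i' then
  if insub k is Some k' then w i' k' else 0 else 0.
have wn0 i k : 0 <= wn i k by rewrite /wn; case: insubP => // i' _ _; case: insubP.
have wnE (i : 'I_n) (k : 'I_q) : wn i k = w i k.
  by rewrite /wn !insubT// => ? ?; congr w; exact: val_inj.
pose mu : {measure set ('rV[R]_d * 'rV[R]_d)%type -> \bar R} :=
  msum (fun i => msum (fun k =>
    mscale (NngNum (wn0 i k)) (slice (x i) (mrestr nu (mlabn k)))) q) n.
have muE A : mu A = (\sum_(i < n) \sum_(k < q)
    (w i k)%:E * nu ([set y | A (x i, y)] `&` [set y | lab y = k]))%E.
  apply: eq_bigr => i _; apply: eq_bigr => k _.
  rewrite /= /mscale /= wnE; congr (_ * _)%E.
  rewrite /slice /pushforward /mrestr; by rewrite labE.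
have mu_fst A : measurable A -> mu (A `*` setT) = empirical_measure n x A.
  move=> mA; rewrite muE empirical_measureE mulr_sumr -sumEFin.
  apply: eq_bigr => i _; case: (boolP (x i \in A)) => [/set_mem xA|nxA].
    rewrite mulr1 -(wrow i) -sumEFin; apply: eq_bigr => k _; rewrite EFinM -bE.
    by congr (_ * nu _)%E; apply/seteqP; split => y //= [].
  rewrite mulr0 big1// => k _.
  rewrite (_ : _ `&` _ = set0) ?measure0 ?mule0//.
  by apply/seteqP; split => // y [[/= xA _] _]; move: nxA; rewrite mem_set.
have mu_snd A : measurable A -> mu (setT `*` A) = nu A.
  move=> mA; rewrite muE exchange_big/= part//; apply: eq_bigr => k _.
  have -> : (\sum_(i < n) (w i k)%:E * nu ([set y | (setT `*` A) (x i, y)] `&` [set y | lab y = k]) =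
    \sum_(i < n) (w i k)%:E * nu (A `&` [set y | lab y = k]))%E.
    apply: eq_bigr => i _; congr (_ * nu _)%E.
    by apply/seteqP; split => y [Ay ky]; split => //; case: Ay.
  rewrite -ge0_sume_distrl ?sumEFin; last by move=> i _; rewrite lee_fin.
  have [bk|bk] := eqVneq (b k) 0; last by rewrite wcol// mul1e.
  suff -> : nu (A `&` [set y | lab y = k]) = 0%E by rewrite mule0.
  apply/eqP; rewrite eq_le measure_ge0 andbT -[leRHS]/(0%:E) -bk -bE.
  by apply: le_measure; rewrite ?inE//; [exact/mem_set/measurableI|exact/mem_set].
have mu1 : mu setT = 1%E.
  by rewrite -(setXTT) mu_snd ?probability_setT.
(* As [mu] has mass 1, normalizing only packages it as a probability; the Dirac mass is a default
   value. *)
pose pi : probability ('rV[R]_d * 'rV[R]_d)%type R := mnormalize mu (dirac ((0, 0) : 'rV[R]_d * 'rV[R]_d)).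
have piE A : pi A = mu A.
  rewrite /pi /=; rewrite /mnormalize mu1.
  by rewrite onee_eq0 /= invr1 mule1.
exists pi.
  by move=> A mA; split; rewrite [LHS]piE; [exact: mu_fst|exact: mu_snd].
rewrite [leLHS]piE muE; apply: le_trans (_ : (_%:E <= _)%E); last by rewrite lee_fin; exact: woff.
rewrite -sumEFin; apply: lee_sum => i _; rewrite -sumEFin [leRHS]big_mkcond/=.
apply: lee_sum => k _; case: (eqVneq k (l i)) => [ki|nki].
  rewrite (_ : _ `&` _ = set0) ?measure0 ?mule0//=.
  by apply/seteqP; split => // y [/= + yk]; rewrite yk ki eqxx.
rewrite /= EFinM lee_wpmul2l ?lee_fin// -bE.
apply: le_measure; rewrite ?inE//; last by exact/mem_set.
rewrite (_ : _ `&` _ = [set y | lab y = k]); first exact/mem_set.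
by apply/seteqP; split => [y []//|y /= yk]; split => //=; rewrite yk eq_sym.
Qed.

End empirical_coupling.

(** * Limits in L^1 and TL^1 *)

Section L1_limit.
Context (R : realType) (d : measure_display) (T : measurableType d).
Variable mu : {measure set T -> \bar R}.

Lemma geometric_half_sum (N : nat) :
  \sum_(0 <= l < N) (1 / 2) ^+ l = 2 - 2 * (1 / 2) ^+ N :> R.
Proof.
elim: N => [|N IH]; first by rewrite big_nil expr0 mulr1 subrr.
by rewrite big_nat_recr//= IH exprS; field.
Qed.

(** The tail [S k] of the series of increments dominates |f k - g| at every point: where it is
    finite [f] converges to [g], and where it is infinite nothing is to be shown. Its integral is a
    geometric sum. *)
Lemma L1_geometric_limit (f : nat -> T -> R) (C : R) :
  (forall k, measurable_fun setT (f k)) ->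
  (forall k, \int[mu]_y (`|f k y - f k.+1 y|)%:E <= (C * (1 / 2) ^+ k)%:E)%E ->
  exists2 g : T -> R, measurable_fun setT g &
    forall k, (\int[mu]_y (`|f k y - g y|)%:E <= (2 * C * (1 / 2) ^+ k)%:E)%E.
Proof.
move=> mf fC.
have C0 : 0 <= C.
  have : (0 <= (C * (1 / 2) ^+ 0)%:E)%E by apply: le_trans (fC 0%N); apply: integral_ge0 => y _; rewrite lee_fin.
  by rewrite expr0 mulr1 lee_fin.
pose h l y : R := `|f l y - f l.+1 y|.
have mh l : measurable_fun setT (fun y => (h l y)%:E).
  by apply/measurable_EFinP; apply: measurableT_comp => //; exact: measurable_funB.
pose S k y : \bar R := (\sum_(0 <= l <oo) (h (l + k)%N y)%:E)%E.
have mS k : measurable_fun setT (S k).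
  rewrite (_ : S k = fun y => (\sum_(0 <= l <oo | l \in xpredT) (h (l + k)%N y)%:E)%E); last first.
    by apply/funext => y; apply: eq_eseriesl => l; rewrite unfold_in.
  by apply: ge0_emeasurable_sum => // l y _ _; rewrite lee_fin normr_ge0.
have intS k : (\int[mu]_y S k y <= (2 * C * (1 / 2) ^+ k)%:E)%E.
  rewrite integral_nneseries//; last by move=> n y _; rewrite lee_fin normr_ge0.
  apply: lime_le; first by apply: is_cvg_nneseries => n _ _; apply: integral_ge0 => y _; rewrite lee_fin normr_ge0.
  apply: nearW => N.
  apply: (@le_trans _ _ (\sum_(0 <= l < N) (C * (1 / 2) ^+ (l + k))%:E)%E).
    by apply: lee_sum => l _; exact: fC.
  rewrite sumEFin lee_fin.
  under eq_bigr do rewrite exprD mulrA mulrAC.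
  rewrite -mulr_sumr geometric_half_sum.
  have : 0 <= C * (1 / 2) ^+ k * (1 / 2) ^+ N by rewrite !mulr_ge0// exprn_ge0//; lra.
  lra.
have SE k y : S 0%N y = (\sum_(0 <= l < k) (h l y)%:E + S k y)%E.
  rewrite /S; under eq_eseriesr do rewrite addn0.
  rewrite [LHS](nneseries_split 0 k)//; last by move=> l _; rewrite lee_fin normr_ge0.
  by rewrite add0n -(nneseries_addn (f := fun l => (h l y)%:E))// => l; rewrite lee_fin normr_ge0.
have S0_fin k y : (S k y < +oo)%E -> (S 0%N y < +oo)%E.
  by move=> Sk; rewrite (SE k) sumEFin; apply: lte_add_pinfty => //; exact: ltry.
have dist_le k N y : (`|f k y - f (N + k)%N y|%:E <= S k y)%E.
  apply: (@le_trans _ _ (\sum_(0 <= l < N) (h (l + k)%N y)%:E)%E); last first.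
    by apply: nneseries_lim_ge => l _ _; rewrite lee_fin normr_ge0.
  rewrite sumEFin lee_fin; elim: N => [|N IH]; first by rewrite big_nil add0n subrr normr0.
  rewrite big_nat_recr//=; apply: le_trans (ler_distD (f (N + k)%N y) _ _) _.
  by rewrite lerD2r.
have f_cvg y : (S 0%N y < +oo)%E -> cvgn (fun k => f k y).
  move=> Sy; have c1 : cvgn (series (fun l => f l.+1 y - f l y)).
    apply: normed_cvg; apply: nnseries_is_cvg => //=.
    apply: le_lt_trans Sy; rewrite le_eqVlt; apply/orP; left; apply/eqP.
    by apply: eq_eseriesr => l _; rewrite /h addn0 distrC.
  have -> : (fun k => f k y) = (fun k => f 0%N y + series (fun l => f l.+1 y - f l y) k).
    by apply/funext => k; rewrite /series/= telescope_sumr// addrC subrK.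
  apply: is_cvgD => //; exact: is_cvg_cst.
(* Cutting off outside [G] makes the limit exist at every point, so that [g] is measurable. *)
pose G := [set y | (S 0%N y < +oo)%E].
have mG : measurable G.
  rewrite -[X in measurable X]setTI.
  exact: (emeasurable_fun_infty_o measurableT (mS 0%N) +oo%E).
pose g y := limn (fun k => f k y * \1_G y).
have fG_cvg y : (fun k => f k y * \1_G y) @ \oo --> g y.
  have [Sy|nSy] := pselect (G y).
    rewrite /g (_ : (fun k => _) = (fun k => f k y)); first exact: f_cvg.
    by apply/funext => k; rewrite indicE mem_set// mulr1.
  rewrite /g (_ : (fun k => _) = (fun=> 0)); first exact: is_cvg_cst.
  by apply/funext => k; rewrite indicE memNset// mulr0.
have mg : measurable_fun setT g.
  apply: (@measurable_fun_cvg _ _ _ setT (fun k y => f k y * \1_G y)) => //.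
  by move=> k; apply: measurable_funM => //; exact: measurable_indic.
exists g => // k; apply: le_trans (intS k); apply: ge0_le_integral => //.
  by apply/measurable_EFinP; apply: measurableT_comp => //; exact: measurable_funB.
move=> y _; have [Sk|nSk] := pselect ((S k y < +oo)%E); last first.
  by move/negP: nSk; rewrite -leNgt leye_eq => /eqP ->; rewrite leey.
have Gy : G y by exact: S0_fin Sk.
have Skf : S k y \is a fin_num.
  by rewrite ge0_fin_numE// nneseries_ge0// => l _ _; rewrite lee_fin normr_ge0.
rewrite -(fineK Skf) lee_fin.
have gE : (fun N => `|f k y - f (N + k)%N y|) @ \oo --> `|f k y - g y|.
  apply: cvg_norm; apply: cvgB; first exact: cvg_cst.
  rewrite (cvg_shiftn k (fun N => f N y)).
  rewrite (_ : (fun N => f N y) = (fun N => f N y * \1_G y)); first exact: fG_cvg.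
  by apply/funext => N; rewrite indicE mem_set// mulr1.
rewrite -(cvg_lim _ gE)//; apply: limr_le; first by apply/cvg_ex; eexists; exact: gE.
by apply: nearW => N; rewrite -lee_fin (fineK Skf).
Qed.

End L1_limit.

Section label_functions.
Context (R : realType) (d : measure_display) (T : measurableType d).
Context (J : finType) (lab : T -> J).
Hypothesis mlab : forall j, measurable [set y | lab y = j].

Lemma measurable_label (A : set J) : measurable [set y | A (lab y)].
Proof.
rewrite (_ : [set y | _] = \bigcup_(j in A) [set y | lab y = j]).
  by apply: fin_bigcup_measurable => //; exact: finite_finset.
by apply/seteqP; split => [y Ay|y [j Aj /= ->]]//; exists (lab y).
Qed.

Lemma measurable_label_fun (g : J -> R) : measurable_fun setT (fun y => g (lab y)).
Proof.
move=> _ B mB; rewrite setTI; exact: (measurable_label [set j | B (g j)]).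
Qed.

Lemma integral_label_fun (mu : {measure set T -> \bar R}) (g : J -> R) :
  (forall j, 0 <= g j) ->
  (\int[mu]_y (g (lab y))%:E = \sum_j (g j)%:E * mu [set y | lab y = j])%E.
Proof.
move=> g0.
have -> : (\int[mu]_y (g (lab y))%:E =
    \int[mu]_y \sum_j ((g j)%:E * (\1_[set y | lab y = j] y)%:E))%E.
  apply: eq_integral => y _; rewrite (bigD1 (lab y))//= big1 ?adde0.
    by rewrite indicE mem_set// mule1.
  by move=> j jy; rewrite indicE memNset ?mule0//= => yj; move: jy; rewrite yj eqxx.
have m1 j : measurable_fun setT (fun y => (\1_[set y | lab y = j] y)%:E : \bar R).
  by apply/measurable_EFinP; exact: measurable_indic.
rewrite ge0_integral_sum//.
- apply: eq_bigr => j _; rewrite ge0_integralZl//.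
  + by rewrite integral_indic// setIT.
  + by rewrite lee_fin.
- by move=> j; apply: measurable_funeM; exact: m1.
- by move=> j y _; rewrite mule_ge0// lee_fin.
Qed.

End label_functions.

Section empirical_integrals.
Context (R : realType) (d : nat) (D : set 'rV[R]_d).
Hypothesis mD : measurable D.

Lemma integral_empirical n (x : nat -> 'rV[R]_d) (g : 'rV[R]_d -> R) :
  (forall i, D (x i)) -> measurable_fun D g -> (forall y, D y -> 0 <= g y) ->
  (\int[empirical_measure n x]_(y in D) (g y)%:E = (n%:R^-1 * \sum_(i < n) g (x i))%:E)%E.
Proof.
move=> xD mg g0; have mg' : measurable_fun D (EFin \o g) by exact/measurable_EFinP.
rewrite /empirical_measure ge0_integral_mscale//=.
rewrite ge0_integral_measure_sum//.
rewrite EFinM -sumEFin; congr (_ * _)%E; apply: eq_bigr => i _.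
by rewrite integral_dirac//= diracE mem_set// mul1e.
Qed.

Lemma label_freqE n (x : nat -> 'rV[R]_d) (J : finType) (lab : 'rV[R]_d -> J) (g : J -> R) :
  n%:R^-1 * \sum_(i < n) g (lab (x i)) =
  \sum_j g j * label_freq R (fun i : 'I_n => lab (x i)) j.
Proof.
rewrite (partition_big (fun i : 'I_n => lab (x i)) xpredT)//= mulr_sumr.
apply: eq_bigr => j _; rewrite /label_freq.
rewrite (_ : \sum_(i < n | _) _ = g j * \sum_(i < n | lab (x i) == j) 1).
  by rewrite mulrCA [n%:R^-1 * _]mulrC.
by rewrite mulr_sumr; apply: eq_bigr => i /eqP ->; rewrite mulr1.
Qed.

Variables (mu theta : {measure set 'rV[R]_d -> \bar R}).
Variable pi : probability ('rV[R]_d * 'rV[R]_d)%type R.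
Hypothesis cpl : couplings mu theta pi.

(** The product of [D] with itself is only part of the preimage of [D] under the projection, hence
    an inequality. *)
Lemma coupling_integral_fst (g : 'rV[R]_d -> R) :
  measurable_fun D g -> (forall y, D y -> 0 <= g y) ->
  (\int[pi]_(z in D `*` D) (g z.1)%:E <= \int[mu]_(y in D) (g y)%:E)%E.
Proof.
move=> mg g0; have mg' : measurable_fun D (EFin \o g) by exact/measurable_EFinP.
apply: (@le_trans _ _ (\int[pi]_(z in fst @^-1` D) ((EFin \o g) \o fst) z)%E).
  apply: ge0_subset_integral => //.
  - exact: measurableX.
  - by rewrite -[X in measurable X]setTI; exact: measurable_fst.
  - apply: (measurable_comp mD _ mg'); first by move=> _ [z Dz <-].
    by apply: measurable_funTS; exact: measurable_fst.
  - by move=> z Dz; rewrite lee_fin g0.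
  - by move=> z [].
rewrite -(ge0_integral_pushforward (@measurable_fst _ _ _ _) pi mD mg'); last first.
  by move=> y /set_mem/g0; rewrite /= lee_fin.
rewrite (eq_measure_integral mu)// => A mA _; have [<- _] := cpl mA.
by congr (pi _); apply/seteqP; split => [z //|z []].
Qed.

Lemma coupling_integral_snd (g : 'rV[R]_d -> R) :
  measurable_fun D g -> (forall y, D y -> 0 <= g y) ->
  (\int[pi]_(z in D `*` D) (g z.2)%:E <= \int[theta]_(y in D) (g y)%:E)%E.
Proof.
move=> mg g0; have mg' : measurable_fun D (EFin \o g) by exact/measurable_EFinP.
apply: (@le_trans _ _ (\int[pi]_(z in snd @^-1` D) ((EFin \o g) \o snd) z)%E).
  apply: ge0_subset_integral => //.
  - exact: measurableX.
  - by rewrite -[X in measurable X]setTI; exact: measurable_snd.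
  - apply: (measurable_comp mD _ mg'); first by move=> _ [z Dz <-].
    by apply: measurable_funTS; exact: measurable_snd.
  - by move=> z Dz; rewrite lee_fin g0.
  - by move=> z [].
rewrite -(ge0_integral_pushforward (@measurable_snd _ _ _ _) pi mD mg'); last first.
  by move=> y /set_mem/g0; rewrite /= lee_fin.
rewrite (eq_measure_integral theta)// => A mA _; have [_ <-] := cpl mA.
by congr (pi _); apply/seteqP; split => [z //|z []].
Qed.

End empirical_integrals.

(** * Measurable partitions into classes of small diameter *)

Section sup_partition.
Context (R : realType) (d : nat).

Lemma measurable_find (I : Type) (s : seq I) (B : I -> set 'rV[R]_d) (k : nat) :
  (forall i, measurable (B i)) ->
  measurable [set x | find (fun i => `[< B i x >]) s = k].
Proof.
move=> mB.
have mcst (Q : Prop) : measurable [set _ : 'rV[R]_d | Q].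
  have [q|nq] := pselect Q.
    by rewrite (_ : [set _ | Q] = setT)//; apply/seteqP; split.
  by rewrite (_ : [set _ | Q] = set0)//; apply/seteqP; split.
elim: s k => [|i s IH] k /=; first exact: mcst.
rewrite (_ : [set x | _] = (B i `&` [set x | 0%N = k]) `|`
    (~` B i `&` [set x | (find (fun i => `[< B i x >]) s).+1 = k])).
  apply: measurableU; apply: measurableI => //; first exact: measurableC.
  case: k => [|k]; first by rewrite (_ : [set x | _] = set0)//; apply/seteqP; split.
  rewrite (_ : [set x | _] = [set x | find (fun i => `[< B i x >]) s = k])//.
  by apply/seteqP; split => x /= => [[]|->].
apply/seteqP; split => x /=.
  by case: asboolP => H fk; [left|right].
by case: asboolP => H [[]|[]].
Qed.

(** The label of a point is the position of the first ball containing it in a finite cover by balls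
    of radius delta / 2, which makes the classes disjoint and measurable. The extra label [size s]
    collects the uncovered points. *)
Lemma fine_partition (D : set 'rV[R]_d) (delta : R) : bounded_set D -> 0 < delta ->
  exists (q : nat) (lab : 'rV[R]_d -> 'I_q),
    (forall j, measurable [set x | lab x = j]) /\
    forall x y, D x -> D y -> lab x = lab y -> `|x - y| < delta.
Proof.
move=> bD d0; have d20 : 0 < delta / 2 by rewrite divr_gt0.
have := bounded_closure_compact bD.
rewrite compact_cover => /(_ _ (closure D) (fun y => ball y (delta / 2))).
case=> [y _|y cDy|F FD Fcov]; first exact: ball_open.
  by exists y => //; exact: ballxx.
pose s := enum_fset F; pose B (y : 'rV[R]_d) := ball y (delta / 2) : set 'rV[R]_d.
pose fd x := find (fun i => `[< B i x >]) s.
exists (size s).+1, (fun x => inord (fd x)).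
have fdle x : (fd x < (size s).+1)%N by rewrite ltnS find_size.
split=> [j|x y Dx Dy].
  rewrite (_ : [set x | _] = [set x | fd x = j]).
    by apply: measurable_find => i; apply: open_measurable_rV; exact: ball_open.
  apply/seteqP; split => x /= [].
    by move=> <-; rewrite inordK.
  by move=> E; apply/val_inj; rewrite /= inordK.
have has_s z : D z -> has (fun i => `[< B i z >]) s.
  move=> /(@subset_closure _ D)/Fcov[i /= iF Biz]; apply/hasP; exists i => //.
  exact/asboolP.
move=> /(congr1 val) /=; rewrite !inordK// => E.
have /asboolP := nth_find 0 (has_s _ Dx); have /asboolP := nth_find 0 (has_s _ Dy).
rewrite -/(fd x) -/(fd y) E /B -ball_normE /= => h1 h2.
apply: le_lt_trans (ler_distD (nth 0 s (fd y)) _ _) _.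
by rewrite [ltRHS]splitr ltrD// distrC.
Qed.

End sup_partition.

Section ultrafilter_limits.
Context (R : realType) (T : Type) (U : set_system T).
Context {U_ultra : UltraFilter U}.

(** Compactness gives a cluster point, and a cluster point of an ultrafilter is a limit. *)
Lemma ultrafilter_bounded_cvg (a : T -> R) (B : R) :
  U [set n | `|a n| <= B] -> exists l : R, a @ U --> l.
Proof.
move=> aB.
have : compact `[- B, B]%classic by exact: segment_compact.
case/(_ (fmap a U) _).
  change (U (a @^-1` `[- B, B]%classic)); apply: filterS aB => n /= aBn.
  by rewrite in_itv/= -ler_norml.
move=> l [_ al]; exists l => V Vl.
have [//|nV] := in_ultra_setVsetC (a @^-1` V) U_ultra.
by have [y [nVy Vy]] := al (~` V) V nV Vl.
Qed.

Lemma cvg_bigsum (I : Type) (s : seq I) (f : I -> T -> R) (l : I -> R) :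
  (forall i, f i @ U --> l i) -> (fun n => \sum_(i <- s) f i n) @ U --> \sum_(i <- s) l i.
Proof.
move=> fl; elim: s => [|i s IH].
  by under eq_fun do rewrite big_nil; rewrite big_nil; exact: cvg_cst.
by under eq_fun do rewrite big_cons; rewrite big_cons; exact: cvgD.
Qed.

End ultrafilter_limits.

Section TL1_limit.
Context (R : realType) (d : nat) (D : set 'rV[R]_d).
Hypotheses (D_open : open D).
Variable nu : probability 'rV[R]_d R.
Variables (x : nat -> 'rV[R]_d) (u : nat -> 'rV[R]_d -> R).
Hypothesis xD : forall i, D (x i).
Hypothesis mu_ : forall n, (0 < n)%N -> measurable_fun D (u n).
Variables (q : nat -> nat) (lab : forall k, 'rV[R]_d -> 'I_(q k)) (A diam : R).
Hypothesis mlab : forall k j, measurable [set y | lab k y = j].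
Hypothesis A_ge0 : 0 <= A.
Hypothesis lab_diam : forall k y z, D y -> D z -> lab k y = lab k z ->
  enorm (y - z) <= A * (1 / 2) ^+ k.
Hypothesis D_diam : forall y z, D y -> D z -> enorm (y - z) <= diam.
Hypothesis freq1_cvg : forall k j,
  label_freq R (fun i : 'I_n => lab k (x i)) j @[n --> \oo] -->
    fine (nu [set y | lab k y = j]).
Hypothesis freq2_cvg : forall k l (p : 'I_(q k) * 'I_(q l)),
  label_freq R (fun i : 'I_n => (lab k (x i), lab l (x i))) p @[n --> \oo] -->
    fine (nu [set y | (lab k y, lab l y) = p]).
Hypothesis approx : forall k, exists (B : R) (N : nat), forall n, (N <= n)%N ->
  exists c : 'I_(q k) -> R, (forall j, `|c j| <= B) /\
    \sum_(i < n) `|u n (x i) - c (lab k (x i))| <= n%:R * (A * (1 / 2) ^+ k).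
Variable (U : set_system nat).
Context {U_ultra : UltraFilter U}.
Hypothesis U_oo : forall N, U [set n | (N <= n)%N].

Let cvg_U (V : topologicalType) (a : nat -> V) (l : V) : a @ \oo --> l -> a @ U --> l.
Proof.
move=> al B /al [N _ HN]; change (U (a @^-1` B)).
by apply: filterS (U_oo N) => n Nn; exact: HN.
Qed.

Let mD : measurable D. Proof. exact: open_measurable_rV. Qed.

Lemma measurable_enorm_sub :
  measurable_fun setT (fun z : 'rV[R]_d * 'rV[R]_d => enorm (z.1 - z.2)).
Proof.
have ms : measurable_fun setT (@Num.sqrt R).
  by apply: continuous_measurable_fun; exact: sqrt_continuous.
apply: (measurableT_comp ms); apply: measurable_sum => i.
under eq_fun do rewrite !mxE.
apply: measurable_funX; apply: measurable_funB.
  exact: (measurableT_comp (measurable_coord i) measurable_fst).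
exact: (measurableT_comp (measurable_coord i) measurable_snd).
Qed.

Lemma mlab2 k l (p : 'I_(q k) * 'I_(q l)) : measurable [set y | (lab k y, lab l y) = p].
Proof.
rewrite (_ : [set y | _] = [set y | lab k y = p.1] `&` [set y | lab l y = p.2]).
  exact: measurableI.
by apply/seteqP; split => y /=; [move=> <-|case: p => a b /= [-> ->]].
Qed.

(** Two scales are compared through [u n] on the sample, which both families of coefficients
    approximate; the joint label frequencies in [freq2_cvg] carry this estimate over to [nu] and
    make the step functions [F k] Cauchy. *)
Lemma TL1_ultrafilter_limit : exists2 f : 'rV[R]_d -> R, L1 D nu f &
  forall e : R, 0 < e ->
    U [set n | (dTL1 D (empirical_measure n x, u n) (nu : {measure set _ -> \bar R}, f) < e%:E)%E].
Proof.
have /boolp.choice[BN BNP] : forall k, exists BN : R * nat, forall n, (BN.2 <= n)%N ->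
  exists c : 'I_(q k) -> R, (forall j, `|c j| <= BN.1) /\
    \sum_(i < n) `|u n (x i) - c (lab k (x i))| <= n%:R * (A * (1 / 2) ^+ k).
  by move=> k; have [B [N H]] := approx k; exists (B, N).
have cex k n : exists c : 'I_(q k) -> R, ((BN k).2 <= n)%N ->
    (forall j, `|c j| <= (BN k).1) /\
    \sum_(i < n) `|u n (x i) - c (lab k (x i))| <= n%:R * (A * (1 / 2) ^+ k).
  have [H|H] := leqP (BN k).2 n; last by exists (fun=> 0).
  by have [c cP] := BNP _ _ H; exists c.
pose c k n := projT1 (cid (cex k n)).
have cP k n : ((BN k).2 <= n)%N -> (forall j, `|c k n j| <= (BN k).1) /\
    \sum_(i < n) `|u n (x i) - c k n (lab k (x i))| <= n%:R * (A * (1 / 2) ^+ k).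
  by move=> H; exact: (projT2 (cid (cex k n)) H).
have lex k j : exists l : R, (fun n => c k n j) @ U --> l.
  have cB : U [set n | `|c k n j| <= (BN k).1].
    by apply: filterS (U_oo (BN k).2) => n /cP[cB _]; exact: cB.
  exact: ultrafilter_bounded_cvg cB.
pose cl k j := projT1 (cid (lex k j)).
have clP k j : (fun n => c k n j) @ U --> cl k j := projT2 (cid (lex k j)).
pose F k y := cl k (lab k y).
have mF k : measurable_fun setT (F k) by exact: (measurable_label_fun (@mlab k) (cl k)).
have half0 k : 0 <= (1 / 2 : R) ^+ k by apply: exprn_ge0; lra.
have F_cauchy k l : (\int[nu]_y (`|F k y - F l y|)%:E <=
    (A * (1 / 2) ^+ k + A * (1 / 2) ^+ l)%:E)%E.
  pose g (p : 'I_(q k) * 'I_(q l)) := `|cl k p.1 - cl l p.2|.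
  rewrite (@integral_label_fun _ _ _ _ (fun y => (lab k y, lab l y)) (@mlab2 k l) nu g); last by move=> p; exact: normr_ge0.
  pose b (p : 'I_(q k) * 'I_(q l)) := fine (nu [set y | (lab k y, lab l y) = p]).
  have bE p : nu [set y | (lab k y, lab l y) = p] = (b p)%:E.
    by rewrite fineK// fin_num_measure//; exact: mlab2.
  rewrite (eq_bigr (fun p => (g p * b p)%:E)) => [|p _]; last by rewrite EFinM -bE.
  rewrite sumEFin lee_fin.
  (* The empirical counterpart of the integral. Both functions depend on labels only, so it is a
     finite sum and passes to the limit along [U]. *)
  pose V n := \sum_p `|c k n p.1 - c l n p.2| *
    label_freq R (fun i : 'I_n => (lab k (x i), lab l (x i))) p.
  have Vcvg : V @ U --> \sum_p g p * b p.
    apply: cvg_bigsum => p; apply: cvgM.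
      by apply: cvg_norm; apply: cvgB; exact: clP.
    by apply: cvg_U; exact: freq2_cvg.
  rewrite leNgt; apply/negP => /(cvgr_gt _ Vcvg) H.
  have [n [/= Vn n0]] := filter_ex (filterI H (U_oo (maxn 1 (maxn (BN k).2 (BN l).2)))).
  move: n0; rewrite !geq_max => /and3P[n1 nk nl].
  have nR : 0 < n%:R :> R by rewrite ltr0n.
  move: Vn; apply/negP; rewrite -leNgt.
  have -> : V n = n%:R^-1 * \sum_(i < n) `|c k n (lab k (x i)) - c l n (lab l (x i))|.
    by rewrite (@label_freqE _ _ n x _ (fun y => (lab k y, lab l y)) (fun p => `|c k n p.1 - c l n p.2|)).
  rewrite ler_pdivrMl// mulrDr.
  apply: le_trans (lerD (cP _ _ nk).2 (cP _ _ nl).2).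
  rewrite -big_split/=; apply: ler_sum => i _.
  apply: le_trans (ler_distD (u n (x i)) _ _) _.
  by rewrite lerD2r distrC.
have [g mg Fg] : exists2 g : 'rV[R]_d -> R, measurable_fun setT g &
    forall k, (\int[nu]_y (`|F k y - g y|)%:E <= (2 * (2 * A) * (1 / 2) ^+ k)%:E)%E.
  apply: L1_geometric_limit => // k; apply: le_trans (F_cauchy k k.+1) _.
  rewrite lee_fin exprS; have := mulr_ge0 A_ge0 (half0 k); lra.
exists g.
  apply/integrableP; split.
    by apply: measurable_funTS; exact/measurable_EFinP.
  have mFg : measurable_fun setT (fun y => F 0%N y - g y) by exact: measurable_funB.
  apply: (@le_lt_trans _ _ (\int[nu]_y ((`|F 0%N y|)%:E + (`|F 0%N y - g y|)%:E))%E).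
    apply: (@le_trans _ _ (\int[nu]_y (`|g y|)%:E)%E).
      apply: ge0_subset_integral => //.
      by apply/measurable_EFinP; exact: measurableT_comp.
    apply: ge0_le_integral => //.
    - by apply/measurable_EFinP; exact: measurableT_comp.
    - by apply/measurable_EFinP; apply: measurable_funD; exact: measurableT_comp.
    - move=> y _; rewrite -EFinD lee_fin.
      have := ler_distD (F 0%N y) (g y) 0; rewrite !subr0.
      by have := distrC (g y) (F 0%N y); lra.
  rewrite ge0_integralD//; [|by apply/measurable_EFinP; exact: measurableT_comp..].
  apply: lte_add_pinfty; last by apply: le_lt_trans (Fg 0%N) _; exact: ltry.
  rewrite (@integral_label_fun _ _ _ _ (lab 0%N) (@mlab 0%N) nu (fun j => `|cl 0%N j|)); last by move=> j; exact: normr_ge0.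
  apply: lte_sum_pinfty => j _; apply: lte_mul_pinfty => //.
  by apply: le_lt_trans (probability_le1 _ _) (ltry 1); exact: mlab.
move=> e e0.
(* The contributions bounded below are A h, 4 A h and (A + 2) h. *)
have [k ke] : exists k, (7 * A + 3) * (1 / 2) ^+ k < e.
  have : (fun k => (7 * A + 3) * (1 / 2) ^+ k : R) @ \oo --> (7 * A + 3) * 0.
    apply: cvgM; first exact: cvg_cst.
    by apply: cvg_expr; rewrite ger0_norm; lra.
  rewrite mulr0 => /cvgrPdist_lt/(_ _ e0)[k _ H]; exists k.
  have := H k (leqnn k); rewrite /= sub0r normrN; apply: le_lt_trans; exact: ler_norm.
set h := (1 / 2 : R) ^+ k in ke.
have h0 : 0 < h by apply: exprn_gt0; lra.
have h1 : h <= 1 by apply: exprn_ile1; lra.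
have A' := A_ge0.
pose B := Num.max (BN k).1 0; have B0 : 0 <= B by rewrite le_max lexx orbT.
(* Bounds the cost where the labels differ: the diameter, a coefficient of size at most [B], and a
   limit coefficient of size at most B + 1 since it is within h <= 1 of one. *)
pose E := Num.max diam 0 + 2 * B + 1.
have diam0 : 0 <= Num.max diam 0 by rewrite le_max lexx orbT.
have E0 : 0 < E by rewrite /E; lra.
have Uc : U [set n | forall j, `|cl k j - c k n j| < h].
  apply: (@filter_forall _ _ (fun j => [set n | `|cl k j - c k n j| < h]) U _) => j.
  by have /cvgrPdist_lt/(_ _ h0) := clP k j.
have Uf : U [set n | \sum_j `|label_freq R (fun i : 'I_n => lab k (x i)) j -
    fine (nu [set y | lab k y = j])| < h / E].
  have : (fun n => \sum_j `|label_freq R (fun i : 'I_n => lab k (x i)) j -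
    fine (nu [set y | lab k y = j])|) @ U --> \sum_(j < q k) (0 : R).
    apply: cvg_bigsum => j; rewrite -[X in _ --> X](@normr0 _ R).
    apply: cvg_norm; rewrite -(subrr (fine (nu [set y | lab k y = j]))).
    by apply: cvgB; [apply: cvg_U; exact: freq1_cvg|exact: cvg_cst].
  by rewrite big1// => /cvgr_lt; apply; exact: divr_gt0.
apply: filterS (filterI (filterI Uc Uf) (U_oo (maxn 1 (BN k).2))) => n [[/= cn fn]]; rewrite geq_max => /andP[n0 nN].
have [pi cpl pineq] := exists_coupling nu x n0 (@mlab k).
have [cB cu] := cP _ _ nN.
have nR : 0 < n%:R :> R by rewrite ltr0n.
apply: (@le_lt_trans _ _ (\int[pi]_(z in D `*` D)
    (enorm (z.1 - z.2) + `|u n z.1 - g z.2|)%:E)%E).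
  by apply: ereal_inf_lbound; exists pi.
apply: le_lt_trans (_ : _ <= ((7 * A + 3) * h)%:E)%E _; last by rewrite lte_fin.
have mDD : measurable (D `*` D) by exact: measurableX.
pose F1 y := `|u n y - c k n (lab k y)|.
pose F2 y := `|F k y - g y|.
have mc : measurable_fun setT (fun y => c k n (lab k y)).
  exact: (measurable_label_fun (@mlab k) (c k n)).
have mF1 : measurable_fun D F1.
  apply: measurableT_comp => //; apply: measurable_funB; first exact: mu_.
  exact: measurable_funTS.
have mF2 : measurable_fun D F2.
  by apply: measurable_funTS; apply: measurableT_comp => //; exact: measurable_funB.
have fstD (f : 'rV[R]_d -> R) : measurable_fun D f ->
    measurable_fun (D `*` D) (fun z : 'rV[R]_d * 'rV[R]_d => f z.1).
  move=> mf; apply: (measurable_comp mD _ mf); first by move=> _ [z [Dz _] <-].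
  by apply: measurable_funTS; exact: measurable_fst.
have sndD (f : 'rV[R]_d -> R) : measurable_fun D f ->
    measurable_fun (D `*` D) (fun z : 'rV[R]_d * 'rV[R]_d => f z.2).
  move=> mf; apply: (measurable_comp mD _ mf); first by move=> _ [z [_ Dz] <-].
  by apply: measurable_funTS; exact: measurable_snd.
pose neq := [set z : 'rV[R]_d * 'rV[R]_d | lab k z.1 != lab k z.2].
pose lab2 (z : 'rV[R]_d * 'rV[R]_d) := (lab k z.1, lab k z.2).
have mlab22 p : measurable [set z | lab2 z = p].
  rewrite (_ : [set z | _] = [set y | lab k y = p.1] `*` [set y | lab k y = p.2]).
    exact: measurableX.
  by apply/seteqP; split => z; rewrite /lab2 /=; [move=> <-|case: p => a b /= [-> ->]].
(* (A + 1) h collects the diameter A h of a class and the error h of the coefficients; [E] is paid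
   only when the labels differ. *)
pose H z : R := (A + 1) * h + (if (lab2 z).1 != (lab2 z).2 then E else 0).
have mH : measurable_fun setT H.
  exact: (measurable_label_fun mlab22 (fun p => (A + 1) * h + (if p.1 != p.2 then E else 0))).
have Ah : 0 <= A * h by rewrite mulr_ge0// ltW.
have H0 z : 0 <= H z by rewrite /H; case: ifP => _; lra.
have pt z : (D `*` D) z -> enorm (z.1 - z.2) + `|u n z.1 - g z.2| <= F1 z.1 + F2 z.2 + H z.
  move=> [Dz1 Dz2].
  have tri : `|u n z.1 - g z.2| <= F1 z.1 + F2 z.2 + `|c k n (lab k z.1) - cl k (lab k z.2)|.
    have := ler_distD (c k n (lab k z.1)) (u n z.1) (g z.2).
    have := ler_distD (cl k (lab k z.2)) (c k n (lab k z.1)) (g z.2).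
    rewrite /F1 /F2 /F; lra.
  have [zE|zN] := eqVneq (lab k z.1) (lab k z.2).
    have := lab_diam Dz1 Dz2 zE; have := cn (lab k z.2).
    rewrite distrC -/h /H /lab2 /= zE eqxx/=; rewrite zE in tri; lra.
  have := D_diam Dz1 Dz2; have := cn (lab k z.2).
  have := cB (lab k z.1); have := cB (lab k z.2).
  have : (BN k).1 <= B by rewrite le_max lexx.
  have : diam <= Num.max diam 0 by rewrite le_max lexx.
  have := ler_normB (c k n (lab k z.1)) (cl k (lab k z.2)).
  have := ler_distD (c k n (lab k z.2)) (cl k (lab k z.2)) 0.
  rewrite !subr0 /H /lab2 /= zN /= /E; lra.
have m1 : measurable_fun (D `*` D) (fun z => (F1 z.1)%:E) by apply/measurable_EFinP; exact: (fstD F1).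
have m2 : measurable_fun (D `*` D) (fun z => (F2 z.2)%:E) by apply/measurable_EFinP; exact: (sndD F2).
have m3 : measurable_fun setT (fun z => (H z)%:E) by exact/measurable_EFinP.
have mG : measurable_fun (D `*` D) (fun z => (enorm (z.1 - z.2) + `|u n z.1 - g z.2|)%:E).
  apply/measurable_EFinP; apply: measurable_funD.
    by apply: measurable_funTS; exact: measurable_enorm_sub.
  apply: measurableT_comp => //; apply: measurable_funB.
    by apply: (fstD (u n)); exact: mu_.
  by apply: (sndD g); exact: measurable_funTS.
have m123 := emeasurable_funD (emeasurable_funD m1 m2) (measurable_funTS m3 (D := D `*` D)).
have G0 z : (D `*` D) z -> (0 <= (enorm (z.1 - z.2) + `|u n z.1 - g z.2|)%:E)%E.
  by move=> _; rewrite lee_fin addr_ge0 ?enorm_ge0.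
apply: (@le_trans _ _ (\int[pi]_(z in D `*` D) ((F1 z.1)%:E + (F2 z.2)%:E + (H z)%:E))%E).
  apply: (ge0_le_integral pi mDD G0 mG m123) => z Dz.
  by rewrite -!EFinD lee_fin; exact: pt.
have p1 z : (D `*` D) z -> (0 <= (F1 z.1)%:E)%E by move=> _; rewrite lee_fin normr_ge0.
have p2 z : (D `*` D) z -> (0 <= (F2 z.2)%:E)%E by move=> _; rewrite lee_fin normr_ge0.
have p3 z : (D `*` D) z -> (0 <= (H z)%:E)%E by move=> _; rewrite lee_fin.
have p12 z : (D `*` D) z -> (0 <= (F1 z.1)%:E + (F2 z.2)%:E)%E.
  by move=> Dz; rewrite adde_ge0 ?p1 ?p2.
rewrite (ge0_integralD pi mDD p12 (emeasurable_funD m1 m2) p3 (measurable_funTS m3)).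
rewrite (ge0_integralD pi mDD p1 m1 p2 m2).
have i1 : (\int[pi]_(z in D `*` D) (F1 z.1)%:E <= (A * h)%:E)%E.
  apply: (le_trans (coupling_integral_fst mD cpl mF1 _)); first by move=> *; exact: normr_ge0.
  rewrite integral_empirical//; last by move=> *; exact: normr_ge0.
  by rewrite lee_fin ler_pdivrMl.
have i2 : (\int[pi]_(z in D `*` D) (F2 z.2)%:E <= (4 * A * h)%:E)%E.
  apply: (le_trans (coupling_integral_snd mD cpl mF2 _)); first by move=> *; exact: normr_ge0.
  apply: (@le_trans _ _ (\int[nu]_y (F2 y)%:E)%E).
    apply: (ge0_subset_integral nu mD measurableT) => // [|y _].
      by apply/measurable_EFinP; apply: measurableT_comp => //; exact: measurable_funB.
    by rewrite lee_fin normr_ge0.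
  apply: le_trans (Fg k) _; rewrite lee_fin -/h; lra.
have i3 : (\int[pi]_(z in D `*` D) (H z)%:E <= ((A + 2) * h)%:E)%E.
  apply: (@le_trans _ _ (\int[pi]_z (H z)%:E)%E); first by apply: (ge0_subset_integral pi mDD measurableT m3) => // z _; rewrite lee_fin.
  have mneq : measurable neq.
    exact: (measurable_label mlab22 [set p | p.1 != p.2]).
  have -> : (\int[pi]_z (H z)%:E = \int[pi]_z ((cst ((A + 1) * h)%:E z) + E%:E * (\1_neq z)%:E))%E.
    apply: eq_integral => z _; rewrite /H EFinD indicE; congr (_ + _)%E.
    case: ifPn => zn; first by rewrite mem_set// mule1.
    by rewrite memNset ?mule0//; exact/negP.
  have mi : measurable_fun setT (fun z => (\1_neq z)%:E : \bar R).
    by apply/measurable_EFinP; exact: measurable_indic.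
  have c0 z : [set: 'rV[R]_d * 'rV[R]_d] z -> (0 <= cst ((A + 1) * h)%:E z)%E.
    by move=> _; rewrite lee_fin; lra.
  have e0' z : [set: 'rV[R]_d * 'rV[R]_d] z -> (0 <= E%:E * (\1_neq z)%:E)%E.
    by move=> _; rewrite mule_ge0 ?lee_fin// ltW.
  have mE : measurable_fun setT (fun z => E%:E * (\1_neq z)%:E)%E by exact: measurable_funeM.
  rewrite (ge0_integralD pi measurableT c0 (measurable_cst _) e0' mE).
  have -> : (\int[pi]_z cst ((A + 1) * h)%:E z = ((A + 1) * h)%:E)%E.
    rewrite integral_cst//; apply: (etrans (congr1 (mule _) (probability_setT pi))); exact: mule1.
  rewrite (ge0_integralZl pi measurableT mi) ?lee_fin ?(ltW E0)//.
  rewrite integral_indic// setIT.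
  apply: (@le_trans _ _ (((A + 1) * h)%:E + E%:E * (h / E)%:E)%E).
    rewrite leeD2l// lee_wpmul2l ?lee_fin ?(ltW E0)//.
    by apply: le_trans pineq _; rewrite lee_fin ltW.
  rewrite -EFinM -EFinD lee_fin mulrCA divff ?lt0r_neq0// mulr1; lra.
apply: (le_trans (leeD (leeD i1 i2) i3)); rewrite -!EFinD lee_fin; lra.
Qed.

End TL1_limit.

(** * From ultrafilter limits to convergent subsequences *)

Section relative_compactness.
Context (R : realType) (d : nat) (D : set 'rV[R]_d).

Lemma leq_increasing_seq (phi : nat -> nat) k : increasing_seq phi -> (k <= phi k)%N.
Proof.
move=> /increasing_seqP ip; elim: k => // k IH.
exact: leq_ltn_trans (ip k).
Qed.

Lemma dTL1_ge0 (p q : {measure set 'rV[R]_d -> \bar R} * ('rV[R]_d -> R)) :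
  (0 <= dTL1 D p q)%E.
Proof.
apply: le_ereal_inf_tmp => _ [pi _ <-]; apply: integral_ge0 => z _.
by rewrite lee_fin addr_ge0 ?enorm_ge0.
Qed.

(** Given [phi], choose an ultrafilter finer than the image of the tails under k -> phi k + 1. Every
    ball around its limit [p] then contains terms of the subsequence with arbitrarily large index,
    and [psi] picks them one by one. The shift by 1 reflects that the sequence starts at n = 1. *)
Lemma TL1_relatively_compact_ultra
    (s : nat -> {measure set 'rV[R]_d -> \bar R} * ('rV[R]_d -> R)) :
  (forall k, TL1 D (s k.+1)) ->
  (forall U : set_system nat, UltraFilter U -> (forall N, U [set n | (N <= n)%N]) ->
    exists2 p, TL1 D p & forall e : R, 0 < e -> U [set n | (dTL1 D (s n) p < e%:E)%E]) ->
  TL1_relatively_compact D (fun k => s k.+1).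
Proof.
move=> sT Ulim; split => // phi iphi.
pose F : set_system nat := fmap (fun k => (phi k).+1) (nbhs \oo).
have [U [UU FU]] := ultraFilterLemma (_ : ProperFilter F).
have Utail m : U [set n | exists2 k, (m <= k)%N & n = (phi k).+1].
  by apply: FU; exists m => // k /= mk; exists k.
have [|p Tp Up] := Ulim U UU.
  move=> N; apply: filterS (Utail N) => _ /= [k Nk ->].
  by rewrite (leq_trans Nk)// leqW// leq_increasing_seq.
have step m (i : nat) : exists k, (m < k)%N /\ (dTL1 D (s (phi k).+1) p < (i.+1%:R^-1)%:E)%E.
  have i0 : 0 < i.+1%:R^-1 :> R by rewrite invr_gt0.
  have [n [/= nd [k mk nE]]] := filter_ex (filterI (Up _ i0) (Utail m.+1)).
  by exists k; split => //; rewrite -nE.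
have {step} step mi : exists k, (mi.1 < k)%N /\
    (dTL1 D (s (phi k).+1) p < (mi.2.+1%:R^-1)%:E)%E by exact: step.
have /boolp.choice[g gP] := step.
(* [g] receives the previous index and the required precision, and returns a strictly larger
   index. *)
pose psi := fix psi i := if i is i'.+1 then g (psi i', i) else g (0%N, 0%N).
have psi_lt i : (dTL1 D (s (phi (psi i)).+1) p < (i.+1%:R^-1)%:E)%E.
  by case: i => [|i]; [have [_ H] := gP (0%N, 0%N)|have [_ H] := gP (psi i, i.+1)].
exists psi; split.
  by apply/increasing_seqP => i; have [H _] := gP (psi i, i.+1).
exists p => //.
apply: (@squeeze_cvge _ _ _ _ (fun=> 0%E) _ (fun i => (i.+1%:R^-1)%:E)).
- by apply: nearW => i; rewrite dTL1_ge0/= ltW.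
- exact: cvg_cst.
- by apply: cvg_EFin; [exact: nearW|exact: cvg_harmonic].
Qed.

End relative_compactness.

(** The value at n = 1 keeps the supremum above -oo, so it is a real number. *)
Lemma ereal_sup_real_bound (R : realType) (f : nat -> R) :
  (ereal_sup [set (f n)%:E | n in [set n | 0 < n]%N] < +oo)%E ->
  exists B, forall n, (0 < n)%N -> f n <= B.
Proof.
move=> supf; have ub n : (0 < n)%N ->
    ((f n)%:E <= ereal_sup [set (f n)%:E | n in [set n | 0 < n]%N])%E.
  by move=> n0; apply: ereal_sup_ubound; exists n.
exists (fine (ereal_sup [set (f n)%:E | n in [set n | 0 < n]%N])) => n n0.
rewrite -lee_fin fineK; first exact: ub.
rewrite fin_numElt supf andbT; apply: lt_le_trans (ub 1%N isT).
exact: ltNyr.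
Qed.

(** * Almost sure frequencies and the choice of the dyadic scales *)

Section almost_sure_frequencies.
Context (R : realType) (d : nat) (dO : measure_display) (Omega : measurableType dO).
Context (P : probability Omega R) (nu : probability 'rV[R]_d R).
Context (X : nat -> {RV P >-> 'rV[R]_d}) (X_iid : iid nu X).

Lemma label_freq_hits (J : finType) (lab : 'rV[R]_d -> J) j n w :
  label_freq R (fun i : 'I_n => lab (X i w)) j =
  (hits X n [set y | lab y = j] w)%:R / n%:R.
Proof.
rewrite /label_freq /hits; congr (_ / _).
rewrite big_mkcond natr_sum; apply: eq_bigr => i _.
case: eqP => H; first by rewrite mem_set.
by rewrite memNset.
Qed.

Lemma ae_label_freq_cvg (J : finType) (lab : 'rV[R]_d -> J) :
  (forall j, measurable [set y | lab y = j]) ->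
  {ae P, forall w, forall j, label_freq R (fun i : 'I_n => lab (X i w)) j
    @[n --> \oo] --> fine (nu [set y | lab y = j])}.
Proof.
move=> mlab; apply: filter_forall => j.
apply: filterS (strong_law_of_large_numbers X_iid (mlab j)) => w.
by under [in X in _ -> X]eq_fun do rewrite label_freq_hits.
Qed.

End almost_sure_frequencies.

Theorem theorem1p2 (R : realType) (d : nat) (hd : (2 <= d)%N)
  (D : set 'rV[R]_d)
  (D_open : open D) (D_bounded : bounded_set D) (D_connected : connected D)
  (D_lipschitz : lipschitz_boundary D)
  (nu : probability 'rV[R]_d R) (rho : 'rV[R]_d -> R)
  (nu_density : has_density_on D nu rho)
  (rho_continuous : {within D, continuous rho})
  (rho_bounds : exists m M : R, 0 < m /\ forall x, D x -> m <= rho x <= M)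
  (dO : measure_display) (Omega : measurableType dO) (P : probability Omega R)
  (X : nat -> {RV P >-> 'rV[R]_d}) (X_iid : iid nu X)
  (eps : nat -> R) (eps_gt0 : forall n, (0 < n)%N -> 0 < eps n)
  (eps_to0 : eps n @[n --> \oo] --> 0)
  (eps_rate2 : d = 2%N ->
    (ln n%:R `^ (3 / 4) / n%:R `^ (1 / 2) * (eps n)^-1) @[n --> \oo] --> 0)
  (eps_rate3 : (3 <= d)%N ->
    (ln n%:R `^ (1 / d%:R) / n%:R `^ (1 / d%:R) * (eps n)^-1)
      @[n --> \oo] --> 0)
  (eta : R -> R) (eta_ge0 : forall r, 0 <= r -> 0 <= eta r)
  (K1 : 0 < eta 0 /\ eta r @[r --> 0^'+] --> eta 0)
  (K2 : forall r s, 0 <= r -> r <= s -> eta s <= eta r)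
  (K3 : (\int[lebesgue_measure]_(r in `[0%R, +oo[) (eta r * r ^+ d)%:E
         < +oo)%E) :
  {ae P, forall w : Omega,
    forall u : nat -> 'rV[R]_d -> R,
    let x i := X i w in
    (forall n, (0 < n)%N -> L1 D (empirical_measure n x) (u n)) ->
    (ereal_sup [set L1norm D (empirical_measure n x) (u n) | n in [set n | 0 < n]%N]
       < +oo)%E ->
    (ereal_sup [set (GTV eta n (eps n) x (u n))%:E | n in [set n | 0 < n]%N]
       < +oo)%E ->
    TL1_relatively_compact D (fun k => (empirical_measure k.+1 x, u k.+1))}.
Proof.
have d0 : (0 < d)%N by exact: leq_trans hd.
have [K [e [r [kappa [r0 k0 e1 cone]]]]] := uniform_inward_cone D_open D_bounded D_lipschitz.
have [a [b [a0 b0 etaa]]] := kernel_ge_near0 K1.1 K1.2 K2.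
have [m [M0 [m0 rhoM0]]] := rho_bounds.
(* The maximum gives m <= M without choosing a point of [D]. *)
pose M := Num.max M0 m.
have mM : m <= M by rewrite le_max lexx orbT.
have M_gt0 : 0 < M by exact: lt_le_trans mM.
have rhoM y : D y -> m <= rho y <= M.
  by move=> /rhoM0/andP[-> h]; rewrite le_max h.
have [c [C0 [delta0 [c0 C00 de0 approx]]]] :=
  piecewise_constant_approx d0 r0 k0 e1 cone eta_ge0 a0 b0 etaa eps_gt0 eps_to0 m0 mM.
have [Kb Kb0 DKb] : exists2 Kb : R, 0 <= Kb & forall y, D y -> `|y| <= Kb.
  have [B [_ HB]] := D_bounded; exists (Num.max 0 (B + 1)); first by rewrite le_max lexx.
  by move=> y Dy; rewrite le_max; apply/orP; right; apply: HB => //; rewrite ltrDl.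
pose delta k := delta0 * (1 / 2) ^+ k.
have half_gt0 k : 0 < (1 / 2 : R) ^+ k by apply: exprn_gt0; lra.
have delta_gt0 k : 0 < delta k by rewrite mulr_gt0.
(* The partitions are fixed before the sample, so the frequencies concern countably many classes and
   pairs of classes. *)
have part k : {q : nat & {lab : 'rV[R]_d -> 'I_q |
    (forall j, measurable [set x | lab x = j]) /\
    forall x y, D x -> D y -> lab x = lab y -> `|x - y| < delta k}}.
  have /cid[q /cid[lab H]] := fine_partition D_bounded (delta_gt0 k).
  by exists q, lab.
pose q k := projT1 (part k).
pose lab k : 'rV[R]_d -> 'I_(q k) := sval (projT2 (part k)).
have mlab k j : measurable [set x | lab k x = j] := (svalP (projT2 (part k))).1 j.
have labD k x y : D x -> D y -> lab k x = lab k y -> `|x - y| < delta k :=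
  (svalP (projT2 (part k))).2 x y.
pose s n := c * eps n.
have [N0 HN0] : exists N, forall n, (N <= n)%N -> 0 < s n <= 1.
  have c1 : 0 < c^-1 by rewrite invr_gt0.
  have /cvgrPdist_lt/(_ _ c1)[N _ HN] := eps_to0.
  exists N.+1 => n Nn; have e0 : 0 < eps n by apply: eps_gt0; exact: leq_trans Nn.
  rewrite /s mulr_gt0//=; have := HN n (ltnW Nn).
  rewrite /= sub0r normrN gtr0_norm// => /ltW h.
  by rewrite -(mulfV (lt0r_neq0 c0)) ler_pM2l.
have rate A : 0 < A -> exists N, forall n, (N <= n)%N -> A * ln n%:R <= n%:R * s n ^+ d.
  move=> A0; have cd : 0 < c ^+ d by exact: exprn_gt0.
  have [N HN] := log_le_of_rate hd eps_gt0 eps_rate2 eps_rate3 (divr_gt0 A0 cd).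
  exists N => n /HN; rewrite mulrAC ler_pdivrMr// /s exprMn => h.
  by rewrite [c ^+ d * _]mulrC mulrA.
have ae1 := cells_concentration D_open nu_density rho_continuous m0 M_gt0 rhoM X_iid
  Kb0 DKb HN0 rate.
have ae2 : {ae P, forall w, forall k j, label_freq R (fun i : 'I_n => lab k (X i w)) j
    @[n --> \oo] --> fine (nu [set y | lab k y = j])}.
  apply: (@ae_foralln _ _ _ P (fun k w => forall j,
    label_freq R (fun i : 'I_n => lab k (X i w)) j
    @[n --> \oo] --> fine (nu [set y | lab k y = j]))) => k.
  exact: (ae_label_freq_cvg X_iid (mlab k)).
have ae3 : {ae P, forall w, forall k l p,
    label_freq R (fun i : 'I_n => (lab k (X i w), lab l (X i w))) p
    @[n --> \oo] --> fine (nu [set y | (lab k y, lab l y) = p])}.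
  apply: (@ae_foralln _ _ _ P (fun k w => forall l p,
    label_freq R (fun i : 'I_n => (lab k (X i w), lab l (X i w))) p
    @[n --> \oo] --> fine (nu [set y | (lab k y, lab l y) = p]))) => k.
  apply: (@ae_foralln _ _ _ P (fun l w => forall p,
    label_freq R (fun i : 'I_n => (lab k (X i w), lab l (X i w))) p
    @[n --> \oo] --> fine (nu [set y | (lab k y, lab l y) = p]))) => l.
  apply: (ae_label_freq_cvg X_iid (lab := fun y => (lab k y, lab l y))) => p.
  exact: mlab2.
have mD : measurable D by exact: open_measurable_rV.
have nuD := density_full D_open nu_density.
(* The three events do not depend on [u]; everything after this line is deterministic. *)
move: ae1 ae2 ae3; apply: filterS3 => w [xD [N1 counts]] freq1 freq2 u uL1 uB uG.
pose x i := X i w.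
have mu_ n : (0 < n)%N -> measurable_fun D (u n).
  by move=> n0; have /integrableP[/measurable_EFinP] := uL1 n n0.
have L1E n : (0 < n)%N ->
    L1norm D (empirical_measure n x) (u n) = (n%:R^-1 * \sum_(i < n) `|u n (x i)|)%:E.
  move=> n0; rewrite /L1norm (@integral_empirical _ _ _ mD n x (fun y => `|u n y|))//.
  by apply: measurableT_comp => //; exact: mu_.
have [B HB] : exists B, forall n, (0 < n)%N -> n%:R^-1 * \sum_(i < n) `|u n (x i)| <= B.
  apply: ereal_sup_real_bound; apply: le_lt_trans uB.
  by apply: ereal_sup_le => _ [n n0 <-]; exists n => //; rewrite L1E.
have [G HG] := ereal_sup_real_bound uG.
have HB' n : (0 < n)%N -> \sum_(i < n) `|u n (x i)| <= n%:R * B.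
  by move=> n0; rewrite -ler_pdivrMl ?HB// ltr0n.
have app k : exists (Bd : R) (N : nat), forall n, (N <= n)%N -> exists c : 'I_(q k) -> R,
      (forall j, `|c j| <= Bd) /\
      \sum_(i < n) `|u n (x i) - c (lab k (x i))| <= n%:R * (C0 * G * delta k).
  apply: (approx x u N1 B G xD counts HB' HG (delta k) (delta_gt0 k) _ _ (lab k) (labD k)).
  rewrite /delta ler_piMr ?(ltW de0)//; apply: exprn_ile1; lra.
(* [A] has to dominate both the approximation error and the Euclidean diameter of the classes; the
   second term makes it nonnegative. *)
pose A := Num.max (C0 * G * delta0) (d%:R * delta0).
have A0 : 0 <= A by rewrite le_max; apply/orP; right; rewrite mulr_ge0// ltW.
apply: (@TL1_relatively_compact_ultra _ _ _ (fun n => (empirical_measure n x, u n))).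
  move=> k; have kR : k.+1%:R != 0 :> R by rewrite pnatr_eq0.
  split => /=; last exact: uL1.
    rewrite empirical_measureE (eq_bigr (fun=> 1)) ?sumr_const ?card_ord ?mulVf//.
    by move=> i _; rewrite mem_set.
  rewrite empirical_measureE (eq_bigr (fun=> 1)) ?sumr_const ?card_ord ?mulVf//.
  by move=> i _; rewrite mem_set; [|exact: xD].
move=> U UU Uoo.
have [||k|f fL1 Uf] := @TL1_ultrafilter_limit R d D D_open nu x u xD mu_ q lab A
    (d%:R * (2 * Kb)) mlab A0 _ _ freq1 freq2 _ U UU Uoo.
- move=> k y z Dy Dz yz; apply: (le_trans (enorm_le_norm _)).
  have AE : d%:R * delta0 <= A by rewrite le_max lexx orbT.
  apply: (@le_trans _ _ (d%:R * delta0 * (1 / 2) ^+ k)); last first.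
    by rewrite ler_wpM2r// ltW.
  by rewrite -mulrA ler_wpM2l// ltW// labD.
- move=> y z /DKb yK /DKb zK; apply: (le_trans (enorm_le_norm _)).
  by rewrite ler_wpM2l//; apply: (le_trans (ler_normB _ _)); lra.
- have [Bd [N HN]] := app k; exists Bd, N => n /HN[cc [ccB ccS]]; exists cc; split => //.
  apply: (le_trans ccS); rewrite ler_wpM2l// /delta mulrA ler_wpM2r ?(ltW (half_gt0 k))//.
  by rewrite le_max lexx.
exists (nu : {measure set 'rV[R]_d -> \bar R}, f) => //.
by split => //=; exact: probability_setT.
Qed.
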